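(* Let $(M,J)$ be a complex nilmanifold of real dimension six endowed with an invariant complex structure $J$. An invariant $J$-Hermitian metric on $M$ is $1$-st Gauduchon if and only if it is SKT.
   Context: A nilmanifold is a compact quotient $M=\Gamma\backslash G$ of a simply-connected nilpotent Lie group $G$ by a lattice $\Gamma$ of maximal rank. A complex structure or a metric on $M$ is invariant if it is induced by a left-invariant one on $G$. For a $J$-Hermitian metric $g$ on a complex manifold of complex dimension $n$, with fundamental $2$-form $\Omega(\cdot,\cdot)=g(J\cdot,\cdot)$, $g$ is $1$-st Gauduchon if $\partial\overline{\partial}\Omega\wedge\Omega^{n-2}=0$ (here $n=3$), and $g$ is SKT (strong Kähler with torsion) if $\partial\overline{\partial}\Omega=0$. *)

(* Defs.v *)
Set Warnings "-notation-overridden,-ambiguous-paths,-notation-incompatible-prefix".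
From HB Require Import structures.
From mathcomp Require Import all_boot all_order all_algebra perm.
From mathcomp Require Import complex.
From mathcomp Require Import all_classical all_reals all_analysis.
Set Implicit Arguments.
Unset Strict Implicit.
Unset Printing Implicit Defensive.
Import Order.TTheory GRing.Theory Num.Theory.
Import numFieldNormedType.Exports.
Local Open Scope classical_set_scope.
Local Open Scope ring_scope.
Local Open Scope complex_scope.

#[short(type="topGroupType")]
HB.structure Definition TopGroup := {G of Topological G & Group G}.

Section SmoothMaps.
Context {R : realType}.

(* For [U] open: all iterated directional derivatives of [f] of order at most
   [k] exist on [U], are Frechet differentiable (continuous, at order [k]). *)
Fixpoint Ck (V W : normedModType R) (k : nat) (U : set V) (f : V -> W) : Prop :=
  if k is k'.+1 then
    (forall x, U x -> differentiable f x) /\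
    (forall v, Ck k' U (fun x => 'D_v f x))
  else forall x, U x -> {for x, continuous f}.

Definition smooth_on (V W : normedModType R) (U : set V) (f : V -> W) :=
  forall k, Ck k U f.

End SmoothMaps.

Section Manifolds.
Context {R : realType} {m : nat}.

(* [cinv] is only meaningful on [cran]. *)
Record chart (T : topologicalType) := Chart {
  cdom : set T;
  cmap : T -> 'rV[R]_m;
  cinv : 'rV[R]_m -> T
}.

Definition cran (T : topologicalType) (c : chart T) : set 'rV[R]_m :=
  cmap c @` cdom c.

Record is_chart (T : topologicalType) (c : chart T) : Prop := {
  chart_dom_open : open (cdom c);
  chart_ran_open : open (cran c);
  chart_mapK : forall x, cdom c x -> cinv c (cmap c x) = x;
  chart_map_cts : forall x, cdom c x -> {for x, continuous (cmap c)};
  chart_inv_cts : forall u, cran c u -> {for u, continuous (cinv c)}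
}.

(* [A] makes [T] a smooth manifold of dimension [m]; it need not be maximal. *)
Record smooth_atlas (T : topologicalType) (A : set (chart T)) : Prop := {
  atlas_hausdorff : hausdorff_space T;
  atlas_countable : @second_countable T;
  atlas_chart : forall c, A c -> is_chart c;
  atlas_cover : forall x, exists2 c, A c & cdom c x;
  atlas_transition : forall c d, A c -> A d ->
    smooth_on (cmap c @` (cdom c `&` cdom d)) (cmap d \o cinv c)
}.

Definition local_rep (M N : topologicalType) (c : chart M) (d : chart N)
    (f : M -> N) : 'rV[R]_m -> 'rV[R]_m :=
  cmap d \o f \o cinv c.

Definition smooth_map_on (M N : topologicalType)
    (AM : set (chart M)) (AN : set (chart N)) (U : set M) (f : M -> N) :=
  (forall x, U x -> {for x, continuous f}) /\
  (forall c d, AM c -> AN d ->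
    smooth_on (cmap c @` (U `&` cdom c `&` f @^-1` cdom d)) (local_rep c d f)).

Definition local_diffeo (M N : topologicalType)
    (AM : set (chart M)) (AN : set (chart N)) (f : M -> N) :=
  smooth_map_on AM AN setT f /\
  (forall x, exists (U : set M) (s : N -> M),
    [/\ open U, U x, open (f @` U), forall y, U y -> s (f y) = y &
        smooth_map_on AN AM (f @` U) s]).

Definition path_connected (T : topologicalType) :=
  forall x y : T, exists p : R -> T,
    [/\ {within `[0, 1], continuous p}, p 0 = x & p 1 = y].

Definition simply_connected (T : topologicalType) :=
  path_connected T /\
  forall p : R -> T, {within `[0, 1], continuous p} -> p 0 = p 1 ->
    exists H : R * R -> T,
      [/\ {within `[0, 1] `*` `[0, 1], continuous H},
          forall s, s \in `[0, 1] -> H (s, 0) = p s,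
          forall s, s \in `[0, 1] -> H (s, 1) = p 0,
          forall t, t \in `[0, 1] -> H (0, t) = p 0 &
          forall t, t \in `[0, 1] -> H (1, t) = p 0].

End Manifolds.
Arguments chart : clear implicits.
Arguments path_connected R T : clear implicits.
Arguments simply_connected R T : clear implicits.

Section Groups.
Local Open Scope group_scope.

Definition is_subgroup (G : groupType) (H : set G) : Prop :=
  H 1 /\ forall x y, H x -> H y -> H (x * y^-1).

Fixpoint lower_central (G : groupType) (k : nat) : set G :=
  if k is k'.+1 then
    smallest (@is_subgroup G)
      [set z | exists x y, lower_central k' x /\ z = [~ x, y]]
  else setT.

Definition nilpotent_group (G : groupType) : Prop :=
  exists k, lower_central k = [set (1 : G)].

Record lie_group (R : realType) (m : nat) (G : topGroupType)
    (A : set (chart R m G)) : Prop := {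
  lie_atlas : smooth_atlas A;
  lie_mul_cts : continuous (fun p : G * G => p.1 * p.2);
  lie_mul_smooth : forall c1 c2 d, A c1 -> A c2 -> A d ->
    smooth_on
      [set u : 'rV[R]_m * 'rV[R]_m | [/\ cran c1 u.1, cran c2 u.2 &
         cdom d (cinv c1 u.1 * cinv c2 u.2)]]
      (fun u => cmap d (cinv c1 u.1 * cinv c2 u.2));
  lie_inv_smooth : smooth_map_on A A setT (fun x : G => x^-1)
}.

(* [M], with its covering map [pr], is the quotient of [G] by left
   translations by [Gamma]; [M] compact makes [Gamma] of maximal rank. *)
Record nilmanifold (R : realType) (m : nat)
    (G : topGroupType) (AG : set (chart R m G)) (Gamma : set G)
    (M : topologicalType) (AM : set (chart R m M)) (pr : G -> M) : Prop := {
  nil_lie : lie_group AG;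
  nil_simply_connected : simply_connected R G;
  nil_nilpotent : nilpotent_group G;
  nil_subgroup : is_subgroup Gamma;
  nil_discrete : exists2 U : set G, open U & U `&` Gamma = [set 1];
  nil_atlas : smooth_atlas AM;
  nil_compact : compact [set: M];
  nil_surj : forall y, exists x, pr x = y;
  nil_fibre : forall x y, pr x = pr y <-> exists2 a, Gamma a & y = a * x;
  nil_covering : local_diffeo AG AM pr
}.

End Groups.

(* A tensor field is given by its components in each chart. Tangent vectors
   are row vectors, so an endomorphism [J c u] acts by [v *m J c u], the
   differential of [f] is [v |-> v *m 'J f u], and the bilinear form of
   matrix [g c u] is [(v, w) |-> v *m g c u *m w^T]. *)
Section Tensors.
Context {R : realType} {m : nat}.
Notation field T := (chart R m T -> 'rV[R]_m -> 'M[R]_m).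

Definition endo_related (M N : topologicalType)
    (AM : set (chart R m M)) (AN : set (chart R m N)) (f : M -> N)
    (J : field M) (J' : field N) :=
  forall c d, AM c -> AN d ->
  forall u, cran c u -> cdom d (f (cinv c u)) ->
    let F := local_rep c d f in
    J c u *m 'J F u = 'J F u *m J' d (F u).

Definition metric_related (M N : topologicalType)
    (AM : set (chart R m M)) (AN : set (chart R m N)) (f : M -> N)
    (g : field M) (g' : field N) :=
  forall c d, AM c -> AN d ->
  forall u, cran c u -> cdom d (f (cinv c u)) ->
    let F := local_rep c d f in
    g c u = 'J F u *m g' d (F u) *m ('J F u)^T.

Definition endo_field (M : topologicalType) (A : set (chart R m M))
    (J : field M) :=
  (forall c, A c -> smooth_on (cran c) (J c)) /\ endo_related A A id J J.

Definition bilinear_field (M : topologicalType) (A : set (chart R m M))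
    (g : field M) :=
  (forall c, A c -> smooth_on (cran c) (g c)) /\ metric_related A A id g g.

Definition left_translation (G : topGroupType) (a x : G) : G := (a * x)%g.

Definition invariant_endo (G : topGroupType) (AG : set (chart R m G))
    (M : topologicalType) (AM : set (chart R m M)) (pr : G -> M)
    (J : field M) :=
  exists JG : field G,
    [/\ endo_field AG JG,
        forall a, endo_related AG AG (left_translation a) JG JG &
        endo_related AG AM pr JG J].

Definition invariant_metric (G : topGroupType) (AG : set (chart R m G))
    (M : topologicalType) (AM : set (chart R m M)) (pr : G -> M)
    (g : field M) :=
  exists gG : field G,
    [/\ bilinear_field AG gG,
        forall a, metric_related AG AG (left_translation a) gG gG &
        metric_related AG AM pr gG g].

Definition lie_bracket (X Y : 'rV[R]_m -> 'rV[R]_m) (u : 'rV[R]_m) :=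
  'D_(X u) Y u - 'D_(Y u) X u.

Definition nijenhuis (J : 'rV[R]_m -> 'M[R]_m) (X Y : 'rV[R]_m -> 'rV[R]_m)
    (u : 'rV[R]_m) :=
  let JX := fun w => X w *m J w in
  let JY := fun w => Y w *m J w in
  lie_bracket JX JY u - lie_bracket JX Y u *m J u
  - lie_bracket X JY u *m J u - lie_bracket X Y u.

Record complex_structure (M : topologicalType) (A : set (chart R m M))
    (J : field M) : Prop := {
  cs_field : endo_field A J;
  cs_square : forall c u, A c -> cran c u -> J c u *m J c u = - 1%:M;
  cs_integrable : forall c u X Y, A c -> cran c u ->
    smooth_on (cran c) X -> smooth_on (cran c) Y ->
    nijenhuis (J c) X Y u = 0
}.

Record hermitian_metric (M : topologicalType) (A : set (chart R m M))
    (J g : field M) : Prop := {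
  hm_field : bilinear_field A g;
  hm_sym : forall c u, A c -> cran c u -> (g c u)^T = g c u;
  hm_pos : forall c u (v : 'rV[R]_m), A c -> cran c u -> v != 0 ->
    0 < (v *m g c u *m v^T) 0 0;
  hm_compat : forall c u, A c -> cran c u ->
    J c u *m g c u *m (J c u)^T = g c u
}.

End Tensors.

(* Complex-valued differential forms on open subsets of R^m, evaluated
   (complex-multilinearly) on complexified tangent vectors. *)
Section Forms.
Context {R : realType} {m : nat}.
Local Notation C := (R[i]).

Definition form (k : nat) := 'rV[R]_m -> ('I_k -> 'rV[C]_m) -> C.

Definition partial (l : 'I_m) (f : 'rV[R]_m -> C) (u : 'rV[R]_m) : C :=
  'D_(delta_mx 0 l) (fun w => complex.Re (f w)) u
  +i* 'D_(delta_mx 0 l) (fun w => complex.Im (f w)) u.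

Definition dform (k : nat) (w : form k) : form k.+1 := fun u v =>
  \sum_(i < k.+1) (-1) ^+ i *
    \sum_(l < m) v i 0 l * partial l (fun u' => w u' (v \o lift i)) u.

(* normalised so that (e1 /\ e2)(v1, v2) = e1 v1 * e2 v2 - e1 v2 * e2 v1 *)
Definition wedge (k l : nat) (a : form k) (b : form l) : form (k + l)%N :=
  fun u v => ((k`! * l`!)%N%:R)^-1 *
    \sum_(s : 'S_(k + l)) (-1) ^+ s
      * a u (fun i => v (s (lshift l i))) * b u (fun j => v (s (rshift k j))).

Fixpoint wedge_exp (w : form 2) (j : nat) : form (j * 2)%N :=
  if j is j'.+1 then wedge w (@wedge_exp w j') else fun _ _ => 1.

Variable J : 'rV[R]_m -> 'M[R]_m.

Definition proj10 (u : 'rV[R]_m) (v : 'rV[C]_m) : 'rV[C]_m :=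
  2^-1 *: (v - (0 +i* 1) *: (v *m map_mx (real_complex R) (J u))).

Definition proj01 (u : 'rV[R]_m) (v : 'rV[C]_m) : 'rV[C]_m :=
  2^-1 *: (v + (0 +i* 1) *: (v *m map_mx (real_complex R) (J u))).

(* the component of type (p, k - p) of a k-form *)
Definition type_part (k p : nat) (w : form k) : form k := fun u v =>
  \sum_(S : {set 'I_k} | #|S| == p)
    w u (fun i => if i \in S then proj10 u (v i) else proj01 u (v i)).

Definition del (k : nat) (w : form k) : form k.+1 := fun u v =>
  \sum_(p < k.+1) type_part p.+1 (dform (type_part p w)) u v.

Definition delbar (k : nat) (w : form k) : form k.+1 := fun u v =>
  \sum_(p < k.+1) type_part p (dform (type_part p w)) u v.

Variable g : 'rV[R]_m -> 'M[R]_m.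

(* Omega(X, Y) = g(J X, Y) *)
Definition fundamental_form : form 2 := fun u v =>
  (v ord0 *m map_mx (real_complex R) (J u *m g u) *m (v ord_max)^T) 0 0.

End Forms.
Arguments wedge_exp {R m} w j.

Section Conditions.
Context {R : realType} {m : nat}.
Notation field T := (chart R m T -> 'rV[R]_m -> 'M[R]_m).

Definition skt (M : topologicalType) (A : set (chart R m M))
    (J g : field M) :=
  forall c u v, A c -> cran c u ->
    let Omega := fundamental_form (J c) (g c) in
    del (J c) (delbar (J c) Omega) u v = 0.

(* [m./2 - 2] is n - 2 for the complex dimension n of M *)
Definition first_gauduchon (M : topologicalType) (A : set (chart R m M))
    (J g : field M) :=
  forall c u v, A c -> cran c u ->
    let Omega := fundamental_form (J c) (g c) in
    wedge (del (J c) (delbar (J c) Omega)) (wedge_exp Omega (m./2 - 2)%N) u v = 0.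

End Conditions.

(* Main.v *)
Require Import Defs.
From mathcomp Require Import all_boot all_order all_algebra all_fingroup complex.
From mathcomp Require Import all_classical all_reals all_analysis.
From mathcomp Require Import ring lra.

(** If [del (delbar Omega)] vanishes then so do its products, hence only the
    implication from 1-st Gauduchon to SKT has content. It is a statement about
    the Lie algebra of [G], proved in three steps.

    Reduction to constant coefficients. Left translations commute with the
    action of [Gamma], so the left invariant frame of [G] descends to a frame
    on [M], and in this frame the bracket, [J] and [g] have constant
    components ([frame_properties], [frame_endo], [frame_metric]). The exterior
    derivative of a form with constant components is then given by the
    Chevalley-Eilenberg formula ([dform_invariant2], [dform_invariant3]), and
    [del], [delbar] and the wedge product become operations of multilinear
    algebra on the complexified Lie algebra ([local_gauduchon_skt]).
    The Lie algebra itself is read off from the second derivatives at the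
    identity of the product of [G] in a chart. Its bracket is the derivative of
    the adjoint representation, from which the Jacobi identity follows
    ([lie_br_jacobi]); since iterated commutators of the nilpotent group [G]
    are trivial, products of enough factors [Ad y - 1] vanish, and so do
    products of enough adjoint maps ([lie_br_nilpotent]).

    The trace condition. Write Theta for the (2,2)-form [del (delbar Omega)].
    On an orthogonal basis z1, z2, z3 of the (1,0)-vectors, the equation
    Theta /\ Omega = 0 says that the sum of
    Theta(zi, zj, conj zi, conj zj) * Omega(zk, conj zk), over the three
    choices of k, is zero ([wedge_sum42_types]).

    Conclusion ([trace_zero_vanish]). A nilpotent Lie algebra has a nonzero
    central vector, hence one of the form z3 - conj z3 with z3 of type (1,0). If z3 is itself central, then the nilpotency of the maps
    which the adjoint action of (0,1)-vectors induces on (1,0)-vectors makes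
    Theta vanish as soon as one argument is z3 or conj z3. Only
    Theta(z1, z2, conj z1, conj z2) can survive, and the trace condition kills
    it ([central_type_vanish]). If z3 is not central, then nilpotency and the
    Jacobi identity leave so few possible brackets that all the terms of the
    trace condition have the same sign, one of them being nonzero: this case
    cannot occur ([noncentral_type_absurd]). *)

Set Implicit Arguments. Unset Strict Implicit. Unset Printing Implicit Defensive.
Import Order.TTheory GRing.Theory Num.Theory.
Import numFieldNormedType.Exports.
Local Open Scope ring_scope.

(** * Hermitian nilpotent Lie algebras *)

Section NilpotentMaps.
Variables (C : fieldType) (V : lmodType C).

(** On the span of [v] and [f v], a nilpotent [f] has characteristic polynomial
    X^2, unless [f v] is a multiple of [v], hence zero. *)
Lemma nilpotent_quadratic (f : V -> V) (K : nat) (t s : C) (v : V) :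
  (forall a x y, f (a *: x + y) = a *: f x + f y) ->
  iter K f v = 0 -> f (f v) = t *: f v + s *: v -> v <> 0 ->
  s = 0 /\ (t = 0 \/ f v = 0).
Proof.
move=> fL fK fE v0.
have f0 : f 0 = 0 by have := fL (-1) 0 0; rewrite !scaleN1r oppr0 addr0 addNr.
have fZ a x : f (a *: x) = a *: f x by rewrite -[a *: x]addr0 fL f0 addr0.
have fi n : iter n.+2 f v = t *: iter n.+1 f v + s *: iter n f v.
  elim: n => [|n IH]; first exact: fE.
  by rewrite [iter n.+3 f v]iterS [in LHS]IH fL fZ.
have [m [m0 mK]] : exists m, iter m f v <> 0 /\ iter m.+1 f v = 0.
  elim: K fK => [//|K IH] fK.
  by have [/IH//|] := pselect (iter K f v = 0); exists K.
have s0 : s = 0.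
  have := fi m; rewrite iterS mK f0 scaler0 add0r => /esym/eqP.
  by rewrite scaler_eq0 => /orP[/eqP//|/eqP].
split=> //; case: m m0 mK => [|m] m0 mK; first by right.
left; have := fi m; rewrite mK s0 scale0r addr0 => /esym/eqP.
by rewrite scaler_eq0 => /orP[/eqP//|/eqP].
Qed.

End NilpotentMaps.

(** [V] is the complexification of a real nilpotent Lie algebra with an
    integrable complex structure and a Hermitian metric, [cj] its conjugation,
    [p10] and [p01] the projections onto the vectors of type (1,0) and (0,1),
    and [Om] the fundamental form. *)
Section HermitianLieAlgebra.
Variables (C : numClosedFieldType) (V : lmodType C) (iu : C).
Variables (br : V -> V -> V) (cj p10 p01 : V -> V) (Om : V -> V -> C).

Hypothesis brL : forall a x y z, br (a *: x + y) z = a *: br x z + br y z.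
Hypothesis brN : forall x y, br x y = - br y x.
Hypothesis jacobi : forall x y z, br x (br y z) = br (br x y) z + br y (br x z).
Hypothesis br_nil : exists K, forall x y, iter K (br x) y = 0.
Hypothesis cjL : forall a x y, cj (a *: x + y) = a^* *: cj x + cj y.
Hypothesis cjK : forall x, cj (cj x) = x.
Hypothesis cjbr : forall x y, cj (br x y) = br (cj x) (cj y).
Hypothesis p10L : forall a x y, p10 (a *: x + y) = a *: p10 x + p10 y.
Hypothesis p10K : forall x, p10 (p10 x) = p10 x.
Hypothesis p01E : forall x, p01 x = x - p10 x.
Hypothesis cjp10 : forall x, cj (p10 x) = p01 (cj x).
Hypothesis integrable : forall x y, p10 (br (p10 x) (p10 y)) = br (p10 x) (p10 y).
Hypothesis OmL : forall a x y z, Om (a *: x + y) z = a * Om x z + Om y z.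
Hypothesis OmN : forall x y, Om x y = - Om y x.
Hypothesis Om1010 : forall x y, Om (p10 x) (p10 y) = 0.
Hypothesis Omcj : forall x y, Om (cj x) (cj y) = (Om x y)^*.
Hypothesis iu2 : iu * iu = -1.
Hypothesis iuC : iu^* = - iu.
Hypothesis Ompos : forall x, p10 x <> 0 -> 0 < - iu * Om (p10 x) (cj (p10 x)).

Definition T10 x := p10 x = x.
Definition T01 x := p01 x = x.
Definition orth x y := Om x (cj y) = 0.

(* The (1,0)-vectors have dimension three. *)
Hypothesis orth_ex : forall x y, exists z, [/\ T10 z, z <> 0, orth z x & orth z y].
Hypothesis orth_span : forall x y z, T10 x -> T10 y -> T10 z ->
  x <> 0 -> y <> 0 -> z <> 0 -> orth x y -> orth x z -> orth y z ->
  forall v, T10 v -> exists a b c, v = a *: x + b *: y + c *: z.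
Hypothesis central_ex : exists2 z, z <> 0 & forall v, br z v = 0.

(** The Chevalley-Eilenberg differential of [Om], its component of type (1,2),
    that is delbar Om, and the differential of the latter, whose component of
    type (2,2) is del (delbar Om). *)
Definition dOm x y z := - Om (br x y) z + Om (br x z) y - Om (br y z) x.
Definition om12 x y z := dOm (p10 x) (p01 y) (p01 z)
  + dOm (p01 x) (p10 y) (p01 z) + dOm (p01 x) (p01 y) (p10 z).
Definition d12 x y z t := - om12 (br x y) z t + om12 (br x z) y t
  - om12 (br x t) y z - om12 (br y z) x t + om12 (br y t) x z - om12 (br z t) x y.

(* The coefficient of del (delbar Om) /\ Om in the basis x, y, z. *)
Hypothesis trace0 : forall x y z, T10 x -> T10 y -> T10 z ->
  x <> 0 -> y <> 0 -> z <> 0 -> orth x y -> orth x z -> orth y z ->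
  d12 x y (cj x) (cj y) * Om z (cj z) + d12 x z (cj x) (cj z) * Om y (cj y)
  + d12 y z (cj y) (cj z) * Om x (cj x) = 0.

Let L0 (W : lmodType C) (f : V -> W) :
  (forall a x y, f (a *: x + y) = a *: f x + f y) -> f 0 = 0.
Proof. by move=> fL; have := fL (-1) 0 0; rewrite !scaleN1r oppr0 addr0 addNr. Qed.
Let LZ (W : lmodType C) (f : V -> W) :
  (forall a x y, f (a *: x + y) = a *: f x + f y) -> forall a x, f (a *: x) = a *: f x.
Proof. by move=> fL a x; rewrite -[a *: x]addr0 fL (L0 fL) addr0. Qed.
Let LD (W : lmodType C) (f : V -> W) :
  (forall a x y, f (a *: x + y) = a *: f x + f y) -> forall x y, f (x + y) = f x + f y.
Proof. by move=> fL x y; rewrite -[x]scale1r fL !scale1r. Qed.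
Let LN (W : lmodType C) (f : V -> W) :
  (forall a x y, f (a *: x + y) = a *: f x + f y) -> forall x, f (- x) = - f x.
Proof. by move=> fL x; rewrite -scaleN1r (LZ fL) scaleN1r. Qed.

Let brLr z a x y : br z (a *: x + y) = a *: br z x + br z y.
Proof. by rewrite brN brL opprD -scalerN -!brN. Qed.
Let brDl z x y : br (x + y) z = br x z + br y z.
Proof. by rewrite (LD (fun a x y => brL a x y z)). Qed.
Let brZl z a x : br (a *: x) z = a *: br x z.
Proof. by rewrite (LZ (fun a x y => brL a x y z)). Qed.
Let brNl z x : br (- x) z = - br x z.
Proof. by rewrite (LN (fun a x y => brL a x y z)). Qed.
Let br0l z : br 0 z = 0.
Proof. by rewrite (L0 (fun a x y => brL a x y z)). Qed.
Let brDr z x y : br z (x + y) = br z x + br z y.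
Proof. by rewrite (LD (brLr z)). Qed.
Let brZr z a x : br z (a *: x) = a *: br z x.
Proof. by rewrite (LZ (brLr z)). Qed.
Let brNr z x : br z (- x) = - br z x.
Proof. by rewrite (LN (brLr z)). Qed.
Let br0r z : br z 0 = 0.
Proof. by rewrite (L0 (brLr z)). Qed.
Let brxx x : br x x = 0.
Proof.
apply/eqP; have /eqP := brN x x; rewrite -addr_eq0 -mulr2n -scaler_nat scaler_eq0.
by rewrite pnatr_eq0.
Qed.
Let brE := (brDl, brDr, brZl, brZr, brNl, brNr, br0l, br0r, brxx).

Let OmLr z a x y : Om z (a *: x + y) = a * Om z x + Om z y.
Proof. by rewrite OmN OmL opprD -mulrN -!OmN. Qed.
Let OmDl z x y : Om (x + y) z = Om x z + Om y z.
Proof. by rewrite (LD (W := C^o) (fun a x y => OmL a x y z)). Qed.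
Let OmZl z a x : Om (a *: x) z = a * Om x z.
Proof. by rewrite (LZ (W := C^o) (fun a x y => OmL a x y z)). Qed.
Let OmNl z x : Om (- x) z = - Om x z.
Proof. by rewrite (LN (W := C^o) (fun a x y => OmL a x y z)). Qed.
Let Om0l z : Om 0 z = 0.
Proof. by rewrite (L0 (W := C^o) (fun a x y => OmL a x y z)). Qed.
Let OmDr z x y : Om z (x + y) = Om z x + Om z y.
Proof. by rewrite (LD (W := C^o) (OmLr z)). Qed.
Let OmZr z a x : Om z (a *: x) = a * Om z x.
Proof. by rewrite (LZ (W := C^o) (OmLr z)). Qed.
Let OmNr z x : Om z (- x) = - Om z x.
Proof. by rewrite (LN (W := C^o) (OmLr z)). Qed.
Let Om0r z : Om z 0 = 0.
Proof. by rewrite (L0 (W := C^o) (OmLr z)). Qed.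
Let OmE := (OmDl, OmDr, OmZl, OmZr, OmNl, OmNr, Om0l, Om0r).

Let p10D x y : p10 (x + y) = p10 x + p10 y. Proof. exact: LD p10L x y. Qed.
Let p10Z a x : p10 (a *: x) = a *: p10 x. Proof. exact: LZ p10L a x. Qed.
Let p10N x : p10 (- x) = - p10 x. Proof. exact: LN p10L x. Qed.
Let p100 : p10 0 = 0. Proof. exact: L0 p10L. Qed.
Let p01L a x y : p01 (a *: x + y) = a *: p01 x + p01 y.
Proof. by rewrite !p01E p10L scalerBr opprD !addrA; congr (_ + _); rewrite -!addrA; congr (_ + _); rewrite addrC. Qed.
Let p01D x y : p01 (x + y) = p01 x + p01 y. Proof. exact: LD p01L x y. Qed.
Let p01Z a x : p01 (a *: x) = a *: p01 x. Proof. exact: LZ p01L a x. Qed.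
Let p01N x : p01 (- x) = - p01 x. Proof. exact: LN p01L x. Qed.
Let p010 : p01 0 = 0. Proof. exact: L0 p01L. Qed.
Let pE := (p10D, p10Z, p10N, p100, p01D, p01Z, p01N, p010).
Let psum x : x = p10 x + p01 x.
Proof. by rewrite p01E addrC subrK. Qed.
Let p1001 x : p10 (p01 x) = 0.
Proof. by rewrite p01E !pE p10K subrr. Qed.
Let p0110 x : p01 (p10 x) = 0.
Proof. by rewrite p01E p10K subrr. Qed.
Let p01K x : p01 (p01 x) = p01 x.
Proof. by rewrite p01E p1001 subr0. Qed.
Let T10_01 x : T10 x -> p01 x = 0.
Proof. by rewrite /T10 p01E => ->; rewrite subrr. Qed.
Let T01_10 x : T01 x -> p10 x = 0.
Proof. by move=> <-; rewrite p1001. Qed.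

Let cjD x y : cj (x + y) = cj x + cj y.
Proof. by rewrite -[x]scale1r cjL rmorph1 !scale1r. Qed.
Let cj0 : cj 0 = 0.
Proof. by apply/eqP; have /eqP := cjD 0 0; rewrite addr0 -subr_eq0 opprD addNKr oppr_eq0. Qed.
Let cjZ a x : cj (a *: x) = a^* *: cj x.
Proof. by rewrite -[a *: x]addr0 cjL cj0 addr0. Qed.
Let cjN x : cj (- x) = - cj x.
Proof. by rewrite -scaleN1r cjZ rmorphN rmorph1 scaleN1r. Qed.
Let cjE := (cjD, cjZ, cjN, cj0, cjK, cjbr).
Let cjp01 x : cj (p01 x) = p10 (cj x).
Proof. by rewrite -[x in LHS]cjK -cjp10 cjK. Qed.
Let cj_inj x y : cj x = cj y -> x = y.
Proof. by move=> /(congr1 cj); rewrite !cjK. Qed.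
Let T10_cj x : T10 x -> T01 (cj x).
Proof. by rewrite /T01 -cjp10 => ->. Qed.
Let T01_cj x : T01 x -> T10 (cj x).
Proof. by rewrite /T10 -cjp01 => ->. Qed.
Let cj_neq0 x : x <> 0 -> cj x <> 0.
Proof. by move=> x0 /(congr1 cj); rewrite cjK cj0. Qed.

Let Om10 x y : T10 x -> T10 y -> Om x y = 0.
Proof. by move=> <- <-. Qed.
Let Om01 x y : T01 x -> T01 y -> Om x y = 0.
Proof.
move=> /T01_cj hx /T01_cj hy; rewrite -[x]cjK -[y]cjK Omcj Om10 ?rmorph0//.
Qed.
Let Om_neq0 x : T10 x -> x <> 0 -> Om x (cj x) != 0.
Proof.
move=> hx x0; have := Ompos (x := x); rewrite hx => /(_ x0).
by apply: contraTneq => ->; rewrite mulr0 ltxx.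
Qed.
Let orthC x y : orth x y -> orth y x.
Proof.
by rewrite /orth => h; rewrite OmN -[y in Om _ y]cjK Omcj h rmorph0 oppr0.
Qed.

Let T10br x y : T10 x -> T10 y -> T10 (br x y).
Proof. by rewrite /T10 => <- <-; exact: integrable. Qed.
Let T01br x y : T01 x -> T01 y -> T01 (br x y).
Proof.
move=> /T01_cj hx /T01_cj hy; rewrite -[x]cjK -[y]cjK -cjbr.
by apply: T10_cj; apply: T10br.
Qed.

Let T10D a x y : T10 x -> T10 y -> T10 (a *: x + y).
Proof. by rewrite /T10 p10L => -> ->. Qed.
Let T10Z a x : T10 x -> T10 (a *: x).
Proof. by rewrite /T10 p10Z => ->. Qed.
Let T01Z a x : T01 x -> T01 (a *: x).
Proof. by rewrite /T01 p01Z => ->. Qed.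

(** A nilpotent endomorphism [f] of the (1,0)-vectors which kills [z3] is
    strictly triangular in a basis that ends with [z3]; the Gram-Schmidt process
    makes this basis orthogonal. The vector before [z3] is the last iterate of
    [f] on a vector orthogonal to [z3] which is not a multiple of [z3]. *)
Lemma typed_flag (f : V -> V) z3 :
  (forall a x y, f (a *: x + y) = a *: f x + f y) ->
  (forall x, T10 x -> T10 (f x)) ->
  (exists K, forall x, T10 x -> iter K f x = 0) ->
  T10 z3 -> z3 <> 0 -> f z3 = 0 ->
  exists z1 z2, [/\ [/\ T10 z1, T10 z2, z1 <> 0 & z2 <> 0],
     [/\ orth z1 z2, orth z1 z3 & orth z2 z3] &
     (exists c, f z2 = c *: z3) /\ (exists a b, f z1 = a *: z2 + b *: z3)].
Proof.
move=> fL fT [K fK] t3 n3 f3.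
have f0 : f 0 = 0 := L0 fL.
have fZ := LZ fL; have LDf := LD fL.
have [y [ty ny oy _]] := orth_ex z3 z3.
pose Q n := exists c, iter n f y = c *: z3.
have [m [Qm QSm]] : exists m, ~ Q m /\ Q m.+1.
  have Q0 : ~ Q 0%N.
    case=> c /= yE; move: oy; rewrite /orth yE OmZl => /eqP.
    rewrite mulf_eq0 (negPf (Om_neq0 t3 n3)) orbF => /eqP c0.
    by apply: ny; rewrite yE c0 scale0r.
  have QK : Q K by exists 0; rewrite fK// scale0r.
  elim: K QK {fK} => [/Q0//|K IH] QK.
  by have [/IH//|] := pselect (Q K); exists K.
have tn n : T10 (iter n f y) by elim: n => //= n; exact: fT.
set x := iter m f y in Qm.
pose k := - (Om x (cj z3) / Om z3 (cj z3)).
pose z2 := k *: z3 + x.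
have t2 : T10 z2 by apply: T10D; last exact: tn.
have n2 : z2 <> 0.
  move=> z20; apply: Qm; exists (- k).
  by apply/eqP; rewrite scaleNr -addr_eq0 addrC; apply/eqP.
have o23 : orth z2 z3.
  by rewrite /orth OmL /k mulNr divfK ?Om_neq0// addNr.
have [c fx] : exists c, f z2 = c *: z3.
  by have [c fx] := QSm; exists c; rewrite fL f3 scaler0 add0r.
clearbody z2.
have [z1 [t1 n1 o12 o13]] := orth_ex z2 z3.
exists z1, z2; split=> //; split; first by exists c.
have [l [a [b f1]]] := orth_span t1 t2 t3 n1 n2 n3 o12 o13 o23 (fT _ t1).
exists a, b; suff l0 : l = 0 by rewrite f1 l0 scale0r add0r.
have o21 := orthC o12; have o31 := orthC o13.
(* The diagonal coefficient [l] of [f] at [z1] is zero by nilpotency. *)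
have fi n : Om (iter n f z1) (cj z1) = l ^+ n * Om z1 (cj z1).
  elim: n => [|n IH]; first by rewrite mul1r.
  have tz : T10 (iter n f z1) by elim: n {IH} => //= n; exact: fT.
  have [a' [b' [c' E]]] := orth_span t1 t2 t3 n1 n2 n3 o12 o13 o23 tz.
  have {}o21 : Om z2 (cj z1) = 0 := o21; have {}o31 : Om z3 (cj z1) = 0 := o31.
  by rewrite exprS -mulrA -IH iterS E !LDf !fZ f1 fx f3 !OmE o21 o31; ring.
have := fi K; rewrite fK// Om0l => /esym/eqP.
by rewrite mulf_eq0 (negPf (Om_neq0 t1 n1)) orbF expf_eq0 => /andP[_ /eqP].
Qed.

Lemma dOmL1 y z a x x' : dOm (a *: x + x') y z = a * dOm x y z + dOm x' y z.
Proof. by rewrite /dOm !brE !OmE; ring. Qed.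
Lemma dOmL2 x z a y y' : dOm x (a *: y + y') z = a * dOm x y z + dOm x y' z.
Proof. by rewrite /dOm !brE !OmE; ring. Qed.
Lemma dOm01 x y z : dOm y x z = - dOm x y z.
Proof. by rewrite /dOm [br y x]brN !OmE; ring. Qed.
Lemma dOm12 x y z : dOm x z y = - dOm x y z.
Proof. by rewrite /dOm [br z y]brN !OmE; ring. Qed.

Lemma om12L1 y z a x x' : om12 (a *: x + x') y z = a * om12 x y z + om12 x' y z.
Proof. by rewrite /om12 p10L p01L !dOmL1; ring. Qed.
Lemma om12L2 x z a y y' : om12 x (a *: y + y') z = a * om12 x y z + om12 x y' z.
Proof. by rewrite /om12 p10L p01L !dOmL2; ring. Qed.
Lemma om12_01 x y z : om12 y x z = - om12 x y z.
Proof. by rewrite /om12 (dOm01 (p01 x)) (dOm01 (p10 x)) (dOm01 (p01 x) (p01 y)); ring. Qed.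
Lemma om12_12 x y z : om12 x z y = - om12 x y z.
Proof. by rewrite /om12 (dOm12 (p10 x)) (dOm12 (p01 x) (p01 y)) (dOm12 (p01 x) (p10 y)); ring. Qed.

Lemma d12L1 y z t a x x' : d12 (a *: x + x') y z t = a * d12 x y z t + d12 x' y z t.
Proof. by rewrite /d12 !brL !om12L1 !om12L2; ring. Qed.
Lemma d12_01 x y z t : d12 y x z t = - d12 x y z t.
Proof.
rewrite /d12 [br y x]brN -[- br x y]addr0 -scaleN1r !om12L1 om12_01.
rewrite (om12_12 (br z t)).
have -> : om12 0 z t = 0 by have := om12L1 z t (-1) 0 0; rewrite scaler0 addr0 mulN1r addNr.
ring.
Qed.

(* Reduce an equation to a ring identity modulo one or two known equations. *)
Let lin_comb1 (a b c d : C) : c = d -> a - b = c - d -> a = b.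
Proof. by move=> -> /eqP; rewrite subrr subr_eq0 => /eqP. Qed.
Let lin_comb2 (a b c d c' d' : C) : c = d -> c' = d' ->
  a - b = (c - d) + (c' - d') -> a = b.
Proof. by move=> -> -> /eqP; rewrite !subrr addr0 subr_eq0 => /eqP. Qed.

Lemma d12_23 x y z t : d12 x y t z = - d12 x y z t.
Proof.
rewrite /d12 [br t z]brN -[- br z t]addr0 -scaleN1r !om12L1 (om12_12 (br x y)).
have -> : om12 0 x y = 0 by have := om12L1 x y (-1) 0 0; rewrite scaler0 addr0 mulN1r addNr.
ring.
Qed.
Lemma d12_12 x y z t : d12 x z y t = - d12 x y z t.
Proof.
rewrite /d12 [br z y]brN -[- br y z]addr0 -scaleN1r !om12L1.
rewrite (om12_12 (br x t)).
have -> : om12 0 x t = 0 by have := om12L1 x t (-1) 0 0; rewrite scaler0 addr0 mulN1r addNr.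
ring.
Qed.
Lemma d12L2 x z t a y y' : d12 x (a *: y + y') z t = a * d12 x y z t + d12 x y' z t.
Proof. by rewrite d12_01 d12L1 !(d12_01 x); ring. Qed.
Lemma d12L3 x y t a z z' : d12 x y (a *: z + z') t = a * d12 x y z t + d12 x y z' t.
Proof. by rewrite d12_12 d12L2 !(d12_12 x y); ring. Qed.
Let dOm0l b c : dOm 0 b c = 0. Proof. by rewrite /dOm !brE !OmE; ring. Qed.
Let dOm0m a c : dOm a 0 c = 0. Proof. by rewrite dOm01 dOm0l oppr0. Qed.
Let dOm0r a b : dOm a b 0 = 0. Proof. by rewrite dOm12 dOm0m oppr0. Qed.

Lemma d12_typed x y u v : T10 x -> T10 y -> T01 u -> T01 v ->
  d12 x y u v = - dOm (br x y) u v + dOm (p01 (br x u)) y v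
   - dOm (p01 (br x v)) y u - dOm (p01 (br y u)) x v + dOm (p01 (br y v)) x u.
Proof.
move=> hx hy hu hv; rewrite /d12 /om12.
have hxy := T10br hx hy; have huv := T01br hu hv.
rewrite (T10_01 hx) (T10_01 hy) (T01_10 hu) (T01_10 hv) (T01_10 huv) (T10_01 hxy).
rewrite [p10 x]hx [p10 y]hy [p01 u]hu [p01 v]hv [p10 (br x y)]hxy [p01 (br u v)]huv.
by rewrite !(dOm0l, dOm0m, dOm0r); ring.
Qed.

(** An alternating form on a space of dimension three whose kernel contains
    [z3] is determined by its value on the two other basis vectors. *)
Lemma alternating_vanish (ga : V -> V -> C) z1 z2 z3 :
  (forall v, T10 v -> exists a b c, v = a *: z1 + b *: z2 + c *: z3) ->
  T10 z1 -> T10 z2 -> T10 z3 ->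
  (forall a x y z, ga (a *: x + y) z = a * ga x z + ga y z) ->
  (forall x y, T10 x -> T10 y -> ga y x = - ga x y) ->
  (forall y, T10 y -> ga z3 y = 0) -> ga z1 z2 = 0 ->
  forall x y, T10 x -> T10 y -> ga x y = 0.
Proof.
move=> span t1 t2 t3 gL gN g3 g12.
have g0 z : ga 0 z = 0.
  by have := gL (-1) 0 0 z; rewrite scaler0 addr0 mulN1r addNr.
have gZ a x z : ga (a *: x) z = a * ga x z by rewrite -[a *: x]addr0 gL g0 addr0.
have gxx x : T10 x -> ga x x = 0.
  move=> tx; apply/eqP; have /eqP := gN x x tx tx.
  by rewrite -addr_eq0 -mulr2n mulrn_eq0.
have ty a b c : T10 (a *: z1 + (b *: z2 + c *: z3)).
  by apply: T10D => //; apply: T10D => //; apply: T10Z.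
have g1y y : T10 y -> ga z1 y = 0.
  move=> /span [a [b [c ->]]]; rewrite -addrA gN// !gL gZ gxx// gN// g12 g3//.
  by rewrite oppr0 !mulr0 !addr0 oppr0.
have g2y y : T10 y -> ga z2 y = 0.
  move=> /span [a [b [c ->]]]; rewrite -addrA gN// !gL gZ gxx// g12 g3//.
  by rewrite !mulr0 !addr0 oppr0.
move=> x y /span [a [b [c ->]]] hy; rewrite -addrA !gL gZ g1y// g2y// g3//.
by rewrite !mulr0 !addr0.
Qed.

(* The adjoint action of a (0,1)-vector on (1,0)-vectors modulo (0,1)-vectors,
   which it preserves. *)
Let p10br_nil w : T01 w -> exists K, forall x, T10 x -> iter K (fun x => p10 (br w x)) x = 0.
Proof.
move=> tw; have [K hK] := br_nil; exists K => x tx.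
suff -> : iter K (fun x => p10 (br w x)) x = p10 (iter K (br w) x) by rewrite hK p100.
elim: K {hK} => [|K IH] //=; rewrite IH.
rewrite [iter K _ x in RHS]psum brDr p10D [X in _ + X]T01_10 ?addr0//.
by apply: T01br => //; exact: p01K.
Qed.

(** When [z3] is central, so is its conjugate. Up to sign, del (delbar Om)
    with an argument [cj z3] is [Om (br (f x) y + br x (f y)) (cj z3)], where [f] is
    the adjoint action of a (0,1)-vector: this is the infinitesimal action of [f]
    on a 2-form on the quotient by [z3], which has dimension two, hence the trace
    of [f] times this 2-form. The trace is zero by nilpotency. The case of an
    argument [z3] is similar, up to conjugation. *)
Lemma central_type_vanish z3 : T10 z3 -> z3 <> 0 -> (forall v, br z3 v = 0) ->
  forall x y u v, T10 x -> T10 y -> T01 u -> T01 v -> d12 x y u v = 0.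
Proof.
move=> t3 n3 c3.
have c3' v : br (cj z3) v = 0 by rewrite -[v]cjK -cjbr c3 cj0.
have c3r v : br v z3 = 0 by rewrite brN c3 oppr0.
have c3r' v : br v (cj z3) = 0 by rewrite brN c3' oppr0.
have key w x y : T01 w -> T10 x -> T10 y ->
    Om (br (p10 (br w x)) y + br x (p10 (br w y))) (cj z3) = 0.
  move=> tw tx ty.
  pose f x := p10 (br w x).
  have fL a x' y' : f (a *: x' + y') = a *: f x' + f y' by rewrite /f brLr p10L.
  have fT x' : T10 x' -> T10 (f x') by move=> _; exact: p10K.
  have f3 : f z3 = 0 by rewrite /f c3r p100.
  have [z1 [z2 [[t1 t2 n1 n2] [ o12 o13 o23] [[c f2] [a [b f1]]]]]] :=
    typed_flag fL fT (p10br_nil tw) t3 n3 f3.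
  have span := orth_span t1 t2 t3 n1 n2 n3 o12 o13 o23.
  rewrite -/(f x) -/(f y).
  apply: (alternating_vanish (ga := fun x y => Om (br (f x) y + br x (f y)) (cj z3)) span) => //.
  - by move=> k x' y' z'; rewrite fL !brE !OmE; ring.
  - move=> x' y' _ _; rewrite [br (f y') x']brN [br y' _]brN !OmE; ring.
  - by move=> y' _; rewrite f3 !brE c3 addr0 Om0l.
  - by rewrite f1 f2 !brE !c3 c3r !scaler0 !addr0 Om0l.
have left3 y u v : T10 y -> T01 u -> T01 v -> d12 z3 y u v = 0.
  move=> ty tu tv; rewrite d12_typed// !c3 p010.
  have dOm3 a b : dOm a z3 b = Om (br a b) z3.
    by rewrite /dOm c3r c3 !OmE; ring.
  have := key _ _ _ (T10_cj ty) (T01_cj tu) (T01_cj tv).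
  move=> /(congr1 (fun z : C => z^* )); rewrite -Omcj !cjE -!cjbr !cjp10 !cjE rmorph0.
  rewrite !dOm0l !dOm3 !OmE [br u _]brN !OmE => e.
  apply: (lin_comb1 (esym e)); ring.
have right3 x y v : T10 x -> T10 y -> T01 v -> d12 x y (cj z3) v = 0.
  move=> tx ty tv; rewrite d12_typed//; last exact: T10_cj.
  have dOm3 a b : dOm a (cj z3) b = Om (br a b) (cj z3).
    by rewrite /dOm c3r' c3' !OmE; ring.
  rewrite !c3r' p010 !dOm0l !(dOm12 _ (cj z3)) !dOm3.
  have := key _ _ _ tv tx ty.
  rewrite [br v x]brN [br v y]brN !pE !brE !OmE => e.
  have e2 := congr1 (fun z => Om z (cj z3)) (jacobi x y v).
  rewrite [br y v]psum [br x v]psum !brE !OmE in e2.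
  have e3 a b : Om (br a b) (cj z3) = - Om (br b a) (cj z3) by rewrite brN OmNl.
  rewrite (e3 (p10 _)) in e; rewrite !(e3 (p01 _)).
  by apply: (lin_comb2 e2 e); ring.
have [z1 [z2 [[t1 t2 n1 n2] [ o12 o13 o23]]]] : exists z1 z2,
    [/\ T10 z1, T10 z2, z1 <> 0 & z2 <> 0] /\ [/\ orth z1 z2, orth z1 z3 & orth z2 z3].
  have [z2 [t2 n2 o23 _]] := orth_ex z3 z3.
  by have [z1 [t1 n1 o12 o13]] := orth_ex z2 z3; exists z1, z2.
have span := orth_span t1 t2 t3 n1 n2 n3 o12 o13 o23.
have d1212 : d12 z1 z2 (cj z1) (cj z2) = 0.
  have := trace0 t1 t2 t3 n1 n2 n3 o12 o13 o23.
  have tc1 := T10_cj t1; have tc2 := T10_cj t2; have tc3 := T10_cj t3.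
  rewrite (d12_01 z3 z1) (d12_01 z3 z2) !left3// !oppr0 !mul0r !addr0 => /eqP.
  by rewrite mulf_eq0 (negPf (Om_neq0 t3 n3)) orbF => /eqP.
have d12z u v : T01 u -> T01 v -> d12 z1 z2 u v = 0.
  move=> tu tv; rewrite -[u]cjK -[v]cjK -[LHS]conjCK.
  rewrite -[RHS](rmorph0 (@Num.conj C)); congr (_^* ).
  apply: (alternating_vanish (ga := fun u v => (d12 z1 z2 (cj u) (cj v))^* ) span) => //.
  - by move=> a x y z; rewrite cjL d12L3 rmorphD rmorphM /= conjCK.
  - by move=> x y _ _; rewrite d12_23 rmorphN.
  - by move=> y /T10_cj ty; rewrite right3// rmorph0.
  - by rewrite d1212 rmorph0.
  - exact: T01_cj.
  - exact: T01_cj.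
move=> x y u v tx ty tu tv.
apply: (alternating_vanish (ga := fun x y => d12 x y u v) span) => //.
- by move=> a x' y' z; rewrite d12L1.
- by move=> x' y' _ _; rewrite d12_01.
- by move=> y' ty'; apply: left3.
- exact: d12z.
Qed.

(** Let D be the common adjoint action of [z3] and of its conjugate. It is a real
    derivation with D (D v) = 0, and on the (1,0)-vectors it has rank one, with
    image spanned by [e], the bracket of [z3] and [z1]. Applying D to the brackets
    of [z1], [e] and their conjugates, and using nilpotency to remove diagonal
    coefficients, one finds that [e] commutes with [z1] and with its conjugate, and
    that the bracket of [z1] and [cj e] is [m1 *: (z3 - cj z3)] with [m1] imaginary.
    With these brackets the trace condition is a sum of terms of the same sign,
    one of which, the product of the squared norms of [e] and [z2], is nonzero. *)
Lemma noncentral_type_absurd z3 : T10 z3 -> z3 <> 0 ->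
  (forall v, br z3 v = br (cj z3) v) -> (exists v, br z3 v <> 0) -> False.
Proof.
move=> t3 n3 c3 D0.
have [K hK] := br_nil.
have DT x : T10 x -> T10 (br z3 x) by exact: T10br.
have cjD3 v : cj (br z3 v) = br z3 (cj v) by rewrite cjbr -c3.
have [z1 [y [[t1 ty n1 ny] [ o1y o13 oy3] [[c fy] [a [b f1]]]]]] :=
  typed_flag (brLr z3) DT (ex_intro _ K (fun x _ => hK z3 x)) t3 n3 (brxx z3).
have {c}fy : br z3 y = 0.
  have [] := nilpotent_quadratic (t := - c) (s := 0) (brLr y) (hK y z3) _ n3.
    have E : br y z3 = - c *: z3 by rewrite brN fy scaleNr.
    by rewrite {1}E brZr scale0r addr0.
  move=> _ []; last by rewrite brN fy => /eqP; rewrite oppr_eq0 => /eqP.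
  by move=> /eqP; rewrite oppr_eq0 fy => /eqP->; rewrite scale0r.
have DD v : br z3 (br z3 v) = 0.
  have DD10 x : T10 x -> br z3 (br z3 x) = 0.
    move=> tx; have [k [l [m ->]]] := orth_span t1 ty t3 n1 ny n3 o1y o13 oy3 tx.
    by rewrite !brE f1 fy !brE fy !(scaler0, addr0).
  rewrite [v]psum !brE DD10 ?add0r; last exact: p10K.
  by apply: cj_inj; rewrite !cjD3 DD10 ?cj0//; apply: T01_cj; exact: p01K.
have a0 : a <> 0.
  move=> a0; move: f1; rewrite a0 scale0r add0r => f1.
  have f1' : br z3 z1 = 0.
    have [] := nilpotent_quadratic (t := - b) (s := 0) (brLr z1) (hK z1 z3) _ n3.
      have E : br z1 z3 = - b *: z3 by rewrite brN f1 scaleNr.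
      by rewrite {1}E brZr scale0r addr0.
    move=> _ []; last by rewrite brN => /eqP; rewrite oppr_eq0 => /eqP.
    by move=> /eqP; rewrite oppr_eq0 f1 => /eqP->; rewrite scale0r.
  case: D0 => v; apply; rewrite [v]psum brDr.
  have D10 x : T10 x -> br z3 x = 0.
    move=> tx; have [k [l [m ->]]] := orth_span t1 ty t3 n1 ny n3 o1y o13 oy3 tx.
    by rewrite !brE f1' fy !(scaler0, addr0).
  rewrite D10 ?add0r; last exact: p10K.
  by apply: cj_inj; rewrite cjD3 D10 ?cj0//; apply: T01_cj; exact: p01K.
(* Replacing [y] by a multiple gives [f z1 = z2 + b *: z3]. *)
set z2 := a *: y in f1.
have t2 : T10 z2 by exact: T10Z.
have n2 : z2 <> 0 by move=> /eqP; rewrite scaler_eq0 => /orP[/eqP|/eqP].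
have o23 : orth z2 z3 by rewrite /orth OmZl oy3 mulr0.
have o12 : orth z1 z2 by rewrite /orth /z2 cjZ OmZr o1y mulr0.
have f2 : br z3 z2 = 0 by rewrite /z2 brZr fy scaler0.
clearbody z2; clear a0 fy oy3 o1y ny ty y a D0 DT.
set e := br z3 z1 in f1.
have De : br z3 e = 0 by exact: DD.
have te : T10 e by exact: T10br.
have z2E : z2 = e - b *: z3 by rewrite f1 addrK.
have span v : T10 v -> exists k l m, v = k *: z1 + l *: e + m *: z3.
  move=> /(orth_span t1 t2 t3 n1 n2 n3 o12 o13 o23) [k [l [m ->]]].
  exists k, l, (m - l * b); rewrite f1 scalerBl scalerDr scalerA.
  by rewrite -!addrA; congr (_ + (_ + _)); rewrite addrCA subrr addr0.
have ne : e <> 0.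
  move=> e0; move: o23; rewrite /orth z2E e0 sub0r OmNl OmZl => /eqP.
  rewrite oppr_eq0 mulf_eq0 (negPf (Om_neq0 t3 n3)) orbF => /eqP b0.
  by apply: n2; rewrite z2E e0 b0 scale0r subrr.
have ec_neq0 := cj_neq0 ne.
have [tc1 [tce tc3]] := (T10_cj t1, (T10_cj te, T10_cj t3)).
have oe1 : Om e (cj z1) = 0.
  by rewrite f1 OmDl OmZl [Om z2 _](orthC o12) [Om z3 _](orthC o13) mulr0 addr0.
have o1e : Om z1 (cj e) = 0 := orthC oe1.
have ind k l : k *: e + l *: z3 = 0 -> k = 0 /\ l = 0.
  move=> kl; have k0 : k = 0.
    have := congr1 (fun z => Om z (cj z2)) kl.
    rewrite f1 !OmE [Om z3 _](orthC o23) !mulr0 !addr0 => /eqP.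
    by rewrite mulf_eq0 (negPf (Om_neq0 t2 n2)) orbF => /eqP.
  move: kl; rewrite k0 scale0r add0r => /eqP.
  by rewrite scaler_eq0 => /orP[/eqP|/eqP//].
have indc k l : k *: cj e + l *: cj z3 = 0 -> k = 0 /\ l = 0.
  move=> /(congr1 cj); rewrite !cjE => /ind[k0 l0].
  by rewrite -[k]conjCK k0 -[l]conjCK l0 rmorph0.
have B31 : br z3 z1 = e by [].
have B31c : br z3 (cj z1) = cj e by rewrite -cjD3.
have B3ec : br z3 (cj e) = 0 by rewrite -cjD3 De cj0.
have B33c : br z3 (cj z3) = 0 by rewrite c3 brxx.
have C3 v : br (cj z3) v = br z3 v by rewrite c3.
clearbody e.
have split_types x y : T10 x -> T01 y -> x + y = 0 -> x = 0 /\ y = 0.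
  move=> tx ty' xy0; have := congr1 p10 xy0.
  rewrite p10D tx T01_10// addr0 p100 => x0.
  by move: xy0; rewrite x0 add0r.
have Deriv x y' : br z3 (br x y') = br (br z3 x) y' + br x (br z3 y') by exact: jacobi.
(* Apply D twice to the bracket of [z1] and its conjugate. *)
have Bee : br e (cj e) = 0.
  have := DD (br z1 (cj z1)).
  rewrite (Deriv z1) B31 B31c brDr (Deriv e) (Deriv z1) De B31 B31c B3ec !brE add0r addr0.
  by rewrite -mulr2n -scaler_nat => /eqP; rewrite scaler_eq0 pnatr_eq0 => /eqP.
have B13 : br z1 z3 = - e by rewrite brN B31.
have B1e : br z1 e = 0.
  have [k [l [m E]]] := span _ (T10br t1 te).
  have := Deriv z1 e; rewrite E B31 De !brE B31 De !(scaler0, addr0).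
  move=> /eqP; rewrite scaler_eq0 => /orP[/eqP k0|/eqP//].
  rewrite k0 scale0r add0r in E.
  have [] := nilpotent_quadratic (t := l) (s := - m) (brLr z1) (hK z1 z3) _ n3.
    by rewrite B13 brNr E scalerN opprD scaleNr.
  move=> /eqP; rewrite oppr_eq0 => /eqP m0 [l0|].
    by rewrite k0 l0 m0 !scale0r !addr0.
  by rewrite brN B31 => /eqP; rewrite oppr_eq0 => /eqP.
have B13c : br z1 (cj z3) = - e by rewrite brN C3 B31.
have spanc v : T01 v -> exists k l m, v = k *: cj z1 + l *: cj e + m *: cj z3.
  move=> /T01_cj /span [k [l [m E]]]; exists k^*, l^*, m^*.
  by rewrite -[v]cjK E !cjE.
have [k1 [l1 [m1 E1]]] := span _ (p10K (br z1 (cj e))).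
have [k1' [l1' [m1' E1']]] := spanc _ (p01K (br z1 (cj e))).
have [k2 [l2 [m2 E2]]] := span _ (p10K (br z1 (cj z1))).
have [k2' [l2' [m2' E2']]] := spanc _ (p01K (br z1 (cj z1))).
have sc0 (k : C) (v : V) : v <> 0 -> k *: v = 0 -> k = 0.
  by move=> v0 /eqP; rewrite scaler_eq0 => /orP[/eqP//|/eqP].
have [k10 k10'] : k1 = 0 /\ k1' = 0.
  have := Deriv z1 (cj e); rewrite [br z1 (cj e)]psum E1 E1' B31 B3ec Bee !brE.
  rewrite B31 De B31c B33c B3ec !(scaler0, addr0).
  by move=> /split_types []; [exact: T10Z|exact: T01Z|move=> /sc0-> // /sc0->].
rewrite k10 scale0r add0r in E1; rewrite k10' scale0r add0r in E1'.
pose f v := p01 (br z1 v).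
have fL k x y' : f (k *: x + y') = k *: f x + f y' by rewrite /f brLr p01L.
have fK v : T01 v -> iter K f v = 0.
  move=> tv; suff -> : iter K f v = p01 (iter K (br z1) v) by rewrite hK p010.
  elim: K {hK} => [|n IH] //=; rewrite IH /f.
  rewrite [iter n _ v in RHS]psum brDr p01D [X in X + _]T10_01 ?add0r//.
  by apply: T10br => //; exact: p10K.
have fZ k x : f (k *: x) = k *: f x by rewrite (LZ fL).
have fD x y' : f (x + y') = f x + f y' by rewrite (LD fL).
have f1c : f (cj z1) = k2' *: cj z1 + l2' *: cj e + m2' *: cj z3 by [].
have fec : f (cj e) = l1' *: cj e + m1' *: cj z3 by [].
have f3c : f (cj z3) = 0 by rewrite /f B13c p01N T10_01 ?oppr0.
(* The diagonal coefficient of a nilpotent map vanishes. *)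
have k20' : k2' = 0.
  have fi n : Om z1 (iter n f (cj z1)) = k2' ^+ n * Om z1 (cj z1).
    elim: n => [|n IH]; first by rewrite mul1r.
    have tz : T01 (iter n f (cj z1)).
      by elim: n {IH} => //= n _; exact: p01K.
    have [k' [l' [m' E]]] := spanc _ tz.
    rewrite exprS -mulrA -IH iterS E !fD !fZ f1c fec f3c !OmE o1e.
    by rewrite [Om z1 (cj z3)]o13; ring.
  have := fi K; rewrite fK// Om0r => /esym/eqP.
  by rewrite mulf_eq0 (negPf (Om_neq0 t1 n1)) orbF expf_eq0 => /andP[_ /eqP].
have l10' : l1' = 0.
  have [] := nilpotent_quadratic (t := l1') (s := 0) fL (fK _ tce) _ ec_neq0.
    by rewrite {1}fec fD !fZ f3c scaler0 scale0r.
  by move=> _ [//|]; rewrite fec => /indc[].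
rewrite l10' scale0r add0r in E1'; rewrite k20' scale0r add0r in E2'.
have Bec1 : br e (cj z1) = - cj (br z1 (cj e)) by rewrite cjbr cjK brN.
have k20 : k2 = 0.
  have : cj (br z1 (cj z1)) = - br z1 (cj z1) by rewrite cjbr cjK brN.
  rewrite [br z1 (cj z1)]psum E2 E2' !cjE => /(congr1 p01).
  have tz := T10_01; rewrite !pE !(tz e, tz z1, tz z3)// tc1 tce tc3.
  rewrite !scaler0 !addr0 => /(congr1 (Om z1)).
  rewrite !OmE o1e [Om z1 (cj z3)]o13 !mulr0 !addr0 oppr0 => /eqP.
  rewrite mulf_eq0 (negPf (Om_neq0 t1 n1)) orbF => /eqP k0.
  by rewrite -[k2]conjCK k0 rmorph0.
rewrite k20 scale0r add0r in E2.
have [l10 m1E] : l1 = 0 /\ m1' = m1^*.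
  have := Deriv z1 (cj z1); rewrite B31 B31c Bec1 [br z1 (cj z1)]psum.
  rewrite [br z1 (cj e)]psum E1 E1' E2 E2' !brE De B3ec B33c !scaler0 !addr0 !cjE.
  move=> /(congr1 p10).
  rewrite !pE (T01_10 tce) (T01_10 tc3) te t3 !scaler0 !add0r addr0 => E.
  have {}E : l1 *: e + (m1 - m1'^* ) *: z3 = 0.
    by rewrite scalerBl addrA addrC; exact: esym E.
  have [-> /eqP] := ind _ _ E.
  by rewrite subr_eq0 => /eqP->; rewrite conjCK.
have {l10 m1E E1 E1'} B1ec : br z1 (cj e) = m1 *: z3 + m1^* *: cj z3.
  by rewrite [LHS]psum E1 E1' l10 m1E scale0r add0r.
have {Bec1} Be1c : br e (cj z1) = - (m1 *: z3 + m1^* *: cj z3).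
  by rewrite Bec1 B1ec !cjE conjCK addrC.
have {E2 E2'} B11c : br z1 (cj z1) = l2 *: e + m2 *: z3 + (l2' *: cj e + m2' *: cj z3).
  by rewrite [LHS]psum E2 E2'.
have m1c : m1^* = - m1.
  have := jacobi z1 (cj z1) e; rewrite B1e [br (cj z1) e]brN Be1c opprK B11c.
  rewrite !brE B13 B13c De [br (cj z3) e]C3 De [br (cj e) e]brN Bee.
  rewrite !(oppr0, scaler0, addr0, scalerN) -opprD -scalerDl => /eqP.
  rewrite oppr_eq0 scaler_eq0 => /orP[|/eqP//]; rewrite addrC addr_eq0 => /eqP; exact.
rewrite m1c in B1ec Be1c.
(* The multiplication table of [z1], [e], [z3] and their conjugates. *)
have Bs : ((br z1 z3 = - e) * (br z1 (cj z3) = - e) * (br z3 z1 = e) * (br (cj z3) z1 = e)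
  * (br z3 (cj z1) = cj e) * (br (cj z3) (cj z1) = cj e) * (br (cj z1) z3 = - cj e)
  * (br (cj z1) (cj z3) = - cj e)
  * (br z3 e = 0) * (br e z3 = 0) * (br (cj z3) e = 0) * (br e (cj z3) = 0)
  * (br z3 (cj e) = 0) * (br (cj e) z3 = 0) * (br (cj z3) (cj e) = 0) * (br (cj e) (cj z3) = 0)
  * (br z3 (cj z3) = 0) * (br (cj z3) z3 = 0)
  * (br e (cj e) = 0) * (br (cj e) e = 0) * (br z1 e = 0) * (br e z1 = 0)
  * (br (cj z1) (cj e) = 0) * (br (cj e) (cj z1) = 0))%type.
  have N := brN; do !split; rewrite // ?(B13, B13c, De, B3ec, B33c, B1e, Bee)// ?C3//;
  first [ by rewrite !C3 brxx | by rewrite -cjbr B1e cj0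
    | by rewrite N -cjbr B1e cj0 oppr0
    | by rewrite N !(C3, B31c, De, B3ec, B33c, Bee, B1e) ?oppr0 ].
have Bs' : ((br z1 (cj e) = (m1 *: z3 + - m1 *: cj z3)%R)
  * (br (cj e) z1 = (- (m1 *: z3 + - m1 *: cj z3))%R)
  * (br e (cj z1) = (- (m1 *: z3 + - m1 *: cj z3))%R)
  * (br (cj z1) e = (m1 *: z3 + - m1 *: cj z3)%R))%type.
  by do !split; rewrite // brN ?B1ec// Be1c opprK.
have Os : ((Om e e = 0) * (Om e z3 = 0) * (Om z3 e = 0) * (Om z3 z3 = 0) * (Om (cj e) (cj e) = 0)
  * (Om (cj e) (cj z3) = 0) * (Om (cj z3) (cj e) = 0) * (Om (cj z3) (cj z3) = 0)
  * (Om (cj e) e = - Om e (cj e)) * (Om (cj e) z3 = - Om z3 (cj e))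
  * (Om (cj z3) e = - Om e (cj z3)) * (Om (cj z3) z3 = - Om z3 (cj z3)))%type.
  by do !split; (exact: Om10 || exact: Om01 || exact: OmN).
have Ps : ((p01 e = 0) * (p01 z3 = 0) * (p01 (cj e) = cj e) * (p01 (cj z3) = cj z3))%type.
  by do !split => //; exact: T10_01.
have Th13 : d12 z1 z3 (cj z1) (cj z3) = - 2%:R * Om e (cj e).
  rewrite d12_typed// !Bs B11c !pE !Ps /dOm !brE !Bs !Bs' !OmE !Os.
  ring.
have Th23 : d12 z2 z3 (cj z2) (cj z3) = 0.
  rewrite d12_typed//; last exact: T10_cj.
  by rewrite z2E !cjE !brE !Bs !(scaler0, oppr0, addr0) !pE !dOm0l; ring.
have Th12 : d12 z1 z2 (cj z1) (cj z2) =
    - 2%:R * (b * b^* * Om e (cj e) + m1 * m1^* * Om z3 (cj z3)).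
  rewrite d12_typed//; last exact: T10_cj.
  rewrite m1c z2E !cjE !brE !Bs !Bs' B11c !pE !Ps /dOm !brE !Bs !Bs' !OmE !Os.
  ring.
have := trace0 t1 t2 t3 n1 n2 n3 o12 o13 o23; rewrite Th12 Th13 Th23.
have h3 := Ompos (x := z3); rewrite t3 in h3; have {}h3 := h3 n3.
have h2 := Ompos (x := z2); rewrite t2 in h2; have {}h2 := h2 n2.
have he := Ompos (x := e); rewrite te in he; have {}he := he ne.
move=> E0.
have : 0 < (b * b^* * (- iu * Om e (cj e)) + m1 * m1^* * (- iu * Om z3 (cj z3))) * (- iu * Om z3 (cj z3))
   + (- iu * Om e (cj e)) * (- iu * Om z2 (cj z2)).
  apply: ltr_wpDl; last exact: mulr_gt0.
  apply: mulr_ge0; last exact: ltW.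
  apply: addr_ge0; apply: mulr_ge0; rewrite ?mul_conjC_ge0//; exact: ltW.
rewrite (_ : _ + _ = 0) ?ltxx//.
apply: (mulfI (_ : 2%:R != 0)); first by rewrite pnatr_eq0.
rewrite mulr0 -[RHS](mulr0 (- (iu * iu))) -E0; ring.
Qed.

(** For a central vector [w], either [w] is real and [iu *: w] is anti-real, or
    [w - cj w] is nonzero: in both cases there is a central vector of the form
    [z3 - cj z3], where [z3] is of type (1,0). *)
Theorem trace_zero_vanish x y u v : T10 x -> T10 y -> T01 u -> T01 v -> d12 x y u v = 0.
Proof.
have [w w0 wc] := central_ex.
have wc' u' : br (cj w) u' = 0 by rewrite -[u']cjK -cjbr wc cj0.
have [X [X0 Xc XN]] : exists X, [/\ X <> 0, forall u', br X u' = 0 & cj X = - X].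
  have [E|E] := pselect (cj w = w).
    exists (iu *: w); split; first 1 last.
    - by move=> u'; rewrite brZl wc scaler0.
    - by rewrite cjZ E iuC scaleNr.
    - move=> /eqP; rewrite scaler_eq0 => /orP[|/eqP//] /eqP iu0.
      by have /eqP := iu2; rewrite iu0 mul0r eq_sym oppr_eq0 oner_eq0.
  exists (w - cj w); split.
  - by move=> /eqP; rewrite subr_eq0 => /eqP /esym.
  - by move=> u'; rewrite brDl brNl wc wc' subrr.
  - by rewrite cjD cjN cjK opprB addrC.
pose z3 := p10 X.
have z3N : X = z3 - cj z3 by rewrite cjp10 XN p01N opprK -psum.
have n3 : z3 <> 0 by move=> z0; apply: X0; rewrite z3N z0 cj0 subrr.
have t3 : T10 z3 by exact: p10K.
have c3 u' : br z3 u' = br (cj z3) u'.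
  by apply/eqP; rewrite -subr_eq0 -brNl -brDl -z3N Xc.
have [|nD] := pselect (exists u', br z3 u' <> 0).
  by move=> /(noncentral_type_absurd t3 n3 c3).
apply: (central_type_vanish t3 n3) => u'.
by apply: contrapT => h; apply: nD; exists u'.
Qed.

End HermitianLieAlgebra.

(** * Structure constants in dimension six *)

(** The hypotheses of [trace_zero_vanish] are checked on basis vectors: bracket,
    complex structure and form are given by real matrices over a closed field. *)
Section StructureConstants.
Variables (C : numClosedFieldType) (J N : 'M[C]_6) (iu : C).
Variable c : 'I_6 -> 'I_6 -> 'rV[C]_6.
Local Notation V := 'rV[C]_6.
Local Notation e i := (delta_mx 0 i : V).

Definition scbr (a b : V) : V := \sum_i \sum_j (a 0 i * b 0 j) *: c i j.
Definition vconj (x : V) : V := map_mx (@Num.conj C) x.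
Definition vp10 (x : V) : V := 2%:R^-1 *: (x - iu *: (x *m J)).
Definition vp01 (x : V) : V := 2%:R^-1 *: (x + iu *: (x *m J)).
Definition vform (x y : V) : C := (x *m N *m y^T) 0 0.

Hypothesis iu2 : iu * iu = -1.
Hypothesis iuC : iu^* = - iu.
Hypothesis J2 : J *m J = - 1%:M.
Hypothesis Jreal : map_mx (@Num.conj C) J = J.
Hypothesis Nreal : map_mx (@Num.conj C) N = N.
Hypothesis creal : forall i j, vconj (c i j) = c i j.
Hypothesis NT : N^T = - N.
Hypothesis JN : J *m N *m J^T = N.
Hypothesis Npos : forall x, vp10 x <> 0 -> 0 < - iu * vform (vp10 x) (vconj (vp10 x)).
Hypothesis cN : forall i j, c i j = - c j i.
Hypothesis cjac : forall i j k, scbr (e i) (scbr (e j) (e k)) =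
  scbr (scbr (e i) (e j)) (e k) + scbr (e j) (scbr (e i) (e k)).
Hypothesis cnil : exists K, forall s : seq 'I_6, size s = K ->
  forall j, foldr (fun i y => scbr (e i) y) (e j) s = 0.
Hypothesis cint : forall i j, scbr (e i *m J) (e j *m J) - scbr (e i *m J) (e j) *m J
  - scbr (e i) (e j *m J) *m J - scbr (e i) (e j) = 0.

Lemma scbrL a x y z : scbr (a *: x + y) z = a *: scbr x z + scbr y z.
Proof.
rewrite /scbr scaler_sumr -big_split; apply: eq_bigr => i _ /=.
rewrite scaler_sumr -big_split; apply: eq_bigr => j _ /=.
by rewrite !mxE mulrDl scalerDl scalerA mulrA.
Qed.

Lemma scbrN x y : scbr x y = - scbr y x.
Proof.
rewrite /scbr exchange_big -sumrN; apply: eq_bigr => j _ /=.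
rewrite -sumrN; apply: eq_bigr => i _ /=.
by rewrite cN scalerN mulrC.
Qed.

Lemma scbrR a x y z : scbr z (a *: x + y) = a *: scbr z x + scbr z y.
Proof. by rewrite scbrN scbrL opprD -scalerN -!scbrN. Qed.

Lemma linear_ext (W : lmodType C) (f : V -> W) :
  (forall a x y, f (a *: x + y) = a *: f x + f y) ->
  (forall i, f (e i) = 0) -> forall x, f x = 0.
Proof.
move=> fL f0 x; rewrite [x]row_sum_delta; elim/big_ind: _ => [|y z fy fz|i _].
- by have := fL (-1) 0 0; rewrite !scaleN1r oppr0 addr0 addNr.
- by rewrite -[y]scale1r fL fy fz scaler0 addr0.
- rewrite -[_ *: _]addr0 fL f0 scaler0 add0r.
  by have := fL (-1) 0 0; rewrite !scaleN1r oppr0 addr0 addNr.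
Qed.

Let addsub (W : zmodType) (x y z : W) : x - (y + z) = 0 -> x = y + z.
Proof. by move=> /eqP; rewrite subr_eq0 => /eqP. Qed.

Lemma scbr_jacobi x y z : scbr x (scbr y z) = scbr (scbr x y) z + scbr y (scbr x z).
Proof.
apply: addsub.
pose D x y z := scbr x (scbr y z) - (scbr (scbr x y) z + scbr y (scbr x z)).
rewrite -/(D x y z).
have simp (W : lmodType C) (a : C) (p q r p' q' r' : W) :
    a *: p + p' - (a *: q + q' + (a *: r + r')) = a *: (p - (q + r)) + (p' - (q' + r')).
  by rewrite scalerBr scalerDr [X in _ - X = _]addrACA opprD addrACA.
move: x; apply: linear_ext => [a x x'|i]; first by rewrite /D !(scbrL, scbrR) simp.
move: y; apply: linear_ext => [a y y'|j]; first by rewrite /D !(scbrL, scbrR) simp.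
move: z; apply: linear_ext => [a z z'|k]; first by rewrite /D !(scbrL, scbrR) simp.
by rewrite /D cjac subrr.
Qed.

(** The nilpotency hypothesis, about brackets with successive basis vectors,
    is multilinear and extends to arbitrary vectors one at a time. *)
Lemma scbr_nil : exists K, forall x y, iter K (scbr x) y = 0.
Proof.
have [K cK] := cnil; exists K => x y.
suff H n : forall s : seq 'I_6, (size s + n)%N = K -> forall x y,
    foldr (fun i y => scbr (e i) y) (iter n (scbr x) y) s = 0 by exact: (H K [::]).
have fL (s : seq 'I_6) a x1 x2 :
   foldr (fun i y => scbr (e i) y) (a *: x1 + x2) s =
   a *: foldr (fun i y => scbr (e i) y) x1 s + foldr (fun i y => scbr (e i) y) x2 s.
  by elim: s => //= i s ->; rewrite scbrR.
elim: n => [|n IH] s sK {}x {}y.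
  rewrite addn0 in sK; rewrite /=.
  by move: y; apply: linear_ext => [a y y'|j]; [exact: fL|exact: cK].
rewrite iterS; set z := iter _ _ _.
suff -> : forall w, foldr (fun i y => scbr (e i) y) (scbr w z) s = 0 by [].
apply: linear_ext => [a w w'|i]; first by rewrite scbrL fL.
have := IH (rcons s i); rewrite size_rcons addSnnS => /(_ sK x y).
by rewrite foldr_rcons.
Qed.

Lemma vconjL a x y : vconj (a *: x + y) = a^* *: vconj x + vconj y.
Proof. by rewrite /vconj map_mxD map_mxZ. Qed.

Lemma vconjK x : vconj (vconj x) = x.
Proof. by apply/rowP => i; rewrite !mxE conjCK. Qed.

Lemma vconj_scbr x y : vconj (scbr x y) = scbr (vconj x) (vconj y).
Proof.
rewrite /vconj /scbr raddf_sum; apply: eq_bigr => i _ /=.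
rewrite raddf_sum; apply: eq_bigr => j _ /=.
by rewrite map_mxZ rmorphM -[in RHS]creal !mxE.
Qed.

Lemma vp10L a x y : vp10 (a *: x + y) = a *: vp10 x + vp10 y.
Proof.
rewrite /vp10 mulmxDl -scalemxAl; apply/rowP => i; rewrite !mxE; ring.
Qed.

Let JJ (x : V) : x *m J *m J = - x.
Proof. by rewrite -mulmxA J2 mulmxN mulmx1. Qed.

Let two0 : 2%:R != 0 :> C. Proof. by rewrite pnatr_eq0. Qed.

Lemma vp10_J x : vp10 x *m J = iu *: vp10 x.
Proof.
rewrite /vp10 -scalemxAl mulmxBl -scalemxAl JJ scalerA [iu * _]mulrC -scalerA; congr (_ *: _).
by rewrite scalerN opprK scalerBr scalerA iu2 scaleN1r opprK addrC.
Qed.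

Lemma vp10_of_J x : x *m J = iu *: x -> vp10 x = x.
Proof.
move=> xJ; rewrite /vp10 xJ scalerA iu2 scaleN1r opprK -mulr2n -[x *+ 2]scaler_nat scalerA.
by rewrite mulVf ?scale1r.
Qed.

Lemma vp10K x : vp10 (vp10 x) = vp10 x.
Proof. by apply: vp10_of_J; exact: vp10_J. Qed.

Lemma vp01E x : vp01 x = x - vp10 x.
Proof.
apply: (can_inj (scalerK two0)).
rewrite /vp01 /vp10 scalerBr !scalerA divff// !scale1r.
by apply/rowP => i; rewrite !mxE; ring.
Qed.

Lemma vconj_vp10 x : vconj (vp10 x) = vp01 (vconj x).
Proof.
rewrite /vp10 /vp01 /vconj map_mxZ map_mxB map_mxZ map_mxM Jreal.
rewrite /= iuC scaleNr opprK; congr (_ *: _).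
by rewrite fmorphV rmorph_nat.
Qed.

Lemma scbr_integrable x y : vp10 (scbr (vp10 x) (vp10 y)) = scbr (vp10 x) (vp10 y).
Proof.
have pJ := vp10_J x; have qJ := vp10_J y.
move: (vp10 x) (vp10 y) pJ qJ => p q pJ qJ; apply: vp10_of_J.
pose D x y := scbr (x *m J) (y *m J) - scbr (x *m J) y *m J
  - scbr x (y *m J) *m J - scbr x y.
have D0 : D p q = 0.
  move: p {pJ}; apply: linear_ext => [a x1 x2|i].
    rewrite /D mulmxDl -!scalemxAl !scbrL !mulmxDl -!scalemxAl.
    by apply/rowP => k; rewrite !mxE; ring.
  move: q {qJ}; apply: linear_ext => [a x1 x2|j].
    rewrite /D mulmxDl -!scalemxAl !scbrR !mulmxDl -!scalemxAl.
    by apply/rowP => k; rewrite !mxE; ring.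
  exact: cint.
have Zl a x' y' : scbr (a *: x') y' = a *: scbr x' y'.
  have l0 : scbr 0 y' = 0.
    by have := scbrL (-1) 0 0 y'; rewrite !scaleN1r oppr0 addr0 addNr.
  by rewrite -[a *: x']addr0 scbrL l0 addr0.
have Zr a x' y' : scbr x' (a *: y') = a *: scbr x' y'.
  by rewrite scbrN Zl -scalerN -scbrN.
move: D0; rewrite /D pJ qJ !(Zl, Zr) scalerA iu2 -!scalemxAl scaleN1r.
set w := scbr p q; move=> /eqP.
have -> : - w - iu *: (w *m J) - iu *: (w *m J) - w = (- 2%:R) *: (w + iu *: (w *m J)).
  by apply/rowP => k; rewrite !mxE; ring.
rewrite scaler_eq0 oppr_eq0 (negPf two0) /= addr_eq0 => /eqP ww.
by rewrite [in RHS]ww scalerN scalerA iu2 scaleN1r opprK.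
Qed.

Lemma vformL a x y z : vform (a *: x + y) z = a * vform x z + vform y z.
Proof. by rewrite /vform !mulmxDl -!scalemxAl !mxE. Qed.

Lemma vformN x y : vform x y = - vform y x.
Proof.
have -> : vform x y = ((x *m N *m y^T)^T) 0 0 by rewrite mxE.
by rewrite !trmx_mul trmxK NT mulNmx mulmxN mulmxA mxE.
Qed.

Let vform0l z : vform 0 z = 0.
Proof. by have := vformL (-1) 0 0 z; rewrite scaler0 addr0 mulN1r addNr. Qed.

Lemma vform1010 x y : vform (vp10 x) (vp10 y) = 0.
Proof.
have : vform (vp10 x *m J) (vp10 y *m J) = vform (vp10 x) (vp10 y).
  by rewrite /vform trmx_mul -(mulmxA _ J N) -!mulmxA (mulmxA J) (mulmxA (J *m N)) JN !mulmxA.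
rewrite !vp10_J; move: (vp10 x) (vp10 y) => p q.
have -> : vform (iu *: p) (iu *: q) = iu * iu * vform p q.
  by rewrite -[iu *: p]addr0 vformL vformN -[iu *: q]addr0 vformL !vform0l [vform q p]vformN; ring.
rewrite iu2 mulN1r => /eqP.
by rewrite eq_sym -addr_eq0 -mulr2n mulrn_eq0 => /eqP.
Qed.

Lemma vform_conj x y : vform (vconj x) (vconj y) = (vform x y)^*.
Proof.
have yT : (vconj y)^T = map_mx (@Num.conj C) y^T by apply/matrixP => i j; rewrite !mxE.
by rewrite /vform -[N in LHS]Nreal /vconj yT -!map_mxM mxE.
Qed.

Lemma vpsum x : vp10 x + vp01 x = x.
Proof. by rewrite vp01E addrC subrK. Qed.
Lemma vconj0 : vconj 0 = 0. Proof. by rewrite /vconj map_mx0. Qed.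
Lemma vconj_vp01 x : vconj (vp01 x) = vp10 (vconj x).
Proof. by rewrite -[x in LHS]vconjK -vconj_vp10 vconjK. Qed.
Lemma vformR a x y z : vform z (a *: x + y) = a * vform z x + vform z y.
Proof. by rewrite vformN vformL opprD -mulrN -!vformN. Qed.
Lemma vformDl x y z : vform (x + y) z = vform x z + vform y z.
Proof. by have := vformL 1 x y z; rewrite scale1r mul1r. Qed.
Lemma vform0101 x y : vform (vp01 x) (vp01 y) = 0.
Proof.
by rewrite -[vp01 x]vconjK -[vp01 y]vconjK vform_conj !vconj_vp01 vform1010 rmorph0.
Qed.

Lemma vform_types x y : vform (vp10 x) (vp01 y) + vform (vp01 x) (vp10 y) = vform x y.
Proof.
rewrite -[in RHS](vpsum x) -[in RHS](vpsum y) vformDl.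
rewrite ![vform _ (vp10 y + vp01 y)]vformN !vformDl !opprD -!vformN.
by rewrite vform1010 vform0101 add0r addr0.
Qed.

Lemma vorth_ex x y : exists z,
  [/\ T10 vp10 z, z <> 0, orth vconj vform z x & orth vconj vform z y].
Proof.
(* A nonzero vector of any type orthogonal to four vectors exists in dimension
   six; one of its two typed components, conjugated if necessary, is suitable. *)
pose w := [:: vp10 x; vp10 y; vp01 (vconj x); vp01 (vconj y)].
pose W : 'M[C]_(4, 6) := \matrix_i nth 0 w i.
have /rowV0Pn[v vk v0] : kermx (N *m W^T) != 0.
  rewrite -mxrank_eq0 mxrank_ker -lt0n subn_gt0.
  exact: leq_ltn_trans (rank_leq_col _) _.
move: vk => /sub_kermxP vW.
have vw i : (i < 4)%N -> vform v (nth 0 w i) = 0.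
  move=> i4; have := congr1 (fun M : 'rV_4 => M 0 (Ordinal i4)) vW.
  rewrite mulmxA mxE [RHS]mxE => E; rewrite /vform mxE -[RHS]E.
  by apply: eq_bigr => k _; rewrite !mxE.
have o10 z u : vform z (vp01 (vconj u)) = 0 -> orth vconj vform (vp10 z) u.
  move=> h; rewrite /orth -[vconj u]vpsum -[vp10 _ + _]scale1r.
  rewrite scalerDr vformR !scale1r vform1010 mulr0 add0r.
  by rewrite -[z]vpsum vformDl vform0101 addr0 in h.
have [p0|p0] := eqVneq (vp10 v) 0.
  have q0 : vp01 v != 0 by apply: contra v0 => /eqP q0; rewrite -[v]vpsum p0 q0 addr0.
  have o01 u : vform v (vp10 u) = 0 -> orth vconj vform (vconj (vp01 v)) u.
    move=> h; rewrite vconj_vp01; apply: o10.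
    by rewrite -vconj_vp10 vform_conj h rmorph0.
  exists (vconj (vp01 v)); split.
  - by rewrite /T10 vconj_vp01 vp10K.
  - by move=> /(congr1 vconj); rewrite vconjK vconj0; apply/eqP.
  - exact: o01 (vw 0%N isT).
  - exact: o01 (vw 1%N isT).
exists (vp10 v); split.
- exact: vp10K.
- exact/eqP.
- exact: o10 (vw 2%N isT).
- exact: o10 (vw 3%N isT).
Qed.

(** The Gram matrix of [x], [y], [z] and their conjugates against their own
    conjugates is diagonal and invertible, so that these six vectors form a basis;
    the projection of type (1,0) kills the last three. *)
Lemma vorth_span x y z : T10 vp10 x -> T10 vp10 y -> T10 vp10 z ->
  x <> 0 -> y <> 0 -> z <> 0 -> orth vconj vform x y -> orth vconj vform x z ->
  orth vconj vform y z ->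
  forall v, T10 vp10 v -> exists a b c, v = a *: x + b *: y + c *: z.
Proof.
move=> tx ty tz x0 y0 z0 oxy oxz oyz v tv.
have p0 u : vp10 u = u -> u <> 0 -> vform u (vconj u) != 0.
  move=> tu u0; have := Npos (x := u); rewrite tu => /(_ u0).
  by apply: contraTneq => ->; rewrite mulr0 ltxx.
have oC u w : orth vconj vform u w -> orth vconj vform w u.
  by rewrite /orth => h; rewrite vformN -[w in vform _ w]vconjK vform_conj h rmorph0 oppr0.
pose w := [:: x; y; z; vconj x; vconj y; vconj z].
pose w' := [:: vconj x; vconj y; vconj z; x; y; z].
pose B : 'M[C]_6 := \matrix_i nth 0 w i.
pose B' : 'M[C]_6 := \matrix_i nth 0 w' i.
have Bw i j : (B *m N *m B'^T) i j = vform (nth 0 w i) (nth 0 w' j).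
  rewrite /vform !mxE; apply: eq_bigr => k _; congr (_ * _); last by rewrite !mxE.
  by rewrite !mxE; apply: eq_bigr => l _; rewrite !mxE.
have cc u u' : vp10 u = u -> vp10 u' = u' -> vform (vconj u) (vconj u') = 0.
  by move=> <- <-; rewrite vform_conj vform1010 rmorph0.
have c10 u u' : vp10 u = u -> vp10 u' = u' -> vform u u' = 0.
  by move=> <- <-; rewrite vform1010.
have c01 u u' : orth vconj vform u' u -> vform (vconj u) u' = 0.
  by rewrite /orth vformN => /eqP; rewrite oppr_eq0 => /eqP.
have Bu : B \in unitmx.
  have : B *m N *m B'^T \in unitmx.
    have -> : B *m N *m B'^T = diag_mx (\row_i vform (nth 0 w i) (nth 0 w' i)).
      apply/matrixP => i j; rewrite Bw !mxE.
      case: eqP => [->|ne]; first by rewrite mulr1n.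
      rewrite mulr0n; case: i ne => -[|[|[|[|[|[|]]]]]] //= hi;
      case: j => -[|[|[|[|[|[|]]]]]] //= hj ne;
      try (by case: ne; exact: val_inj); rewrite /w /w' /=;
      try (by apply: c10); try (by apply: cc);
      try exact: oxy; try exact: oxz; try exact: oyz;
      try (exact: (oC _ _ oxy)); try (exact: (oC _ _ oxz)); try (exact: (oC _ _ oyz));
      try (exact: (c01 _ _ oxy)); try (exact: (c01 _ _ oxz)); try (exact: (c01 _ _ oyz));
      try (exact: (c01 _ _ (oC _ _ oxy))); try (exact: (c01 _ _ (oC _ _ oxz)));
      exact: (c01 _ _ (oC _ _ oyz)).
    rewrite unitmxE det_diag unitfE; apply/prodf_neq0 => i _; rewrite mxE.
    by case: i => -[|[|[|[|[|[|]]]]]] //= hi; rewrite ?[vform (vconj _) _]vformN ?oppr_eq0; exact: p0.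
  by rewrite -mulmxA unitmx_mul => /andP[].
pose k := v *m invmx B.
exists (k 0 (@Ordinal 6 0 isT)), (k 0 (@Ordinal 6 1 isT)), (k 0 (@Ordinal 6 2 isT)).
have vE : v = \sum_i k 0 i *: nth 0 w i.
  rewrite -[LHS](mulmxKV Bu) -/k [k in LHS]row_sum_delta mulmx_suml.
  by apply: eq_bigr => i _; rewrite -scalemxAl -rowE rowK.
have p10c u : vp10 u = u -> vp10 (vconj u) = 0.
  move=> tu; have : vconj (vp10 u) = vp01 (vconj u) := vconj_vp10 u.
  rewrite tu vp01E => /eqP; rewrite -subr_eq0 opprB addrCA subrr addr0.
  by move/eqP.
rewrite -[LHS]tv {1}vE !big_ord_recl big_ord0 /= addr0.
have p10Dl p q : vp10 (p + q) = vp10 p + vp10 q.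
  by have := vp10L 1 p q; rewrite !scale1r.
have p10Z a p : vp10 (a *: p) = a *: vp10 p.
  have p0' : vp10 0 = 0 by have := vp10L (-1) 0 0; rewrite !scaleN1r oppr0 addr0 addNr.
  by have := vp10L a p 0; rewrite p0' !addr0.
rewrite !p10Dl !p10Z !p10c// [vp10 x]tx [vp10 y]ty [vp10 z]tz !scaler0 !addr0 addrA.
by congr (k 0 _ *: _ + k 0 _ *: _ + k 0 _ *: _); apply: val_inj.
Qed.

Hypothesis central : exists2 z : V, z <> 0 & forall i, scbr z (e i) = 0.

Definition vd12 := d12 scbr vp10 vp01 vform.

Theorem scbr_trace_zero_vanish :
  (forall x y z, T10 vp10 x -> T10 vp10 y -> T10 vp10 z ->
    x <> 0 -> y <> 0 -> z <> 0 ->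
    orth vconj vform x y -> orth vconj vform x z -> orth vconj vform y z ->
    vd12 x y (vconj x) (vconj y) * vform z (vconj z)
    + vd12 x z (vconj x) (vconj z) * vform y (vconj y)
    + vd12 y z (vconj y) (vconj z) * vform x (vconj x) = 0) ->
  forall x y u v, T10 vp10 x -> T10 vp10 y -> T01 vp01 u -> T01 vp01 v ->
    vd12 x y u v = 0.
Proof.
move=> tr0.
apply: (trace_zero_vanish scbrL scbrN scbr_jacobi scbr_nil vconjL vconjK vconj_scbr
  vp10L vp10K vp01E vconj_vp10 scbr_integrable vformL vformN vform1010 vform_conj
  iu2 iuC Npos vorth_ex vorth_span _ tr0).
have [z z0 zc] := central; exists z => //; apply: linear_ext => // a x y.
exact: scbrR.
Qed.

End StructureConstants.

(** * Alternating forms and their types *)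

Section ConstantForms.
Variables (C : fieldType) (V : lmodType C) (p10 p01 : V -> V).

(** The component of type (p, k - p) of a form with constant coefficients. *)
Definition ctype k p (A : ('I_k -> V) -> C) (v : 'I_k -> V) : C :=
  \sum_(S : {set 'I_k} | #|S| == p)
    A (fun i => if i \in S then p10 (v i) else p01 (v i)).

Definition alternating k (A : ('I_k -> V) -> C) :=
  forall (s : 'S_k) v, A (v \o s) = (-1) ^+ s * A v.

(** All that is used of multilinearity when separating types. *)
Definition kills0 k (A : ('I_k -> V) -> C) :=
  forall v i, v i = 0 -> A v = 0.

Let set_neq k (S T : {set 'I_k}) : T <> S -> exists i, (i \in T) != (i \in S).
Proof.
move=> TS; apply: contrapT => nex; apply: TS; apply/setP => i.
by apply/eqP; apply: contrapT => /negP ne; apply: nex; exists i.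
Qed.

Lemma alternating_tperm k (A : ('I_k -> V) -> C) :
  (forall i j v, i != j -> A (v \o tperm i j) = - A v) -> alternating A.
Proof.
move=> At s; have [ts -> dts] := prod_tpermP s.
elim: ts dts => [_ v|[i j] ts IH /= /andP[ij /IH {}IH] v].
  rewrite big_nil odd_perm1 mul1r; congr A.
  by apply/funext => i /=; rewrite perm1.
rewrite big_cons odd_mul_tperm ij signr_addb mulN1r.
have -> : v \o (tperm i j * \prod_(t <- ts) tperm t.1 t.2)%g
   = (v \o (\prod_(t <- ts) tperm t.1 t.2)%g) \o tperm i j.
  by apply/funext => k' /=; rewrite permM.
by rewrite At// IH mulNr.
Qed.

Lemma ctype_alternating k p (A : ('I_k -> V) -> C) :
  alternating A -> alternating (ctype p A).
Proof.
move=> Aalt s v; rewrite /ctype big_distrr /=.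
rewrite [RHS](reindex_inj (imset_inj (@perm_inj _ s))) /=.
apply: eq_big => [S|S _]; first by rewrite card_imset//; exact: perm_inj.
rewrite -Aalt; congr A; apply/funext => i /=.
by rewrite mem_imset//; exact: perm_inj.
Qed.

(** Terms which select different sets of (1,0)-arguments apply both projections
    to some argument. *)
Lemma ctypeK k p q (A : ('I_k -> V) -> C) :
  (forall x, p10 (p10 x) = p10 x) -> (forall x, p01 (p01 x) = p01 x) ->
  (forall x, p10 (p01 x) = 0) -> (forall x, p01 (p10 x) = 0) -> kills0 A ->
  ctype p (ctype q A) = if p == q then ctype q A else fun=> 0.
Proof.
move=> h00 h11 h01 h10 A0; apply/funext => v.
pose F (S : {set 'I_k}) := A (fun i => if i \in S then p10 (v i) else p01 (v i)).
rewrite {1}/ctype.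
have E (S : {set 'I_k}) : ctype q A (fun i => if i \in S then p10 (v i) else p01 (v i)) =
    if #|S| == q then F S else 0.
  rewrite /ctype; case: ifP => [Sq|Sq].
    rewrite (bigD1 S)//= big1 ?addr0.
      by rewrite {1}/F; congr A; apply/funext => i; case: ifP => iS; rewrite ?iS ?h00 ?h11.
    move=> T /andP[_ /eqP TS].
    have [i Ti] := set_neq TS.
    apply: (A0 _ i); move: Ti.
    by case: (i \in T); case: (i \in S).
  rewrite big1// => T /eqP Tq.
  have [i Ti] : exists i, (i \in T) != (i \in S).
    by apply: set_neq => TS; move: Sq; rewrite -TS Tq eqxx.
  apply: (A0 _ i); move: Ti.
  by case: (i \in T); case: (i \in S).
rewrite (eq_bigr _ (fun S _ => E S)) -big_mkcondr /=.
case: ifP => [/eqP->|/negbT pq]; first by apply: eq_bigl => S; rewrite andbb.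
rewrite big1// => S /andP[/eqP-> /eqP e].
by rewrite e eqxx in pq.
Qed.

Lemma ctype_pure k p (A : ('I_k -> V) -> C) (S : {set 'I_k}) v : kills0 A ->
  (forall i, if i \in S then p10 (v i) = v i /\ p01 (v i) = 0
             else p10 (v i) = 0 /\ p01 (v i) = v i) ->
  ctype p A v = if #|S| == p then A v else 0.
Proof.
move=> A0 vS; rewrite /ctype.
have EA (T : {set 'I_k}) : A (fun i => if i \in T then p10 (v i) else p01 (v i)) =
    if T == S then A v else 0.
  case: eqP => [->|TS].
    by congr A; apply/funext => i; have := vS i; case: ifP => _ [].
  have [i Ti] := set_neq TS.
  apply: (A0 _ i); move: Ti (vS i).
  by case: (i \in T); case: (i \in S) => // _ [].
rewrite (eq_bigr _ (fun T _ => EA T)) -big_mkcondr /=.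
case: ifP => [/eqP Sp|/negP Sp].
  by rewrite (big_pred1 S)// => T; rewrite /= andbC; case: eqP => // ->; rewrite Sp eqxx.
by rewrite big1// => T /andP[Tp /eqP TS]; case: Sp; rewrite -TS.
Qed.

Lemma ctype1 k (A : ('I_k -> V) -> C) v :
  ctype 1 A v = \sum_i A (fun j => if j == i then p10 (v j) else p01 (v j)).
Proof.
rewrite /ctype.
pose F (S : {set 'I_k}) := A (fun i => if i \in S then p10 (v i) else p01 (v i)).
transitivity (\sum_(S in [set [set x] | x in 'I_k]) F S).
  apply: eq_bigl => S; apply/cards1P/imsetP => [[x ->]|[x _ ->]]; first by exists x.
  by exists x.
rewrite big_imset /=; last by move=> x y _ _ /set1_inj.
by apply: eq_bigr => i _; congr A; apply/funext => j; rewrite inE.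
Qed.

End ConstantForms.

Section MultilinearForms.
Variables (C : fieldType) (V : lmodType C) (p10 p01 : V -> V).
Local Notation o2 k := (@Ordinal 2 k isT).
Local Notation o3 k := (@Ordinal 3 k isT).
Local Notation o4 k := (@Ordinal 4 k isT).

Definition form2 (O : V -> V -> C) (v : 'I_2 -> V) := O (v (o2 0)) (v (o2 1)).
Definition form3 (O : V -> V -> V -> C) (v : 'I_3 -> V) :=
  O (v (o3 0)) (v (o3 1)) (v (o3 2)).
Definition form4 (O : V -> V -> V -> V -> C) (v : 'I_4 -> V) :=
  O (v (o4 0)) (v (o4 1)) (v (o4 2)) (v (o4 3)).

Lemma ord2P (i : 'I_2) : i = o2 0 \/ i = o2 1.
Proof. by case: i => -[|[|//]] h; [left|right]; exact: val_inj. Qed.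

Lemma ord4P (i : 'I_4) : [\/ i = o4 0, i = o4 1, i = o4 2 | i = o4 3].
Proof.
case: i => -[|[|[|[|//]]]] h;
[apply: Or41|apply: Or42|apply: Or43|apply: Or44]; exact: val_inj.
Qed.

Lemma ctype1_form2 O v : ctype p10 p01 1 (form2 O) v =
  O (p10 (v (o2 0))) (p01 (v (o2 1))) + O (p01 (v (o2 0))) (p10 (v (o2 1))).
Proof. by rewrite ctype1 !big_ord_recl big_ord0 addr0. Qed.

Lemma ctype1_form3 O v : let x := v (o3 0) in let y := v (o3 1) in let z := v (o3 2) in
  ctype p10 p01 1 (form3 O) v = O (p10 x) (p01 y) (p01 z)
    + O (p01 x) (p10 y) (p01 z) + O (p01 x) (p01 y) (p10 z).
Proof. by rewrite /= ctype1 !big_ord_recl big_ord0 addr0 addrA. Qed.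

Lemma kills_form2 (O : V -> V -> C) :
  (forall y, O 0 y = 0) -> (forall x y, O x y = - O y x) -> kills0 (form2 O).
Proof.
move=> O0 ON v [[|[|//]] hi] vi; rewrite /form2.
  by rewrite (_ : v _ = 0) ?O0// -vi; congr v; exact: val_inj.
by rewrite ON (_ : v _ = 0) ?O0 ?oppr0// -vi; congr v; exact: val_inj.
Qed.

Lemma kills_form3 (O : V -> V -> V -> C) : (forall y z, O 0 y z = 0) ->
  (forall x y z, O y x z = - O x y z) -> (forall x y z, O x z y = - O x y z) ->
  kills0 (form3 O).
Proof.
move=> O0 O01 O12 v [[|[|[|//]]] hi] vi; rewrite /form3.
- by rewrite (_ : v _ = 0) ?O0// -vi; congr v; exact: val_inj.
- by rewrite O01 (_ : v _ = 0) ?O0 ?oppr0// -vi; congr v; exact: val_inj.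
- by rewrite O12 O01 (_ : v _ = 0) ?O0 ?oppr0// -vi; congr v; exact: val_inj.
Qed.

Lemma kills_form4 (O : V -> V -> V -> V -> C) : (forall y z t, O 0 y z t = 0) ->
  (forall x y z t, O y x z t = - O x y z t) -> (forall x y z t, O x z y t = - O x y z t) ->
  (forall x y z t, O x y t z = - O x y z t) -> kills0 (form4 O).
Proof.
move=> O0 O01 O12 O23 v [[|[|[|[|//]]]] hi] vi; rewrite /form4.
- by rewrite (_ : v _ = 0) ?O0// -vi; congr v; exact: val_inj.
- by rewrite O01 (_ : v _ = 0) ?O0 ?oppr0// -vi; congr v; exact: val_inj.
- by rewrite O12 O01 (_ : v _ = 0) ?O0 ?oppr0// -vi; congr v; exact: val_inj.
- by rewrite O23 O12 O01 (_ : v _ = 0) ?O0 ?oppr0// -vi; congr v; exact: val_inj.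
Qed.

Lemma alternating_form2 (O : V -> V -> C) :
  (forall x y, O x y = - O y x) -> alternating (form2 O).
Proof.
move=> ON; apply: alternating_tperm => i j v ij; rewrite /form2 /=.
have e01 : o2 0 != o2 1 by [].
move: (o2 0) (o2 1) (ord2P i) (ord2P j) e01 => a b Hi Hj ab.
move: ij; case: Hi => ->; case: Hj => ->; rewrite ?eqxx // => _.
  by rewrite tpermL tpermR ON.
by rewrite tpermL tpermR ON.
Qed.

Lemma alternating_form4 (O : V -> V -> V -> V -> C) :
  (forall x y z t, O y x z t = - O x y z t) -> (forall x y z t, O x z y t = - O x y z t) ->
  (forall x y z t, O x y t z = - O x y z t) -> alternating (form4 O).
Proof.
move=> O01 O12 O23; apply: alternating_tperm.
have E13 x y z t : O x t z y = - O x y z t by rewrite O12 O23 O12 opprK.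
have E02 x y z t : O z y x t = - O x y z t by rewrite O01 O12 O01 opprK.
have E03 x y z t : O t y z x = - O x y z t by rewrite O01 E13 O01 opprK.
move=> i j v; rewrite /form4 /=.
have e01 : o4 0 != o4 1 by []. have e02 : o4 0 != o4 2 by [].
have e03 : o4 0 != o4 3 by []. have e12 : o4 1 != o4 2 by [].
have e13 : o4 1 != o4 3 by []. have e23 : o4 2 != o4 3 by [].
move: (o4 0) (o4 1) (o4 2) (o4 3) (ord4P i) (ord4P j) e01 e02 e03 e12 e13 e23.
move=> a b c d Hi Hj ab ac ad bc bd cd.
case: Hi => ->; case: Hj => ->; rewrite ?eqxx // => _;
  rewrite ?tpermL ?tpermR !tpermD //; try (by rewrite eq_sym);
  first [exact: O01 | exact: O12 | exact: O23 | exact: E13 | exact: E02 | exact: E03].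
Qed.

End MultilinearForms.

(** * Wedge product of a 4-form and a 2-form *)

Section BlockPermutations.

(** By induction on the number of points moved by [t]: composing [t] with the
    transposition of [x] and [t x], which lie in the same block of [be], fixes one
    more point. *)
Lemma block_perm_const n (D : Type) (B : eqType) (be : 'I_n -> B) (g : 'S_n -> D) :
  (forall x y t, x != y -> be x = be y -> g (tperm x y * t)%g = g t) ->
  forall t : 'S_n, (forall i, be (t i) = be i) -> g t = g 1%g.
Proof.
move=> gt t; have [m] := ubnP #|[set i | t i != i]|.
elim: m t => // m IH t tm bt.
have [t1|] := pselect (forall i, t i = i).
  by congr g; apply/permP => i; rewrite perm1 t1.
move=> /existsNP[x /eqP tx].
pose t' := (tperm x (t x) * t)%g.
have t'x : t' (t x) = t x by rewrite permM tpermR.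
have bt' i : be (t' i) = be i.
  by rewrite permM bt; case: tpermP => // ->; rewrite bt.
rewrite -(gt x (t x)) ?bt// 1?eq_sym//.
rewrite ltnS in tm; apply: IH bt'; apply: leq_trans tm; apply: proper_card.
apply/properP; split; last first.
  exists (t x); first by rewrite inE; apply: contra tx => /eqP/perm_inj->.
  by rewrite inE t'x eqxx.
apply/fintype.subsetP => i; rewrite !inE permM.
case: tpermP => [->|->|//]; last by rewrite eqxx.
by rewrite tx.
Qed.

End BlockPermutations.

Section Wedge42.
Variables (C : numFieldType) (V : lmodType C).

Definition wedge_sum k l (A : ('I_k -> V) -> C) (B : ('I_l -> V) -> C)
    (v : 'I_(k + l) -> V) :=
  \sum_(s : 'S_(k + l)) (-1) ^+ s * A (fun i => v (s (lshift l i)))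
                                 * B (fun j => v (s (rshift k j))).

Lemma wedge_term_block k l (A : ('I_k -> V) -> C) (B : ('I_l -> V) -> C) v (s t : 'S_(k + l)) :
  alternating A -> alternating B ->
  (forall i, (t i < k)%N = (i < k)%N) ->
  let f (s : 'S_(k + l)) := (-1) ^+ s * A (fun i => v (s (lshift l i)))
                                      * B (fun j => v (s (rshift k j))) in
  f (t * s)%g = f s.
Proof.
move=> Aalt Balt tk f; rewrite -[s in RHS]mul1g.
apply: (block_perm_const (be := fun i : 'I_(k + l) => (i < k)%N) (g := fun t => f (t * s)%g)) => //.
move=> x y {tk} t' xy bxy; rewrite /f -mulgA odd_mul_tperm xy signr_addb mulN1r.
case: (split_ordP x) xy bxy => i ->; case: (split_ordP y) => j -> xy /=.
- move=> _; rewrite (inj_eq (@lshift_inj _ _)) in xy.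
  have -> : (fun i0 => v ((tperm (lshift l i) (lshift l j) * (t' * s))%g (lshift l i0))) =
     (fun i0 => v ((t' * s)%g (lshift l i0))) \o tperm i j.
    apply/funext => a /=; rewrite [LHS]/= permM; congr (v (_ _)).
    case: tpermP => [/lshift_inj->|/lshift_inj->|]; rewrite ?tpermL ?tpermR//.
    by move=> /eqP n1 /eqP n2; rewrite tpermD// eq_sym; [move: n1|move: n2]; rewrite (inj_eq (@lshift_inj _ _)).
  have -> : (fun j0 => v ((tperm (lshift l i) (lshift l j) * (t' * s))%g (rshift k j0))) =
     (fun j0 => v ((t' * s)%g (rshift k j0))).
    by apply/funext => a /=; rewrite permM tpermD// ?eq_lrshift.
  by rewrite Aalt odd_tperm xy expr1 mulN1r mulrNN.
- by [].
- by [].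
- move=> _; rewrite (inj_eq (@rshift_inj _ _)) in xy.
  have -> : (fun i0 => v ((tperm (rshift k i) (rshift k j) * (t' * s))%g (rshift k i0))) =
     (fun i0 => v ((t' * s)%g (rshift k i0))) \o tperm i j.
    apply/funext => a /=; rewrite [LHS]/= permM; congr (v (_ _)).
    case: tpermP => [/rshift_inj->|/rshift_inj->|]; rewrite ?tpermL ?tpermR//.
    by move=> /eqP n1 /eqP n2; rewrite tpermD// eq_sym; [move: n1|move: n2]; rewrite (inj_eq (@rshift_inj _ _)).
  have -> : (fun j0 => v ((tperm (rshift k i) (rshift k j) * (t' * s))%g (lshift l j0))) =
     (fun j0 => v ((t' * s)%g (lshift l j0))).
    by apply/funext => a /=; rewrite permM tpermD// eq_sym ?eq_lrshift.
  by rewrite Balt odd_tperm xy expr1 mulN1r mulrN !mulNr opprK.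
Qed.

Definition vec k (s : seq V) : 'I_k -> V := fun i => nth 0 s i.

Local Notation o k := (@Ordinal 6 k isT).

(** The terms of the sum are grouped by the pair of arguments fed to [B]: terms
    with the same pair are equal ([wedge_term_block]), all pairs occur equally
    often, and all but three pairs give zero. *)
Lemma wedge_sum42 (A : ('I_4 -> V) -> C) (B : ('I_2 -> V) -> C) (x y z x' y' z' : V) :
  alternating A -> alternating B ->
  (forall a b : 'I_6, [set a; b] \notin [:: [set o 0; o 2]; [set o 1; o 3]; [set o 4; o 5]] ->
     B (vec [:: vec [:: x; y; x'; y'; z; z'] a; vec [:: x; y; x'; y'; z; z'] b]) = 0) ->
  exists2 N : nat, (0 < N)%N &
  wedge_sum A B (vec [:: x; y; x'; y'; z; z']) = N%:R *
   (A (vec [:: x; y; x'; y']) * B (vec [:: z; z'])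
  + A (vec [:: x; z; x'; z']) * B (vec [:: y; y'])
  + A (vec [:: z; y; z'; y']) * B (vec [:: x; x'])).
Proof.
move=> Aalt Balt B0; set v := vec _.
pose f (s : 'S_(4 + 2)) := (-1) ^+ s * A (fun i => v (s (lshift 2 i)))
                                 * B (fun j => v (s (rshift 4 j))).
pose key (s : 'S_(4 + 2)) : {set 'I_6} := [set s (o 4); s (o 5)].
have mem_key (s : 'S_(4 + 2)) i : (s i \in key s) = ~~ (i < 4)%N.
  rewrite !inE !(inj_eq perm_inj).
  by case: i => -[|[|[|[|[|[|]]]]]].
have f_key (s t : 'S_(4 + 2)) : key s = key t -> f s = f t.
  move=> st; have -> : s = ((s * t^-1) * t)%g by rewrite mulgKV.
  apply: wedge_term_block => // i; apply: negb_inj.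
  by rewrite -(mem_key s i) -(mem_key t) -st permM permKV.
have key_mul (s t : 'S_(4 + 2)) : key (s * t)%g = t @: key s.
  by rewrite imsetU !imset_set1 /key !permM.
pose a2 : 'S_(4 + 2) := (tperm (o 1) (o 4) * tperm (o 3) (o 5))%g.
pose a3 : 'S_(4 + 2) := (tperm (o 0) (o 4) * tperm (o 2) (o 5))%g.
have card_key (t : 'S_(4 + 2)) : #|[set s | key s == key t]| = #|[set s | key s == key 1%g]|.
  rewrite -[RHS](card_imset _ (mulIg t)); apply: eq_card => s; rewrite !inE.
  apply/eqP/imsetP => [E|[u]].
    exists (s * t^-1)%g; last by rewrite mulgKV.
    rewrite inE; apply/eqP; apply: (imset_inj (@perm_inj _ t)).
    by rewrite -!key_mul mulgKV mul1g.
  by rewrite inE => /eqP u1 ->; rewrite key_mul u1 -key_mul mul1g.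
exists #|[set s | key s == key 1%g]|.
  by apply/card_gt0P; exists 1%g; rewrite inE.
have k1 : key 1%g = [set o 4; o 5] by rewrite /key !perm1.
have k2 : key a2 = [set o 1; o 3].
  by rewrite /key /a2 !permM !permE /=.
have k3 : key a3 = [set o 0; o 2].
  by rewrite /key /a3 !permM !permE /=.
have f1 : f 1%g = A (vec [:: x; y; x'; y']) * B (vec [:: z; z']).
  rewrite /f odd_perm1 mul1r; congr (A _ * B _); apply/funext => -[[|[|[|[|]]]] h] //;
  by rewrite /vec perm1.
have f2 : f a2 = A (vec [:: x; z; x'; z']) * B (vec [:: y; y']).
  rewrite /f odd_permM !odd_tperm mul1r; congr (A _ * B _); apply/funext => -[[|[|[|[|]]]] h] //;
  by rewrite /vec permM !permE.
have f3 : f a3 = A (vec [:: z; y; z'; y']) * B (vec [:: x; x']).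
  rewrite /f odd_permM !odd_tperm mul1r; congr (A _ * B _); apply/funext => -[[|[|[|[|]]]] h] //;
  by rewrite /vec permM !permE.
rewrite -f1 -f2 -f3 !mulrDr.
have cnt (t : 'S_(4 + 2)) : #|[set s | key s == key 1%g]|%:R * f t = \sum_(s | key s == key t) f s.
  rewrite -(card_key t) mulr_natl -sumr_const big_set /=.
  by apply: eq_bigr => s /eqP/f_key.
rewrite !cnt k1 k2 k3.
have ne12 : [set o 4; o 5] != [set o 1; o 3] :> {set 'I_6}.
  by apply/eqP => /setP/(_ (o 4)); rewrite !inE.
have ne13 : [set o 4; o 5] != [set o 0; o 2] :> {set 'I_6}.
  by apply/eqP => /setP/(_ (o 4)); rewrite !inE.
have ne23 : [set o 1; o 3] != [set o 0; o 2] :> {set 'I_6}.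
  by apply/eqP => /setP/(_ (o 1)); rewrite !inE.
rewrite /wedge_sum -/f (bigID (fun s => key s == [set o 4; o 5])) /= -addrA; congr (_ + _).
rewrite (bigID (fun s => key s == [set o 1; o 3])) /=; congr (_ + _).
  apply: eq_bigl => s; rewrite andbC; case: eqP => //= ->.
  by rewrite eq_sym ne12.
rewrite (bigID (fun s => key s == [set o 0; o 2])) /= [X in _ + X]big1 ?addr0.
  apply: eq_bigl => s; rewrite andbC; case: eqP => //= ->.
  by rewrite ![[set o 0; o 2] == _]eq_sym ne13 ne23.
move=> s /andP[/andP[n1 n2] n3].
rewrite /f [B _](_ : _ = 0) ?mulr0//.
have := B0 (s (o 4)) (s (o 5)); rewrite !inE !negb_or n1 n2 n3 => /(_ isT) <-.
congr B; apply/funext => -[[|[|]] h] //=; congr (v (s _)); exact: val_inj.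
Qed.

Lemma ord6P (i : 'I_6) :
  [\/ [\/ i = o 0, i = o 1 | i = o 2] | [\/ i = o 3, i = o 4 | i = o 5]].
Proof.
case: i => -[|[|[|[|[|[|//]]]]]] h; [left; apply: Or31|left; apply: Or32|left; apply: Or33
  |right; apply: Or31|right; apply: Or32|right; apply: Or33]; exact: val_inj.
Qed.

(** Only pairs made of one vector and its partner contribute: [O] vanishes on
    vectors of the same type, and distinct basis vectors are orthogonal. *)
Lemma wedge_sum42_types (A : ('I_4 -> V) -> C) (O : V -> V -> C) (x y z x' y' z' : V) :
  alternating A -> (forall u v, O u v = - O v u) ->
  (forall u v, u \in [:: x; y; z] -> v \in [:: x; y; z] -> O u v = 0) ->
  (forall u v, u \in [:: x'; y'; z'] -> v \in [:: x'; y'; z'] -> O u v = 0) ->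
  O x y' = 0 -> O x z' = 0 -> O y x' = 0 -> O y z' = 0 -> O z x' = 0 -> O z y' = 0 ->
  wedge_sum A (form2 O) (vec [:: x; y; x'; y'; z; z']) = 0 ->
  A (vec [:: x; y; x'; y']) * O z z' + A (vec [:: x; z; x'; z']) * O y y'
  + A (vec [:: z; y; z'; y']) * O x x' = 0.
Proof.
move=> Aalt ON O10 O01 xy xz yx yz zx zy.
have [] := wedge_sum42 (x := x) (y := y) (z := z) (x' := x') (y' := y') (z' := z')
  Aalt (alternating_form2 ON); last first.
  move=> k k0 -> /eqP; rewrite mulf_eq0 pnatr_eq0 -[k == 0%N]negbK -lt0n k0 /=.
  by move/eqP.
have N0 u v : O u v = 0 -> O v u = 0 by move=> h; rewrite ON h oppr0.
have s20 : [set o 2; o 0] = [set o 0; o 2] by rewrite finset.setUC.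
have s31 : [set o 3; o 1] = [set o 1; o 3] by rewrite finset.setUC.
have s54 : [set o 5; o 4] = [set o 4; o 5] by rewrite finset.setUC.
set L := [:: _; _; _].
have m0 : [set o 0; o 2] \in L by rewrite !inE eqxx.
have m1 : [set o 1; o 3] \in L by rewrite !inE eqxx orbT.
have m2 : [set o 4; o 5] \in L by rewrite !inE eqxx !orbT.
move=> a b; rewrite /form2 /vec /=.
case: (ord6P a) => -[] ->; case: (ord6P b) => -[] -> /= ab;
  try (by rewrite ?(s20, s31, s54) ?(m0, m1, m2) in ab);
  first [ by apply: O10; rewrite !inE !eqxx ?orbT | by apply: O01; rewrite !inE !eqxx ?orbT
        | assumption | by apply: N0 ].
Qed.

End Wedge42.

Local Open Scope classical_set_scope.
Local Open Scope ring_scope.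

(** * Partial derivatives of complex-valued functions *)

Section PartialDerivatives.
Local Open Scope complex_scope.
Context {R : realType} {m : nat}.
Local Notation C := (R[i]).
Local Notation rc := (real_complex R).
Implicit Types (f g : 'rV[R]_m -> C) (u : 'rV[R]_m) (l : 'I_m).

Definition cderivable l f u :=
  derivable (fun w => complex.Re (f w)) u (delta_mx 0 l) /\
  derivable (fun w => complex.Im (f w)) u (delta_mx 0 l).

Let derD (f g : 'rV[R]_m -> R) u v : derivable f u v -> derivable g u v ->
  derivable (fun w => f w + g w) u v /\
  'D_v (fun w => f w + g w) u = 'D_v f u + 'D_v g u.
Proof. by move=> df dg; split; [exact: (derivableD df dg)|exact: (deriveD df dg)]. Qed.

Let derB (f g : 'rV[R]_m -> R) u v : derivable f u v -> derivable g u v ->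
  derivable (fun w => f w - g w) u v /\
  'D_v (fun w => f w - g w) u = 'D_v f u - 'D_v g u.
Proof. by move=> df dg; split; [exact: (derivableB df dg)|exact: (deriveB df dg)]. Qed.

Let derM (f g : 'rV[R]_m -> R) u v : derivable f u v -> derivable g u v ->
  derivable (fun w => f w * g w) u v /\
  'D_v (fun w => f w * g w) u = 'D_v f u * g u + f u * 'D_v g u.
Proof.
move=> df dg; split; first exact: (derivableM df dg).
rewrite (deriveM df dg) addrC; congr (_ + _); rewrite mulrC //.
Qed.

Lemma cderivableD l f g u : cderivable l f u -> cderivable l g u ->
  cderivable l (fun w => f w + g w) u /\
  partial l (fun w => f w + g w) u = partial l f u + partial l g u.
Proof.
case=> fr fi [gr gi].
have er : (fun w => complex.Re (f w + g w)) = (fun w => complex.Re (f w) + complex.Re (g w)).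
  by apply/funext => w; case: (f w); case: (g w).
have ei : (fun w => complex.Im (f w + g w)) = (fun w => complex.Im (f w) + complex.Im (g w)).
  by apply/funext => w; case: (f w); case: (g w).
have [dr hr] := derD fr gr; have [di hi] := derD fi gi.
split; first by split; [rewrite er|rewrite ei].
by rewrite /partial er ei hr hi.
Qed.

Lemma cderivableM l f g u : cderivable l f u -> cderivable l g u ->
  cderivable l (fun w => f w * g w) u /\
  partial l (fun w => f w * g w) u = partial l f u * g u + f u * partial l g u.
Proof.
case=> fr fi [gr gi].
have er : (fun w => complex.Re (f w * g w)) =
   (fun w => complex.Re (f w) * complex.Re (g w) - complex.Im (f w) * complex.Im (g w)).
  by apply/funext => w; case: (f w); case: (g w).
have ei : (fun w => complex.Im (f w * g w)) =
   (fun w => complex.Re (f w) * complex.Im (g w) + complex.Im (f w) * complex.Re (g w)).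
  by apply/funext => w; case: (f w); case: (g w).
have [drr hrr] := derM fr gr; have [dii hii] := derM fi gi.
have [dri hri] := derM fr gi; have [dir hir] := derM fi gr.
have [dr hr] := derB drr dii; have [di hi] := derD dri dir.
split; first by split; [rewrite er|rewrite ei].
rewrite /partial er ei hr hi hrr hii hri hir.
move: ('D_ _ _ _) ('D_ _ _ _) ('D_ _ _ _) ('D_ _ _ _) => a b c d.
case: (f u) => f1 f2; case: (g u) => g1 g2 /=.
by apply/eqP; rewrite eq_complex /=; apply/andP; split; apply/eqP; ring.
Qed.

Lemma cderivable_cst l (a : C) u :
  cderivable l (fun=> a) u /\ partial l (fun=> a) u = 0.
Proof.
split; first by split; exact: derivable_cst.
by rewrite /partial !derive_cst.
Qed.

Lemma cderivable_real l (h : 'rV[R]_m -> R) u : derivable h u (delta_mx 0 l) ->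
  cderivable l (fun w => rc (h w)) u /\
  partial l (fun w => rc (h w)) u = rc ('D_(delta_mx 0 l) h u).
Proof.
move=> dh; split; first by split => //=; exact: derivable_cst.
by rewrite /partial /= derive_cst.
Qed.

Lemma cderivable_sum l n (f : 'I_n -> 'rV[R]_m -> C) u :
  (forall i, cderivable l (f i) u) ->
  cderivable l (fun w => \sum_i f i w) u /\
  partial l (fun w => \sum_i f i w) u = \sum_i partial l (f i) u.
Proof.
elim: n f => [|n IH] f df.
  have -> : (fun w => \sum_(i < 0) f i w) = (fun=> 0).
    by apply/funext => w; rewrite big_ord0.
  by rewrite big_ord0; exact: cderivable_cst.
have -> : (fun w => \sum_(i < n.+1) f i w) = (fun w => f ord0 w + \sum_(i < n) f (lift ord0 i) w).
  by apply/funext => w; rewrite big_ord_recl.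
have [d1 e1] := IH (fun i => f (lift ord0 i)) (fun i => df _).
have [d2 e2] := cderivableD (df ord0) d1.
by split; rewrite // e2 e1 big_ord_recl.
Qed.

Lemma partial_near l f g u : (\near u, f u = g u) -> partial l f u = partial l g u.
Proof.
move=> fg; rewrite /partial; congr (_ +i* _); apply: near_eq_derive;
by apply: filterS fg => w ->.
Qed.

Definition vderivable l n (X : 'rV[R]_m -> 'rV[C]_n) u :=
  forall j, cderivable l (fun w => X w 0 j) u.
Definition vpartial l n (X : 'rV[R]_m -> 'rV[C]_n) u : 'rV[C]_n :=
  \row_j partial l (fun w => X w 0 j) u.

Lemma linear_partial l n (A : 'rV[C]_n -> C) X u :
  (forall a x y, A (a *: x + y) = a * A x + A y) ->
  vderivable l X u -> cderivable l (fun w => A (X w)) u /\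
  partial l (fun w => A (X w)) u = A (vpartial l X u).
Proof.
move=> AL dX.
have A0 : A 0 = 0 by have := AL (-1) 0 0; rewrite scaler0 addr0 mulN1r addNr.
have AE x : A x = \sum_j x 0 j * A (delta_mx 0 j).
  rewrite {1}[x]row_sum_delta; elim/big_rec2: _ => [//|j a b _ <-].
  by rewrite AL.
have -> : (fun w => A (X w)) = (fun w => \sum_j X w 0 j * A (delta_mx 0 j)).
  by apply/funext => w; rewrite AE.
have dj j : cderivable l (fun w => X w 0 j * A (delta_mx 0 j)) u /\
   partial l (fun w => X w 0 j * A (delta_mx 0 j)) u =
   partial l (fun w => X w 0 j) u * A (delta_mx 0 j).
  have [dc ec] := cderivable_cst l (A (delta_mx 0 j)) u.
  have [d e] := cderivableM (dX j) dc.
  by split; rewrite // e ec mulr0 addr0.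
have [d e] := cderivable_sum (fun j => (dj j).1).
split=> //; rewrite e AE; apply: eq_bigr => j _.
by rewrite (dj j).2 mxE.
Qed.

Lemma bilinear_partial l n (A : 'rV[C]_n -> 'rV[C]_n -> C) X Y u :
  (forall a x y z, A (a *: x + y) z = a * A x z + A y z) ->
  (forall a x y z, A z (a *: x + y) = a * A z x + A z y) ->
  vderivable l X u -> vderivable l Y u ->
  cderivable l (fun w => A (X w) (Y w)) u /\
  partial l (fun w => A (X w) (Y w)) u
    = A (vpartial l X u) (Y u) + A (X u) (vpartial l Y u).
Proof.
move=> AL AR dX dY.
have AE x z : A x z = \sum_j x 0 j * A (delta_mx 0 j) z.
  rewrite {1}[x]row_sum_delta; elim/big_rec2: _ => [|j a b _ <-].
    by have := AL (-1) 0 0 z; rewrite scaler0 addr0 mulN1r addNr.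
  by rewrite AL.
have -> : (fun w => A (X w) (Y w)) = (fun w => \sum_j X w 0 j * A (delta_mx 0 j) (Y w)).
  by apply/funext => w; rewrite AE.
have dj j : cderivable l (fun w => X w 0 j * A (delta_mx 0 j) (Y w)) u /\
   partial l (fun w => X w 0 j * A (delta_mx 0 j) (Y w)) u =
   partial l (fun w => X w 0 j) u * A (delta_mx 0 j) (Y u)
   + X u 0 j * A (delta_mx 0 j) (vpartial l Y u).
  have [dc ec] := linear_partial (fun a x y => AR a x y (delta_mx 0 j)) dY.
  have [d e] := cderivableM (dX j) dc.
  by split; rewrite // e ec.
have [d e] := cderivable_sum (fun j => (dj j).1).
split=> //; rewrite e [A (vpartial _ _ _) _]AE [A (X u) (vpartial _ _ _)]AE -big_split.
apply: eq_bigr => j _.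
by rewrite (dj j).2 mxE.
Qed.

Lemma trilinear_partial l n (A : 'rV[C]_n -> 'rV[C]_n -> 'rV[C]_n -> C) X Y Z u :
  (forall a x x' y z, A (a *: x + x') y z = a * A x y z + A x' y z) ->
  (forall a x y y' z, A x (a *: y + y') z = a * A x y z + A x y' z) ->
  (forall a x y z z', A x y (a *: z + z') = a * A x y z + A x y z') ->
  vderivable l X u -> vderivable l Y u -> vderivable l Z u ->
  cderivable l (fun w => A (X w) (Y w) (Z w)) u /\
  partial l (fun w => A (X w) (Y w) (Z w)) u
    = A (vpartial l X u) (Y u) (Z u) + A (X u) (vpartial l Y u) (Z u)
      + A (X u) (Y u) (vpartial l Z u).
Proof.
move=> A1 A2 A3 dX dY dZ.
have AE x y z : A x y z = \sum_j x 0 j * A (delta_mx 0 j) y z.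
  rewrite {1}[x]row_sum_delta; elim/big_rec2: _ => [|j a b _ <-].
    by have := A1 (-1) 0 0 y z; rewrite scaler0 addr0 mulN1r addNr.
  by rewrite A1.
have -> : (fun w => A (X w) (Y w) (Z w)) =
    (fun w => \sum_j X w 0 j * A (delta_mx 0 j) (Y w) (Z w)).
  by apply/funext => w; rewrite AE.
have dj j : cderivable l (fun w => X w 0 j * A (delta_mx 0 j) (Y w) (Z w)) u /\
   partial l (fun w => X w 0 j * A (delta_mx 0 j) (Y w) (Z w)) u =
   partial l (fun w => X w 0 j) u * A (delta_mx 0 j) (Y u) (Z u)
   + X u 0 j * (A (delta_mx 0 j) (vpartial l Y u) (Z u)
                + A (delta_mx 0 j) (Y u) (vpartial l Z u)).
  have [dc ec] := bilinear_partial (A := A (delta_mx 0 j))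
    (fun a x y z => A2 a _ x y z) (fun a x y z => A3 a _ z x y) dY dZ.
  have [d e] := cderivableM (dX j) dc.
  by split; rewrite // e ec.
have [d e] := cderivable_sum (fun j => (dj j).1).
split=> //; rewrite e [A (vpartial _ _ _) _ _]AE [A (X u) (vpartial _ _ _) _]AE
  [A (X u) _ (vpartial _ _ _)]AE -!big_split.
apply: eq_bigr => j _ /=.
by rewrite (dj j).2 mxE; ring.
Qed.

End PartialDerivatives.

(** * Differential calculus *)

Section Calculus.
Context {R : realType}.

Lemma differentiable_epsP (V W : normedModType R) (f : V -> W) x :
  differentiable f x -> forall e, 0 < e ->
  \forall h \near 0, `|f (h + x) - (f x + 'd f x h)| <= e * `|h|.
Proof.
move=> /diff_locally /eqaddoP H e e0.
exact: (H e e0).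
Qed.

Lemma near_eq_differentiable (V W : normedModType R) (f g : V -> W) x :
  (\near x, f x = g x) -> differentiable f x -> differentiable g x.
Proof.
move=> fg df.
have E : g \o shift x = cst (g x) + 'd f x +o_ 0 id.
  apply/eqaddoP => e e0; have := differentiable_epsP df e0.
  have : \forall h \near 0, f (h + x) = g (h + x) by move: fg; rewrite (near_shift 0) subr0.
  apply: filterS2 => h fgh; rewrite fgh (nbhs_singleton fg); exact.
apply/diff_locallyP; rewrite (diff_unique (diff_continuous df) E); split => //.
exact: diff_continuous.
Qed.

Lemma derive_comp (U V W : normedModType R) (f : U -> V) (g : V -> W) x v :
  differentiable f x -> differentiable g (f x) ->
  'D_v (g \o f) x = 'D_('D_v f x) g (f x).
Proof.
move=> df dg.
by rewrite (deriveE _ (differentiable_comp df dg)) (diff_comp df dg) (deriveE _ df) (deriveE _ dg).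
Qed.

Lemma deriveDv (V W : normedModType R) (f : V -> W) x a b :
  differentiable f x -> 'D_(a + b) f x = 'D_a f x + 'D_b f x.
Proof. by move=> df; rewrite !(deriveE _ df) linearD. Qed.

Lemma deriveZv (V W : normedModType R) (f : V -> W) x k a :
  differentiable f x -> 'D_(k *: a) f x = k *: 'D_a f x.
Proof. by move=> df; rewrite !(deriveE _ df) linearZ. Qed.

Lemma derive_rV n (W : normedModType R) (f : 'rV[R]_n -> W) x a :
  differentiable f x -> 'D_a f x = \sum_l a 0 l *: 'D_(delta_mx 0 l) f x.
Proof.
move=> df; rewrite [in LHS](row_sum_delta a) (deriveE _ df) linear_sum.
by apply: eq_bigr => l _; rewrite linearZ (deriveE _ df).
Qed.

Lemma derive_line (V W : normedModType R) (f : V -> W) (a y : V) (s : R) :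
  derivable f (s *: a + y) a ->
  is_derive s 1 (fun s => f (s *: a + y)) ('D_a f (s *: a + y)).
Proof.
have E : (fun h => h^-1 *: (((fun s => f (s *: a + y)) \o shift s) (h *: 1) - f (s *: a + y)))
   = (fun h => h^-1 *: ((f \o shift (s *: a + y)) (h *: a) - f (s *: a + y))).
  by apply/funext => h /=; rewrite scalerDl -addrA [h *: 1]mulr1.
by move=> df; split; rewrite /derivable /derive E.
Qed.

(* By the mean value theorem applied to [phi], the second difference equals
   [t * psi c] for some [c] between 0 and [t]; the differentiability of ['D_a f]
   at [x] compares [psi c] with [t * 'D_b ('D_a f) x]. *)
Let second_difference (V : normedModType R) (f : V -> R) x a b e :
  (\near x, differentiable f x) -> differentiable ('D_a f) x -> 0 < e ->
  \forall t \near 0^'+, `|f (t *: a + t *: b + x) - f (t *: a + x) - f (t *: b + x) + f x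
      - t ^+ 2 * 'D_b ('D_a f) x| <= e * t ^+ 2.
Proof.
move=> df dDf e0.
pose M := 2 * `|a| + `|b| + 1.
have M0 : 0 < M.
  by rewrite ltr_wpDl// addr_ge0// mulr_ge0.
have eM : 0 < e / M by rewrite divr_gt0.
have := differentiable_epsP dDf eM.
have : \forall h \near 0, differentiable f (h + x) by move: df; rewrite (near_shift 0) subr0.
move=> /nbhs_norm0P[d1 /= d10 D1] /nbhs_norm0P[d2 /= d20 D2].
near=> t.
have t0 : 0 < t by near: t; exact: nbhs_right_gt.
have small s s' : 0 <= s <= t -> 0 <= s' <= t ->
   `|s *: a + s' *: b| < d1 /\ `|s *: a + s' *: b| < d2.
  move=> /andP[s0 st] /andP[s0' st'].
  have le : `|s *: a + s' *: b| <= t * M.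
    apply: (le_trans (ler_normD _ _)); rewrite !normrZ !ger0_norm// /M.
    have ha : s * `|a| <= t * `|a| by rewrite ler_wpM2r.
    have hb : s' * `|b| <= t * `|b| by rewrite ler_wpM2r.
    have h1 : 0 <= t * `|a| by rewrite mulr_ge0// ltW.
    rewrite !mulrDr mulr1; lra.
  split; apply: (le_lt_trans le); rewrite -ltr_pdivlMr//; near: t;
  by apply: nbhs_right_lt; rewrite divr_gt0.
pose phi s := f (s *: a + t *: b + x) - f (s *: a + x).
pose psi s := 'D_a f (s *: a + t *: b + x) - 'D_a f (s *: a + x).
have tt : 0 <= t <= t by rewrite ltW//=.
have z0 : (0 : R) <= (0 : R) <= t by rewrite lexx ltW.
have dphi s : 0 <= s <= t -> is_derive s 1 phi (psi s).
  move=> st; rewrite /phi /psi.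
  have [n1 _] := small s t st tt.
  have [n2 _] := small s 0 st z0.
  rewrite scale0r addr0 in n2.
  have d2s : is_derive s 1 (fun s => f (s *: a + x)) ('D_a f (s *: a + x)).
    by apply: derive_line; apply: diff_derivable; exact: D1.
  have d1s : is_derive s 1 (fun s => f (s *: a + (t *: b + x)))
      ('D_a f (s *: a + (t *: b + x))).
    by apply: derive_line; apply: diff_derivable; rewrite addrA; exact: D1.
  have -> : (fun s => f (s *: a + t *: b + x) - f (s *: a + x)) =
      (fun s => f (s *: a + (t *: b + x))) - (fun s => f (s *: a + x)).
    by apply/funext => s' /=; rewrite -addrA.
  by rewrite -addrA; exact: is_deriveB.
have [c cI] : exists2 c, c \in `[0, t] & phi t - phi 0 = psi c * (t - 0).
  apply: (MVT_segment (ltW t0)) => [s|].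
    by rewrite in_itv /= => /andP[/ltW s0 /ltW st]; apply: dphi; rewrite s0.
  apply: derivable_within_continuous => s; rewrite in_itv /= => st.
  by have [] := dphi s st.
rewrite in_itv /= in cI; rewrite subr0 => MV.
have [n1 m1] := small c t cI tt.
have [n2 m2] := small c 0 cI z0.
rewrite scale0r addr0 in n2 m2.
have B1 := D2 _ m1; have B2 := D2 _ m2.
rewrite /= in B1 B2.
have -> : f (t *: a + t *: b + x) - f (t *: a + x) - f (t *: b + x) + f x = t * psi c.
  rewrite mulrC -MV /phi !scale0r !add0r; ring.
rewrite (deriveE _ dDf).
have -> : t * psi c - t ^+ 2 * 'd ('D_a f) x b = t * (psi c - 'd ('D_a f) x (t *: b)).
  have -> : 'd ('D_a f) x (t *: b) = t * 'd ('D_a f) x b by rewrite linearZ.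
  by rewrite [RHS]mulrBr expr2 mulrA.
rewrite normrM (ger0_norm (ltW t0)) expr2 [leRHS]mulrCA (ler_pM2l t0).
have -> : psi c - 'd ('D_a f) x (t *: b) =
  ('D_a f (c *: a + t *: b + x) - ('D_a f x + 'd ('D_a f) x (c *: a + t *: b)))
  - ('D_a f (c *: a + x) - ('D_a f x + 'd ('D_a f) x (c *: a))).
  rewrite (linearD ('d ('D_a f) x)) /psi.
  move: ('d ('D_a f) x (c *: a)) ('d ('D_a f) x (t *: b)) => p q.
  move: ('D_a f (c *: a + t *: b + x)) ('D_a f (c *: a + x)) ('D_a f x) => p' q' r'.
  ring.
apply: (le_trans (ler_normB _ _)); apply: (le_trans (lerD B1 B2)).
rewrite -mulrDr -mulrA (ler_pM2l e0) ler_pdivrMl; last exact: M0.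
rewrite mulrC.
move: cI => /andP[c0 ct].
have h1 : `|c *: a + t *: b| <= c * `|a| + t * `|b|.
  by apply: (le_trans (ler_normD _ _)); rewrite !normrZ !ger0_norm// ltW.
have h2 : `|c *: a| = c * `|a| by rewrite normrZ ger0_norm.
rewrite h2 /M !mulrDr mulr1.
have ha : c * `|a| <= t * `|a| by rewrite ler_wpM2r.
lra.
Unshelve. all: by end_near.
Qed.

(** Young's form of the symmetry of second derivatives: the second difference
    is symmetric in [a] and [b], and both sides are its limit divided by the
    square of [t]. *)
Lemma derive_sym (V : normedModType R) (f : V -> R) x a b :
  (\near x, differentiable f x) -> differentiable ('D_a f) x -> differentiable ('D_b f) x ->
  'D_b ('D_a f) x = 'D_a ('D_b f) x.
Proof.
move=> df da db; apply/eqP; rewrite -subr_eq0 -normr_le0; apply/ler_addgt0Pl => e e0.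
rewrite addr0.
have e20 : 0 < e / 2 by rewrite divr_gt0.
have Ha := second_difference b df da e20.
have Hb := second_difference a df db e20.
have [t [[A B] t0]] := filter_ex (filterI (filterI Ha Hb) (nbhs_right_gt 0)).
rewrite /= in A B.
have t20 : 0 < t ^+ 2 by rewrite exprn_gt0.
rewrite -(ler_pM2l t20) -[X in X * `|_|](ger0_norm (ltW t20)) -normrM.
have -> : t ^+ 2 * ('D_b ('D_a f) x - 'D_a ('D_b f) x) =
   (f (t *: b + t *: a + x) - f (t *: b + x) - f (t *: a + x) + f x
      - t ^+ 2 * 'D_a ('D_b f) x) -
   (f (t *: a + t *: b + x) - f (t *: a + x) - f (t *: b + x) + f x
      - t ^+ 2 * 'D_b ('D_a f) x).
  rewrite [t *: b + t *: a]addrC.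
  move: ('D_b _ _) ('D_a _ _) (f (t *: a + t *: b + x)) (f (t *: b + x)) => *.
  ring.
apply: (le_trans (ler_normB _ _)); apply: (le_trans (lerD B A)).
by rewrite -mulrDl -splitr mulrC.
Qed.

Lemma differentiable_rV (V : normedModType R) n (f : V -> 'rV[R]_n) x :
  (forall j, differentiable (fun w => f w 0 j : R) x) -> differentiable f x.
Proof.
move=> df.
have -> : f = \sum_(j < n) (fun w => f w 0 j *: (delta_mx 0 j : 'rV[R]_n)).
  by apply/funext => w; rewrite fct_sumE [LHS]row_sum_delta.
by apply: differentiable_sum => j; apply: differentiableZl.
Qed.

Lemma differentiable_comp_coord (V : normedModType R) m n (f : V -> 'M[R]_(m, n)) x i j :
  differentiable f x -> differentiable (fun w => f w i j : R) x.
Proof.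
move=> df; have -> : (fun w => f w i j : R) = (fun M : 'M[R]_(m, n) => M i j : R) \o f by [].
by apply: differentiable_comp => //; exact: differentiable_coord.
Qed.

Lemma derive_coord (V : normedModType R) m n (f : V -> 'M[R]_(m, n)) x v i j :
  derivable f x v -> ('D_v f x) i j = 'D_v (fun w => f w i j) x.
Proof. by move=> df; rewrite derive_mx// mxE. Qed.

Lemma jacobian_comp m n p (f : 'rV[R]_m -> 'rV[R]_n) (g : 'rV[R]_n -> 'rV[R]_p) x :
  differentiable f x -> differentiable g (f x) ->
  'J (g \o f) x = 'J f x *m 'J g (f x).
Proof.
move=> df dg; apply/row_matrixP => i; rewrite !rowE mulmxA.
rewrite -(deriveEjacobian _ (differentiable_comp df dg)) (derive_comp _ df dg).
by rewrite (deriveEjacobian _ dg) (deriveEjacobian _ df).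
Qed.

Lemma jacobian_near m n (f g : 'rV[R]_m -> 'rV[R]_n) x :
  (\near x, f x = g x) -> differentiable f x -> 'J f x = 'J g x.
Proof.
move=> fg df; have dg := near_eq_differentiable fg df.
apply/row_matrixP => i; rewrite [LHS]rowE [RHS]rowE.
rewrite -[LHS](deriveEjacobian (delta_mx 0 i) df) -[RHS](deriveEjacobian (delta_mx 0 i) dg).
exact: near_eq_derive.
Qed.

Lemma jacobian_id m (x : 'rV[R]_m) : 'J id x = 1%:M.
Proof.
apply/row_matrixP => i; rewrite !rowE -deriveEjacobian//.
by rewrite derive_id mulmx1.
Qed.

Lemma jacobian_cst m n (a : 'rV[R]_n) (x : 'rV[R]_m) : 'J (cst a) x = 0.
Proof.
apply/row_matrixP => i; rewrite !rowE -deriveEjacobian//.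
by rewrite derive_cst mulmx0.
Qed.

(** Weaker than being of class C2, but stable under composition and sufficient
    for the symmetry of second derivatives. *)
Definition twice_differentiable (V W : normedModType R) (f : V -> W) x :=
  (\near x, differentiable f x) /\ forall v, differentiable ('D_v f) x.

Lemma derive_sym_rV (V : normedModType R) n (f : V -> 'rV[R]_n) x a b :
  twice_differentiable f x -> 'D_b ('D_a f) x = 'D_a ('D_b f) x.
Proof.
move=> [df dDf].
have E v : \near x, forall j, ('D_v f x) 0 j = 'D_v (fun w => f w 0 j : R) x.
  apply: filterS df => w dw j; rewrite derive_coord//; exact: diff_derivable.
have dj v j : differentiable ('D_v (fun w => f w 0 j : R)) x.
  apply: near_eq_differentiable (differentiable_comp_coord 0 j (dDf v)).
  by apply: filterS (E v) => w ->.
have Ej v w j : ('D_w ('D_v f) x) 0 j = 'D_w ('D_v (fun w => f w 0 j : R)) x.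
  rewrite derive_coord; last exact: diff_derivable.
  by apply: near_eq_derive; apply: filterS (E v) => y ->.
apply/rowP => j; rewrite [LHS]Ej [RHS]Ej; apply: derive_sym; [|exact: dj|exact: dj].
by apply: filterS df => w; exact: differentiable_comp_coord.
Qed.

End Calculus.

Section Calculus2.
Context {R : realType}.

Lemma differentiable_cvg (V W : normedModType R) (f : V -> W) x (P : W -> Prop) :
  differentiable f x -> (\forall y \near f x, P y) -> \forall w \near x, P (f w).
Proof. by move=> /differentiable_continuous fc; exact: fc. Qed.

Lemma twice_differentiable_comp m n p (f : 'rV[R]_m -> 'rV[R]_n) (g : 'rV[R]_n -> 'rV[R]_p) x :
  twice_differentiable f x -> twice_differentiable g (f x) -> twice_differentiable (g \o f) x.
Proof.
move=> [df ddf] [dg ddg].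
have dfx : differentiable f x := nbhs_singleton df.
have nd : \near x, differentiable f x /\ differentiable g (f x).
  exact: (filterI df (differentiable_cvg dfx dg)).
split; first by apply: filterS nd => w [dfw dgw]; exact: differentiable_comp.
move=> v.
pose h w : 'rV[R]_p := \sum_l ('D_v f w) 0 l *: 'D_(delta_mx 0 l) g (f w).
apply: (near_eq_differentiable (f := h)).
  apply: filterS nd => w [dfw dgw]; rewrite /h.
  by rewrite (derive_comp _ dfw dgw) (derive_rV _ dgw).
apply: differentiable_rV => j.
have -> : (fun w => h w 0 j : R) =
    \sum_l (fun w => ('D_v f w) 0 l * ('D_(delta_mx 0 l) g (f w)) 0 j).
  by apply/funext => w; rewrite fct_sumE /h summxE; apply: eq_bigr => l _; rewrite mxE.
apply: differentiable_sum => l.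
apply: (@differentiableM _ _ (fun w => ('D_v f w) 0 l) (fun w => ('D_(delta_mx 0 l) g (f w)) 0 j)).
  exact: differentiable_comp_coord.
have := differentiable_comp dfx (ddg (delta_mx 0 l)).
exact: differentiable_comp_coord.
Qed.

Let pair2 m n (a : 'rV[R]_m) (w v : 'rV[R]_n) :
  differentiable (fun w : 'rV[R]_n => (a, w)) w /\ 'D_v (fun w : 'rV[R]_n => (a, w)) w = (0, v).
Proof.
have d : differentiable (fun w : 'rV[R]_n => (a, w)) w.
  by apply: differentiable_pair; [exact: differentiable_cst|].
split=> //; rewrite (deriveE _ d).
have dc : differentiable (fun _ : 'rV[R]_n => a) w by exact: differentiable_cst.
have di : differentiable (fun w : 'rV[R]_n => w) w by [].
rewrite (diff_pair dc di).
have -> : 'd (fun _ : 'rV[R]_n => a) w v = 0 by rewrite -(deriveE _ dc) derive_cst.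
by have -> : 'd (fun w : 'rV[R]_n => w) w v = v by rewrite -(deriveE _ di) derive_id.
Qed.

Let pair1 m n (a : 'rV[R]_m) (w v : 'rV[R]_n) :
  differentiable (fun w : 'rV[R]_n => (w, a)) w /\ 'D_v (fun w : 'rV[R]_n => (w, a)) w = (v, 0).
Proof.
have d : differentiable (fun w : 'rV[R]_n => (w, a)) w.
  by apply: differentiable_pair; [|exact: differentiable_cst].
split=> //; rewrite (deriveE _ d).
have dc : differentiable (fun _ : 'rV[R]_n => a) w by exact: differentiable_cst.
have di : differentiable (fun w : 'rV[R]_n => w) w by [].
rewrite (diff_pair di dc).
have -> : 'd (fun _ : 'rV[R]_n => a) w v = 0 by rewrite -(deriveE _ dc) derive_cst.
by have -> : 'd (fun w : 'rV[R]_n => w) w v = v by rewrite -(deriveE _ di) derive_id.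
Qed.

Lemma derive_partial2 m n (W : normedModType R) (f : 'rV[R]_m * 'rV[R]_n -> W) a w v :
  differentiable f (a, w) ->
  differentiable (fun w => f (a, w)) w /\ 'D_v (fun w => f (a, w)) w = 'D_(0, v) f (a, w).
Proof.
move=> df; have [dp ep] := pair2 a w v; split.
  exact: (differentiable_comp dp df).
by rewrite -ep; exact: (derive_comp v dp df).
Qed.

Lemma derive_partial1 m n (W : normedModType R) (f : 'rV[R]_n * 'rV[R]_m -> W) a w v :
  differentiable f (w, a) ->
  differentiable (fun w => f (w, a)) w /\ 'D_v (fun w => f (w, a)) w = 'D_(v, 0) f (w, a).
Proof.
move=> df; have [dp ep] := pair1 a w v; split.
  exact: (differentiable_comp dp df).
by rewrite -ep; exact: (derive_comp v dp df).
Qed.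

Lemma near_partial2 m n (a : 'rV[R]_m) (w : 'rV[R]_n) (P : 'rV[R]_m * 'rV[R]_n -> Prop) :
  (\forall q \near (a, w), P q) -> \forall w' \near w, P (a, w').
Proof. by move=> h; exact: (differentiable_cvg (pair2 a w 0).1 h). Qed.

Lemma near_partial1 m n (a : 'rV[R]_m) (w : 'rV[R]_n) (P : 'rV[R]_n * 'rV[R]_m -> Prop) :
  (\forall q \near (w, a), P q) -> \forall w' \near w, P (w', a).
Proof. by move=> h; exact: (differentiable_cvg (pair1 a w 0).1 h). Qed.

Lemma twice_partial2 m n (W : normedModType R) (f : 'rV[R]_m * 'rV[R]_n -> W) a w :
  twice_differentiable f (a, w) -> twice_differentiable (fun w => f (a, w)) w.
Proof.
move=> [df ddf]; have nd := near_partial2 df; split.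
  by apply: filterS nd => w' /(derive_partial2 0)[].
move=> v; apply: (near_eq_differentiable (f := fun w => 'D_(0, v) f (a, w))).
  by apply: filterS nd => w' /(derive_partial2 v)[_ ->].
by have [] := derive_partial2 0 (ddf (0, v)).
Qed.

Lemma twice_partial1 m n (W : normedModType R) (f : 'rV[R]_n * 'rV[R]_m -> W) a w :
  twice_differentiable f (w, a) -> twice_differentiable (fun w => f (w, a)) w.
Proof.
move=> [df ddf]; have nd := near_partial1 df; split.
  by apply: filterS nd => w' /(derive_partial1 0)[].
move=> v; apply: (near_eq_differentiable (f := fun w => 'D_(v, 0) f (w, a))).
  by apply: filterS nd => w' /(derive_partial1 v)[_ ->].
by have [] := derive_partial1 0 (ddf (v, 0)).
Qed.

Lemma derive_mulmx (V : normedModType R) m n p (A : V -> 'M[R]_(m, n)) (B : V -> 'M[R]_(n, p)) x v :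
  derivable A x v -> derivable B x v ->
  derivable (fun w => A w *m B w) x v /\
  'D_v (fun w => A w *m B w) x = 'D_v A x *m B x + A x *m 'D_v B x.
Proof.
move=> dA dB.
have dAi i k : derivable (fun w => A w i k : R) x v by move/derivable_mxP: dA; exact.
have dBi k j : derivable (fun w => B w k j : R) x v by move/derivable_mxP: dB; exact.
pose h i j k (w : V) : R := A w i k * B w k j.
have E i j : (fun w => (A w *m B w) i j) = \sum_k h i j k.
  by apply/funext => w; rewrite mxE fct_sumE.
have dh i j k : derivable (h i j k) x v by exact: (derivableM (dAi i k) (dBi k j)).
have dAB : derivable (fun w => A w *m B w) x v.
  apply/derivable_mxP => i j; rewrite E; exact: derivable_sum.
split=> //; apply/matrixP => i j.
rewrite (derive_coord _ _ dAB) E derive_sum// !mxE -big_split.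
apply: eq_bigr => k _ /=.
rewrite (derive_coord _ _ dA) (derive_coord _ _ dB).
rewrite /h (deriveM (dAi i k) (dBi k j)) addrC; congr (_ + _).
by rewrite mulrC.
Qed.

Lemma differentiable_mx (V : normedModType R) m n (f : V -> 'M[R]_(m, n)) x :
  (forall i j, differentiable (fun w => f w i j : R) x) -> differentiable f x.
Proof.
move=> df.
have -> : f = \sum_(i < m) \sum_(j < n) (fun w => f w i j *: (delta_mx i j : 'M[R]_(m, n))).
  apply/funext => w; rewrite fct_sumE [LHS]matrix_sum_delta; apply: eq_bigr => i _.
  by rewrite fct_sumE.
by apply: differentiable_sum => i; apply: differentiable_sum => j; apply: differentiableZl.
Qed.

Lemma differentiable_mulmx (V : normedModType R) m n p (A : V -> 'M[R]_(m, n))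
    (B : V -> 'M[R]_(n, p)) x :
  differentiable A x -> differentiable B x -> differentiable (fun w => A w *m B w) x.
Proof.
move=> dA dB; apply: differentiable_mx => i j.
have -> : (fun w => (A w *m B w) i j : R) = \sum_k (fun w => A w i k * B w k j).
  by apply/funext => w; rewrite mxE fct_sumE.
apply: differentiable_sum => k.
apply: (@differentiableM _ _ (fun w => A w i k) (fun w => B w k j));
exact: differentiable_comp_coord.
Qed.

Definition mixed_derivative m n p (f : 'rV[R]_m * 'rV[R]_n -> 'rV[R]_p) q a b : 'rV[R]_p :=
  'D_(a, 0) ('D_(0, b) f) q.

Lemma mixed_derivative1 m n p (f : 'rV[R]_m * 'rV[R]_n -> 'rV[R]_p) x y a b :
  twice_differentiable f (x, y) ->
  differentiable (fun w => 'D_(0, b) f (w, y)) x /\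
  'D_a (fun w => 'D_(0, b) f (w, y)) x = mixed_derivative f (x, y) a b.
Proof. by move=> [_ ddf]; exact: (derive_partial1 a (ddf (0, b))). Qed.

Lemma mixed_derivative2 m n p (f : 'rV[R]_m * 'rV[R]_n -> 'rV[R]_p) x y a b :
  twice_differentiable f (x, y) ->
  differentiable (fun w => 'D_(a, 0) f (x, w)) y /\
  'D_b (fun w => 'D_(a, 0) f (x, w)) y = mixed_derivative f (x, y) a b.
Proof.
move=> df; have [d E] := derive_partial2 b (df.2 (a, 0)).
split; first exact: d.
have S := @derive_sym_rV R _ p f (x, y) (a, 0) (0, b) df.
have H : ('D_b (fun w => 'D_(a, 0) f (x, w)) y) = 'D_(0, b) ('D_(a, 0) f) (x, y) by exact: E.
apply: (etrans H).
apply: (etrans S).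
reflexivity.
Qed.

Let near_eq_diff_derive (V W : normedModType R) (f g : V -> W) x a c :
  (\near x, f x = g x) -> differentiable f x /\ 'D_a f x = c ->
  differentiable g x /\ 'D_a g x = c.
Proof.
move=> fg [df <-]; split; first exact: near_eq_differentiable fg df.
exact/esym/near_eq_derive.
Qed.

Lemma differentiable_rows (V : normedModType R) p q (F : V -> 'M[R]_(p, q)) x :
  (forall b, differentiable (fun w => b *m F w : 'rV[R]_q) x) -> differentiable F x.
Proof.
move=> dF; apply: differentiable_mx => i j.
have := differentiable_comp_coord 0 j (dF (delta_mx 0 i)).
by under eq_fun do rewrite -rowE mxE.
Qed.

Lemma derive_mulmxl (V : normedModType R) n p q (b : 'M[R]_(n, p)) (F : V -> 'M[R]_(p, q)) x v :
  derivable F x v -> 'D_v (fun w => b *m F w) x = b *m 'D_v F x.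
Proof.
move=> dF; have dc : derivable (fun _ : V => b) x v by exact: derivable_cst.
by have [_ ->] := derive_mulmx dc dF; rewrite derive_cst mul0mx add0r.
Qed.

Definition jacobian2 m n p (f : 'rV[R]_m * 'rV[R]_n -> 'rV[R]_p) (y : 'rV[R]_n) w :=
  'J (fun w' => f (w, w')) y.
Definition jacobian1 m n p (f : 'rV[R]_m * 'rV[R]_n -> 'rV[R]_p) (x : 'rV[R]_m) w :=
  'J (fun w' => f (w', w)) x.

Lemma near_jacobian2 m n p (f : 'rV[R]_m * 'rV[R]_n -> 'rV[R]_p) x y :
  twice_differentiable f (x, y) ->
  \forall w \near x, differentiable (fun w' => f (w, w')) y /\
    forall b, b *m jacobian2 f y w = 'D_(0, b) f (w, y).
Proof.
move=> [df _]; have nd := near_partial1 df; apply: filterS nd => w dw.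
split=> [|b]; first by have [] := derive_partial2 0 dw.
by have [d <-] := derive_partial2 b dw; rewrite (deriveEjacobian b d).
Qed.

Lemma near_jacobian1 m n p (f : 'rV[R]_m * 'rV[R]_n -> 'rV[R]_p) x y :
  twice_differentiable f (x, y) ->
  \forall w \near y, differentiable (fun w' => f (w', w)) x /\
    forall b, b *m jacobian1 f x w = 'D_(b, 0) f (x, w).
Proof.
move=> [df _]; have nd := near_partial2 df; apply: filterS nd => w dw.
split=> [|b]; first by have [] := derive_partial1 0 dw.
by have [d <-] := derive_partial1 b dw; rewrite (deriveEjacobian b d).
Qed.

Lemma derive_jacobian2 m n p (f : 'rV[R]_m * 'rV[R]_n -> 'rV[R]_p) x y :
  twice_differentiable f (x, y) -> differentiable (jacobian2 f y) x /\
  forall a b, b *m 'D_a (jacobian2 f y) x = mixed_derivative f (x, y) a b.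
Proof.
move=> df.
have D a b : differentiable (fun w => b *m jacobian2 f y w) x /\
    'D_a (fun w => b *m jacobian2 f y w) x = mixed_derivative f (x, y) a b.
  apply: near_eq_diff_derive (mixed_derivative1 a b df).
  by apply: filterS (near_jacobian2 df) => w [_ ->].
have d : differentiable (jacobian2 f y) x.
  by apply: differentiable_rows => b; have [] := D 0 b.
split=> // a b; rewrite -(D a b).2 derive_mulmxl//.
exact: diff_derivable.
Qed.

Lemma derive_jacobian1 m n p (f : 'rV[R]_m * 'rV[R]_n -> 'rV[R]_p) x y :
  twice_differentiable f (x, y) -> differentiable (jacobian1 f x) y /\
  forall a b, b *m 'D_a (jacobian1 f x) y = mixed_derivative f (x, y) b a.
Proof.
move=> df.
have D a b : differentiable (fun w => b *m jacobian1 f x w) y /\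
    'D_a (fun w => b *m jacobian1 f x w) y = mixed_derivative f (x, y) b a.
  apply: near_eq_diff_derive (mixed_derivative2 b a df).
  by apply: filterS (near_jacobian1 df) => w [_ ->].
have d : differentiable (jacobian1 f x) y.
  by apply: differentiable_rows => b; have [] := D 0 b.
split=> // a b; rewrite -(D a b).2 derive_mulmxl//.
exact: diff_derivable.
Qed.

Lemma derive_mulmx_at1 (V : normedModType R) n (A B C : V -> 'M[R]_n) x v :
  differentiable A x -> differentiable B x -> A x = 1%:M -> B x = 1%:M ->
  (\near x, A x *m B x = C x) -> 'D_v A x = 'D_v C x - 'D_v B x.
Proof.
move=> dA dB A1 B1 AB; rewrite -(near_eq_derive v AB).
have [_ ->] := derive_mulmx (diff_derivable (v := v) dA) (diff_derivable (v := v) dB).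
by rewrite A1 B1 mulmx1 mul1mx addrK.
Qed.

Lemma derive_mulmxr (V : normedModType R) n p q (F : V -> 'M[R]_(p, q)) (b : 'M[R]_(q, n)) x v :
  derivable F x v -> 'D_v (fun w => F w *m b) x = 'D_v F x *m b.
Proof.
move=> dF; have dc : derivable (fun _ : V => b) x v by exact: derivable_cst.
by have [_ ->] := derive_mulmx dF dc; rewrite derive_cst mulmx0 addr0.
Qed.

(** The equation is differentiated at a fixed point of [k]. *)
Lemma derive_intertwine (V : normedModType R) n (A : V -> 'M[R]_n) (k : V -> V) M x v :
  differentiable A x -> differentiable k x -> k x = x ->
  (\near x, M *m A (k x) = A x *m M) -> M *m 'D_('D_v k x) A x = 'D_v A x *m M.
Proof.
move=> dA dk kx kA; have dA' : differentiable A (k x) by rewrite kx.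
have dAk := differentiable_comp dk dA'.
have /esym E1 : 'D_v (fun w => M *m A (k w)) x = M *m 'D_('D_v k x) A x.
  by rewrite (derive_mulmxl _ (diff_derivable (v := v) dAk)) (derive_comp v dk dA') kx.
apply: etrans E1 _; rewrite (near_eq_derive v kA).
exact: derive_mulmxr (diff_derivable (v := v) dA).
Qed.

Lemma derive_mulmx_lin m n (A : 'rV[R]_m -> 'M[R]_n) (T : 'rV[R]_n -> 'M[R]_n) x a b :
  (forall k c d, T (k *: c + d) = k *: T c + T d) -> differentiable A x -> A x = 1%:M ->
  'D_a (fun w => A w *m T (b *m A w)) x = 'D_a A x *m T b + T (b *m 'D_a A x).
Proof.
move=> TL dA A1.
have TE c : T c = \sum_j c 0 j *: T (delta_mx 0 j).
  have T0 : T 0 = 0 by have := TL (-1) 0 0; rewrite scaler0 addr0 scaleN1r addNr.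
  rewrite [in LHS](row_sum_delta c); elim/big_rec2: _ => [//|j p q _ <-]; exact: TL.
have dbA : differentiable (fun w => b *m A w) x.
  by apply: differentiable_mulmx => //; exact: differentiable_cst.
have dT c : differentiable T c.
  have -> : T = \sum_(j < n) (fun c : 'rV[R]_n => c 0 j *: T (delta_mx 0 j)).
    by apply/funext => d; rewrite fct_sumE.
  apply: differentiable_sum => j; apply: differentiableZl.
  exact: (@differentiable_coord).
have dTA := differentiable_comp dbA (dT _).
have [_ ->] := derive_mulmx (diff_derivable (v := a) dA) (diff_derivable (v := a) dTA).
rewrite (derive_comp a dbA (dT _)) (derive_mulmxl b (diff_derivable (v := a) dA)).
rewrite A1 mulmx1 mul1mx; congr (_ + _); first by rewrite /= A1 mulmx1.
have dx c y : 'D_c T y = T c.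
  rewrite /derive; apply: cvg_lim => //.
  apply: cvg_near_cst; near=> h.
  rewrite /= TL addrK scalerA mulVf ?scale1r//.
  by near: h; exact: nbhs_dnbhs_neq.
exact: dx.
Unshelve. all: by end_near.
Qed.

Lemma jacobian_pair_comp m n p q (f : 'rV[R]_m * 'rV[R]_n -> 'rV[R]_p)
    (g : 'rV[R]_q -> 'rV[R]_m) (h : 'rV[R]_q -> 'rV[R]_n) x :
  differentiable g x -> differentiable h x -> differentiable f (g x, h x) ->
  differentiable (fun w => f (g w, h w)) x /\
  'J (fun w => f (g w, h w)) x = 'J g x *m jacobian1 f (g x) (h x)
    + 'J h x *m jacobian2 f (h x) (g x).
Proof.
move=> dg dh df.
have dp : differentiable (fun w => (g w, h w)) x by exact: differentiable_pair.
have dc := differentiable_comp dp df.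
split; first exact: dc.
apply/row_matrixP => i; rewrite [LHS]rowE -(deriveEjacobian (delta_mx 0 i) dc).
rewrite [RHS]rowE mulmxDr !mulmxA.
rewrite -(deriveEjacobian (delta_mx 0 i) dg) -(deriveEjacobian (delta_mx 0 i) dh).
have [d1 E1] := derive_partial1 ('D_(delta_mx 0 i) g x) df.
have [d2 E2] := derive_partial2 ('D_(delta_mx 0 i) h x) df.
rewrite -(deriveEjacobian _ d1) -(deriveEjacobian _ d2) E1 E2.
have Ec := derive_comp (delta_mx 0 i) dp df.
set a := 'D__ g x; set b := 'D__ h x.
have Ep : 'D_(delta_mx 0 i) (fun w => (g w, h w)) x = (a, 0) + (0, b).
  rewrite (deriveE _ dp) (diff_pair dg dh) /a /b (deriveE _ dg) (deriveE _ dh).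
  by congr (_, _); rewrite /= ?addr0 ?add0r.
have Es := @deriveDv R _ _ f (g x, h x) (a, 0) (0, b) df.
exact: etrans Ec (etrans (congr1 (fun d => 'D_d f (g x, h x)) Ep) Es).
Qed.

Lemma derive_sandwich (V : normedModType R) n (A : V -> 'M[R]_n) (P Q : 'M[R]_n) x a :
  differentiable A x -> (forall w, P *m A w *m Q = P *m Q) -> P *m 'D_a A x *m Q = 0.
Proof.
move=> dA AE; have dPA : derivable (fun w => P *m A w) x a.
  have dc : derivable (fun _ : V => P) x a by exact: derivable_cst.
  by have [] := derive_mulmx dc (diff_derivable (v := a) dA).
rewrite -(derive_mulmxl P (diff_derivable (v := a) dA)) -(derive_mulmxr Q dPA).
by under eq_fun do rewrite AE; exact: derive_cst.
Qed.

End Calculus2.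

(** * Matrix inversion and differentiability *)

(** [P] stands for a notion of differentiability at a point. *)
Section FunctionAlgebra.
Variables (V : Type) (R : comNzRingType) (P : (V -> R) -> Prop).
Hypothesis Pcst : forall a, P (fun=> a).
Hypothesis PD : forall f g, P f -> P g -> P (fun w => f w + g w).
Hypothesis PM : forall f g, P f -> P g -> P (fun w => f w * g w).

Lemma closed_sum (I : Type) (r : seq I) (f : I -> V -> R) :
  (forall i, P (f i)) -> P (fun w => \sum_(i <- r) f i w).
Proof.
move=> Pf; elim: r => [|i r IH].
  by under eq_fun do rewrite big_nil; exact: Pcst.
by under eq_fun do rewrite big_cons; exact: PD.
Qed.

Lemma closed_prod (I : Type) (r : seq I) (f : I -> V -> R) :
  (forall i, P (f i)) -> P (fun w => \prod_(i <- r) f i w).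
Proof.
move=> Pf; elim: r => [|i r IH].
  by under eq_fun do rewrite big_nil; exact: Pcst.
by under eq_fun do rewrite big_cons; exact: PM.
Qed.

Lemma closed_det n (F : V -> 'M[R]_n) :
  (forall i j, P (fun w => F w i j)) -> P (fun w => \det (F w)).
Proof.
move=> PF; rewrite /determinant; apply: closed_sum => s.
by apply: PM; [exact: Pcst | apply: closed_prod => i].
Qed.

Lemma closed_adj n (F : V -> 'M[R]_n) i j :
  (forall i j, P (fun w => F w i j)) -> P (fun w => \adj (F w) i j).
Proof.
move=> PF; under eq_fun do rewrite mxE.
apply: PM; first exact: Pcst.
apply: closed_det => a b; under eq_fun do rewrite !mxE.
exact: PF.
Qed.

End FunctionAlgebra.

Lemma invmx_entry (R : comUnitRingType) n (A : 'M[R]_n) i j : A \in unitmx ->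
  invmx A i j = (\det A)^-1 * \adj A i j.
Proof. by move=> uA; rewrite /invmx uA mxE. Qed.

Section DifferentiableInverse.
Context {R : realType} {V : normedModType R}.
Variables (n : nat) (F : V -> 'M[R]_n) (u : V).
Hypothesis dF : differentiable F u.
Hypothesis uF : F u \in unitmx.

Let dcst (a : R) : differentiable (fun=> a : R) u. Proof. exact: differentiable_cst. Qed.
Let dD (f g : V -> R) :
  differentiable f u -> differentiable g u -> differentiable (fun w => f w + g w) u.
Proof. by move=> df dg; exact: (differentiableD df dg). Qed.
Let dM (f g : V -> R) :
  differentiable f u -> differentiable g u -> differentiable (fun w => f w * g w) u.
Proof. by move=> df dg; exact: (differentiableM df dg). Qed.
Let P (f : V -> R) := differentiable f u.
Let dFi i j : differentiable (fun w => F w i j : R) u.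
Proof. exact: differentiable_comp_coord. Qed.
Let ddet : differentiable (fun w => \det (F w)) u.
Proof. exact: (@closed_det _ _ P dcst dD dM n F dFi). Qed.
Let detF : \det (F u) != 0. Proof. by rewrite -unitfE -unitmxE. Qed.

Lemma near_unitmx : \forall w \near u, F w \in unitmx.
Proof.
have n0 : \forall y \near (\det (F u)), y != 0.
  by have := open_nbhs_nbhs (conj (open_neq (y := 0 : R)) detF); exact.
have nw := differentiable_cvg ddet n0; apply: filterS nw => w.
by rewrite unitmxE unitfE.
Qed.

Lemma differentiable_invmx : differentiable (fun w => invmx (F w)) u.
Proof.
apply: differentiable_mx => i j.
apply: (near_eq_differentiable (f := fun w => (\det (F w))^-1 * \adj (F w) i j)).
  by apply: filterS near_unitmx => w uw; rewrite invmx_entry.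
have dadj := @closed_adj _ _ P dcst dD dM n F i j dFi.
apply: dM dadj; apply: (@differentiable_comp _ _ _ _ (fun w => \det (F w)) (fun y : R => y^-1)) => //.
by apply/derivable1_diffP; apply: derivableV => //; exact: derivable_id.
Qed.

End DifferentiableInverse.

(** * Forms with constant coefficients in a frame *)

(** The rows of [F u] form a frame, whose brackets have the constant
    coefficients [c i j] in this frame. *)
Section DerivativeConstantForms.
Local Open Scope complex_scope.
Context {R : realType} {m : nat}.
Local Notation C := (R[i]).
Local Notation rc := (real_complex R).
Variables (U : set 'rV[R]_m) (F : 'rV[R]_m -> 'M[R]_m) (c : 'I_m -> 'I_m -> 'rV[R]_m).
Hypothesis oU : open U.
Hypothesis uF : forall u, U u -> F u \in unitmx.
Hypothesis dF : forall u, U u -> differentiable F u.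

Definition dframe l u : 'M[R]_m := 'D_(delta_mx 0 l) F u.

Hypothesis structF : forall u i j, U u ->
  \sum_l F u i l *: row j (dframe l u) - \sum_l F u j l *: row i (dframe l u) = c i j *m F u.

Definition cbr (a b : 'rV[C]_m) : 'rV[C]_m :=
  \sum_i \sum_j (a 0 i * b 0 j) *: map_mx rc (c i j).

Definition coframe u : 'M[C]_m := map_mx rc (invmx (F u)).
Definition invariant_form k (A : ('I_k -> 'rV[C]_m) -> C) : @Defs.form R m k :=
  fun u v => A (fun i => v i *m coframe u).

Let nearU u : U u -> \near u, U u.
Proof. by move=> Uu; exact: open_nbhs_nbhs. Qed.

Let frameK u : U u -> map_mx rc (F u) *m coframe u = 1%:M.
Proof. by move=> Uu; rewrite -map_mxM mulmxV ?map_mx1//; exact: uF. Qed.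
Let coframeK u : U u -> coframe u *m map_mx rc (F u) = 1%:M.
Proof. by move=> Uu; rewrite -map_mxM mulVmx ?map_mx1//; exact: uF. Qed.

Let dI u : U u -> differentiable (fun w => invmx (F w)) u.
Proof. by move=> Uu; apply: differentiable_invmx; [exact: dF | exact: uF]. Qed.

Lemma derive_invmx_frame u l : U u ->
  'D_(delta_mx 0 l) (fun w => invmx (F w)) u = - (invmx (F u) *m dframe l u *m invmx (F u)).
Proof.
move=> Uu; set v := delta_mx 0 l.
have [_ E] := derive_mulmx (diff_derivable (v := v) (dI Uu)) (diff_derivable (v := v) (dF Uu)).
have near1 : \near u, invmx (F u) *m F u = cst 1%:M u.
  by apply: filterS (nearU Uu) => w Uw; rewrite mulVmx ?uF.
have /eqP := etrans (esym E) (etrans (near_eq_derive v near1) (derive_cst _ _ _)).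
rewrite /dframe -/v; move: ('D_v (fun w => invmx (F w)) u) ('D_v F u) => D D' {E}.
rewrite addr_eq0 => /eqP E.
by rewrite -[LHS](mulmxK (uF Uu)) E mulNmx.
Qed.

(** In the frame, the flat connection for which the coordinate fields are
    parallel. *)
Definition cconn u (a b : 'rV[C]_m) : 'rV[C]_m :=
  \sum_l (a *m map_mx rc (F u)) 0 l *: (b *m map_mx rc (dframe l u) *m coframe u).

(** The connection is torsion free, so that the bracket of two fields is the
    difference of their covariant derivatives. *)
Lemma cconn_torsion u a b : U u -> cconn u a b - cconn u b a = cbr a b.
Proof.
move=> Uu.
have E (x y : 'rV[C]_m) : cconn u x y = \sum_i \sum_j (x 0 i * y 0 j) *:
    (map_mx rc (\sum_l F u i l *: row j (dframe l u)) *m coframe u).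
  rewrite /cconn (eq_bigr (fun l => \sum_i \sum_j (x 0 i * y 0 j) *: (rc (F u i l) *:
      (map_mx rc (row j (dframe l u)) *m coframe u)))); last first.
    move=> l _; rewrite mxE scaler_suml; apply: eq_bigr => i _.
    rewrite [in LHS](row_sum_delta y) !mulmx_suml scaler_sumr; apply: eq_bigr => j _.
    rewrite -!scalemxAl !scalerA mxE map_row -rowE; congr (_ *: _); ring.
  rewrite exchange_big; apply: eq_bigr => i _ /=.
  rewrite exchange_big; apply: eq_bigr => j _ /=.
  rewrite -scaler_sumr; congr (_ *: _).
  rewrite raddf_sum /= mulmx_suml; apply: eq_bigr => l _.
  by rewrite map_mxZ -scalemxAl.
rewrite !E [in X in _ - X]exchange_big /= -sumrB /cbr; apply: eq_bigr => i _.
rewrite -sumrB; apply: eq_bigr => j _.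
rewrite [b 0 j * _]mulrC -scalerBr; congr (_ *: _).
by rewrite -mulmxBl -map_mxB structF// map_mxM -mulmxA frameK// mulmx1.
Qed.

Lemma vderivable_coframe u l (x : 'rV[C]_m) : U u ->
  vderivable l (fun w => x *m coframe w) u /\
  vpartial l (fun w => x *m coframe w) u =
    - (x *m coframe u *m map_mx rc (dframe l u) *m coframe u).
Proof.
move=> Uu.
have dIv : derivable (fun w => invmx (F w)) u (delta_mx 0 l) := diff_derivable (dI Uu).
have dIj i j : derivable (fun w => invmx (F w) i j) u (delta_mx 0 l).
  by move/derivable_mxP: dIv; exact.
have st j : cderivable l (fun w => (x *m coframe w) 0 j) u /\
   partial l (fun w => (x *m coframe w) 0 j) u =
   \sum_k x 0 k * rc ('D_(delta_mx 0 l) (fun w => invmx (F w) k j) u).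
  have -> : (fun w => (x *m coframe w) 0 j) = (fun w => \sum_k x 0 k * rc (invmx (F w) k j)).
    by apply/funext => w; rewrite mxE; apply: eq_bigr => k _; rewrite mxE.
  have d k : cderivable l (fun w => x 0 k * rc (invmx (F w) k j)) u /\
      partial l (fun w => x 0 k * rc (invmx (F w) k j)) u =
      x 0 k * rc ('D_(delta_mx 0 l) (fun w => invmx (F w) k j) u).
    have [d1 e1] := cderivable_cst l (x 0 k) u.
    have [d2 e2] := cderivable_real (dIj k j).
    have [d3 e3] := cderivableM d1 d2.
    by split; rewrite // e3 e1 e2 mul0r add0r.
  have [d1 e1] := cderivable_sum (fun k => (d k).1).
  by split; rewrite // e1; apply: eq_bigr => k _; rewrite (d k).2.
split; first by move=> j; exact: (st j).1.
rewrite -!mulmxA /coframe -!map_mxM -mulmxN -map_mxN mulmxA -derive_invmx_frame//.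
apply/rowP => j; rewrite mxE (st j).2 mxE; apply: eq_bigr => k _.
by rewrite mxE (derive_coord _ _ dIv).
Qed.

Let lin_sum (A : 'rV[C]_m -> C) (a : 'I_m -> C) X :
  (forall a x y, A (a *: x + y) = a * A x + A y) ->
  A (\sum_l a l *: X l) = \sum_l a l * A (X l).
Proof.
move=> AL; elim/big_rec2: _ => [|l x y _ <-]; last by rewrite AL.
by have := AL (-1) 0 0; rewrite scaler0 addr0 mulN1r addNr.
Qed.

Let linN (A : 'rV[C]_m -> C) :
  (forall a x y, A (a *: x + y) = a * A x + A y) -> forall x, A (- x) = - A x.
Proof.
move=> AL x; have A0 : A 0 = 0 by have := AL (-1) 0 0; rewrite scaler0 addr0 mulN1r addNr.
by rewrite -scaleN1r -[_ *: _]addr0 AL A0 addr0 mulN1r.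
Qed.

Let cconn_frame u (w x : 'rV[C]_m) : U u -> cconn u (w *m coframe u) x =
  \sum_l w 0 l *: (x *m map_mx rc (dframe l u) *m coframe u).
Proof. by move=> Uu; rewrite /cconn -mulmxA coframeK// mulmx1. Qed.

Definition dirpart u (w : 'rV[C]_m) (f : 'rV[R]_m -> C) : C :=
  \sum_l w 0 l * partial l f u.

Lemma dformE k (w : @Defs.form R m k) u v :
  dform w u v = \sum_(i < k.+1) (-1) ^+ i * dirpart u (v i) (fun u' => w u' (v \o lift i)).
Proof. by []. Qed.

Lemma partial_invariant2 u (w x y : 'rV[C]_m) (O : 'rV[C]_m -> 'rV[C]_m -> C) :
  (forall a x y z, O (a *: x + y) z = a * O x z + O y z) ->
  (forall a x y z, O z (a *: x + y) = a * O z x + O z y) -> U u ->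
  dirpart u w (fun u' => O (x *m coframe u') (y *m coframe u')) =
  - (O (cconn u (w *m coframe u) (x *m coframe u)) (y *m coframe u)
     + O (x *m coframe u) (cconn u (w *m coframe u) (y *m coframe u))).
Proof.
move=> OL OR Uu; rewrite /dirpart !cconn_frame//.
rewrite (lin_sum _ _ (fun a x' y' => OL a x' y' (y *m coframe u))).
rewrite (lin_sum _ _ (fun a x' y' => OR a x' y' (x *m coframe u))).
rewrite -big_split -sumrN; apply: eq_bigr => l _ /=.
have [dx ex] := vderivable_coframe l x Uu; have [dy ey] := vderivable_coframe l y Uu.
rewrite (bilinear_partial OL OR dx dy).2 ex ey.
rewrite (linN (fun a x' y' => OL a x' y' (y *m coframe u))).
by rewrite (linN (fun a x' y' => OR a x' y' (x *m coframe u))); ring.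
Qed.

Lemma partial_invariant3 u (w x y z : 'rV[C]_m) (O : 'rV[C]_m -> 'rV[C]_m -> 'rV[C]_m -> C) :
  (forall a x x' y z, O (a *: x + x') y z = a * O x y z + O x' y z) ->
  (forall a x y y' z, O x (a *: y + y') z = a * O x y z + O x y' z) ->
  (forall a x y z z', O x y (a *: z + z') = a * O x y z + O x y z') -> U u ->
  let cf := coframe in
  dirpart u w (fun u' => O (x *m cf u') (y *m cf u') (z *m cf u')) =
  - (O (cconn u (w *m cf u) (x *m cf u)) (y *m cf u) (z *m cf u)
     + O (x *m cf u) (cconn u (w *m cf u) (y *m cf u)) (z *m cf u)
     + O (x *m cf u) (y *m cf u) (cconn u (w *m cf u) (z *m cf u))).
Proof.
move=> O1 O2 O3 Uu /=; rewrite /dirpart !cconn_frame//.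
rewrite (lin_sum _ _ (fun a x' y' => O1 a x' y' (y *m coframe u) (z *m coframe u))).
rewrite (lin_sum _ _ (fun a x' y' => O2 a (x *m coframe u) x' y' (z *m coframe u))).
rewrite (lin_sum _ _ (fun a x' y' => O3 a (x *m coframe u) (y *m coframe u) x' y')).
rewrite -!big_split -sumrN; apply: eq_bigr => l _ /=.
have [dx ex] := vderivable_coframe l x Uu; have [dy ey] := vderivable_coframe l y Uu.
have [dz ez] := vderivable_coframe l z Uu.
rewrite (trilinear_partial O1 O2 O3 dx dy dz).2 ex ey ez.
rewrite (linN (fun a x' y' => O1 a x' y' (y *m coframe u) (z *m coframe u))).
rewrite (linN (fun a x' y' => O2 a (x *m coframe u) x' y' (z *m coframe u))).
by rewrite (linN (fun a x' y' => O3 a (x *m coframe u) (y *m coframe u) x' y')); ring.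
Qed.

Local Notation o2 k := (@Ordinal 2 k isT).
Local Notation o3 k := (@Ordinal 3 k isT).
Local Notation o4 k := (@Ordinal 4 k isT).

(** The covariant derivatives coming from [partial_invariant2] combine into
    brackets by [cconn_torsion]. *)
Lemma dform_invariant2 (O : 'rV[C]_m -> 'rV[C]_m -> C) u v :
  (forall a x y z, O (a *: x + y) z = a * O x z + O y z) ->
  (forall x y, O x y = - O y x) -> U u ->
  dform (invariant_form (form2 O)) u v = invariant_form
    (form3 (fun x y z => - O (cbr x y) z + O (cbr x z) y - O (cbr y z) x)) u v.
Proof.
move=> OL ON Uu.
have OR a x y z : O z (a *: x + y) = a * O z x + O z y.
  by rewrite ON OL opprD -mulrN -!ON.
have ONl x z : O (- x) z = - O x z by rewrite (linN (fun a x' y' => OL a x' y' z)).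
have ODl x y z : O (x + y) z = O x z + O y z by have := OL 1 x y z; rewrite scale1r mul1r.
rewrite dformE !big_ord_recl big_ord0 /invariant_form /form2 /form3 /=.
set x := v (o3 0); set y := v (o3 1); set z := v (o3 2).
have -> : lift ord0 (ord0 : 'I_2) = o3 1 by apply: val_inj.
have -> : lift ord0 (lift ord0 ord0) = o3 2 by apply: val_inj.
have e0 : v ord0 = x by congr v; apply: val_inj.
have l00 : v (lift ord0 (o2 0)) = y by congr v; apply: val_inj.
have l01 : v (lift ord0 (o2 1)) = z by congr v; apply: val_inj.
have l10 : v (lift (o3 1) (o2 0)) = x by congr v; apply: val_inj.
have l11 : v (lift (o3 1) (o2 1)) = z by congr v; apply: val_inj.
have l20 : v (lift (o3 2) (o2 0)) = x by congr v; apply: val_inj.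
have l21 : v (lift (o3 2) (o2 1)) = y by congr v; apply: val_inj.
have P2 := partial_invariant2 _ _ _ OL OR Uu.
have e1 : v (o3 1) = y by []. have e2 : v (o3 2) = z by [].
rewrite e0 e1 e2 l00 l01 l10 l11 l20 l21.
clearbody x y z; rewrite (P2 x y z) (P2 y x z) (P2 z x y) {P2 e1 e2}.
have T p q := esym (cconn_torsion p q Uu).
move: (x *m coframe u) (y *m coframe u) (z *m coframe u) => {e0 l00 l01 l10 l11 l20 l21} a b d.
rewrite !T {T}; move: (cconn u) => q; rewrite !ODl !ONl /bump /=.
have ON' p f g : O p (q f g) = - O (q f g) p by rewrite ON.
rewrite !ON'.
by rewrite !expr1 !expr0 sqrrN expr1n; ring.
Qed.

Lemma dform_invariant3 (O : 'rV[C]_m -> 'rV[C]_m -> 'rV[C]_m -> C) u v :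
  (forall a x x' y z, O (a *: x + x') y z = a * O x y z + O x' y z) ->
  (forall x y z, O y x z = - O x y z) -> (forall x y z, O x z y = - O x y z) -> U u ->
  dform (invariant_form (form3 O)) u v = invariant_form
    (form4 (fun x y z t => - O (cbr x y) z t + O (cbr x z) y t - O (cbr x t) y z
      - O (cbr y z) x t + O (cbr y t) x z - O (cbr z t) x y)) u v.
Proof.
move=> O1 ON1 ON2 Uu.
have O2 a x y y' z : O x (a *: y + y') z = a * O x y z + O x y' z.
  by rewrite ON1 O1 opprD -mulrN -!ON1.
have O3 a x y z z' : O x y (a *: z + z') = a * O x y z + O x y z'.
  by rewrite ON2 O2 opprD -mulrN -!ON2.
have ONl x y z : O (- x) y z = - O x y z by rewrite (linN (fun a x' y' => O1 a x' y' y z)).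
have ODl x x' y z : O (x + x') y z = O x y z + O x' y z.
  by have := O1 1 x x' y z; rewrite scale1r mul1r.
rewrite dformE !big_ord_recl big_ord0 /invariant_form /form3 /form4 /=.
set x := v (o4 0); set y := v (o4 1); set z := v (o4 2); set t := v (o4 3).
have -> : lift ord0 (ord0 : 'I_3) = o4 1 by apply: val_inj.
have -> : lift ord0 (lift ord0 (ord0 : 'I_2)) = o4 2 by apply: val_inj.
have -> : lift ord0 (lift ord0 (lift ord0 ord0)) = o4 3 by apply: val_inj.
have e0 : v ord0 = x by congr v; apply: val_inj.
have l00 : v (lift ord0 (o3 0)) = y by congr v; apply: val_inj.
have l01 : v (lift ord0 (o3 1)) = z by congr v; apply: val_inj.
have l02 : v (lift ord0 (o3 2)) = t by congr v; apply: val_inj.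
have l10 : v (lift (o4 1) (o3 0)) = x by congr v; apply: val_inj.
have l11 : v (lift (o4 1) (o3 1)) = z by congr v; apply: val_inj.
have l12 : v (lift (o4 1) (o3 2)) = t by congr v; apply: val_inj.
have l20 : v (lift (o4 2) (o3 0)) = x by congr v; apply: val_inj.
have l21 : v (lift (o4 2) (o3 1)) = y by congr v; apply: val_inj.
have l22 : v (lift (o4 2) (o3 2)) = t by congr v; apply: val_inj.
have l30 : v (lift (o4 3) (o3 0)) = x by congr v; apply: val_inj.
have l31 : v (lift (o4 3) (o3 1)) = y by congr v; apply: val_inj.
have l32 : v (lift (o4 3) (o3 2)) = z by congr v; apply: val_inj.
have e1 : v (o4 1) = y by []. have e2 : v (o4 2) = z by []. have e3 : v (o4 3) = t by [].
rewrite e0 e1 e2 e3 l00 l01 l02 l10 l11 l12 l20 l21 l22 l30 l31 l32.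
clearbody x y z t.
have P3 := partial_invariant3 _ _ _ _ O1 O2 O3 Uu.
have T p q := esym (cconn_torsion p q Uu).
rewrite (P3 x y z t) (P3 y x z t) (P3 z x y t) (P3 t x y z) {P3 e1 e2 e3 e0 l00 l01 l02 l10 l11 l12 l20 l21 l22 l30 l31 l32}.
move: (x *m coframe u) (y *m coframe u) (z *m coframe u) (t *m coframe u) => a b d e.
rewrite !T {T}; move: (cconn u) => q; rewrite !ODl !ONl /bump /=.
have N1 p f g r : O p (q f g) r = - O (q f g) p r by rewrite ON1.
have N2 p f g r : O p r (q f g) = O (q f g) p r by rewrite ON2 ON1 opprK.
rewrite !N1 !N2.
by rewrite !expr1 !expr0 sqrrN expr1n exprS sqrrN expr1n; ring.
Qed.

End DerivativeConstantForms.

(** * Complexification of a real Lie algebra *)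

Section Complexification.
Local Open Scope complex_scope.
Context {R : realType}.
Local Notation C := (R[i]).
Local Notation rc := (real_complex R).
Variables (J0 g0 : 'M[R]_6) (rb : 'rV[R]_6 -> 'rV[R]_6 -> 'rV[R]_6).
Local Notation e i := (delta_mx 0 i).
Local Notation iu := (0 +i* 1 : C).

Hypothesis rbL : forall a x y z, rb (a *: x + y) z = a *: rb x z + rb y z.
Hypothesis rbN : forall x y, rb x y = - rb y x.
Hypothesis rbjac : forall x y z, rb x (rb y z) = rb (rb x y) z + rb y (rb x z).
Hypothesis rbnil : exists K, forall s : seq 'rV[R]_6, size s = K ->
  forall y, foldr rb y s = 0.
Hypothesis J2 : J0 *m J0 = - 1%:M.
Hypothesis rbint : forall x y, rb (x *m J0) (y *m J0) - rb (x *m J0) y *m J0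
  - rb x (y *m J0) *m J0 - rb x y = 0.
Hypothesis gT : g0^T = g0.
Hypothesis gpos : forall v : 'rV[R]_6, v != 0 -> 0 < (v *m g0 *m v^T) 0 0.
Hypothesis gJ : J0 *m g0 *m J0^T = g0.

Definition structure_cst (i j : 'I_6) : 'rV[C]_6 := map_mx rc (rb (e i) (e j)).
Local Notation JC := (map_mx rc J0).
Local Notation NC := (map_mx rc (J0 *m g0)).

Lemma iu2 : iu * iu = -1.
Proof. by apply/eqP; rewrite eq_complex /= !(mulr0, mul0r, mulr1, add0r, addr0, sub0r) oppr0 !eqxx. Qed.

Lemma iuC : @Num.conj C iu = - iu.
Proof. by apply/eqP; rewrite eq_complex /= oppr0 !eqxx. Qed.

Lemma conj_rc (x : R) : @Num.conj C (rc x) = rc x.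
Proof. by apply/eqP; rewrite eq_complex /= oppr0 !eqxx. Qed.

Lemma conj_map_rc m n (A : 'M[R]_(m, n)) : map_mx (@Num.conj C) (map_mx rc A) = map_mx rc A.
Proof. by apply/matrixP => i j; rewrite !mxE conj_rc. Qed.

Lemma scbr_real a b : scbr structure_cst (map_mx rc a) (map_mx rc b) = map_mx rc (rb a b).
Proof.
have rbZ k x y : rb (k *: x) y = k *: rb x y.
  have l0 : rb 0 y = 0 by have := rbL (-1) 0 0 y; rewrite !scaleN1r oppr0 addr0 addNr.
  by rewrite -[k *: x]addr0 rbL l0 addr0.
have rbD x x' y : rb (x + x') y = rb x y + rb x' y.
  by have := rbL 1 x x' y; rewrite !scale1r.
have rbsum (k : 'I_6 -> R) X y : rb (\sum_i k i *: X i) y = \sum_i k i *: rb (X i) y.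
  elim/big_rec2: _ => [|i p q _ <-]; last by rewrite rbD rbZ.
  by have := rbZ 0 0 y; rewrite !scale0r.
have rbsumr (k : 'I_6 -> R) X y : rb y (\sum_i k i *: X i) = \sum_i k i *: rb y (X i).
  by rewrite rbN rbsum -sumrN; apply: eq_bigr => i _; rewrite -scalerN -rbN.
rewrite {2}[a]row_sum_delta rbsum raddf_sum /scbr; apply: eq_bigr => i _ /=.
rewrite {2}[b]row_sum_delta rbsumr scaler_sumr raddf_sum; apply: eq_bigr => j _ /=.
by rewrite scalerA map_mxZ rmorphM /= !mxE.
Qed.

Lemma map_delta (i : 'I_6) : map_mx rc (e i : 'rV[R]_6) = e i.
Proof. exact: map_delta_mx. Qed.

(** With p = a + i b of type (1,0), the left hand side is g(a, a) + g(b, b). *)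
Lemma complexified_pos (x : 'rV[C]_6) : vp10 JC iu x <> 0 ->
  0 < - iu * vform NC (vp10 JC iu x) (vconj (vp10 JC iu x)).
Proof.
have JC2 : JC *m JC = - 1%:M by rewrite -map_mxM J2 map_mxN map_mx1.
have := vp10_J iu2 JC2 x; move: (vp10 JC iu x) => p pJ p0.
pose a : 'rV[R]_6 := map_mx (@complex.Re R) p.
pose b : 'rV[R]_6 := map_mx (@complex.Im R) p.
have pE : p = map_mx rc a + iu *: map_mx rc b.
  apply/rowP => i; rewrite !mxE; case: (p 0 i) => s t /=.
  by apply/eqP; rewrite eq_complex /= !(mulr0, mul0r, mul1r, add0r, addr0, subr0, oppr0) !eqxx.
have pcE : vconj p = map_mx rc a - iu *: map_mx rc b.
  by rewrite pE addrC vconjL iuC /vconj !conj_map_rc scaleNr addrC.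
have -> : - iu * vform NC p (vconj p) = rc ((a *m g0 *m a^T) 0 0 + (b *m g0 *m b^T) 0 0).
  rewrite /vform map_mxM mulmxA pJ -!scalemxAl mxE mulrA mulNr iu2 opprK mul1r.
  rewrite pcE pE.
  have tr (u v : 'rV[C]_6) : (u - iu *: v)^T = u^T - iu *: v^T.
    by apply/matrixP => i j; rewrite !mxE.
  rewrite tr !mulmxDl !mulmxBr -!scalemxAl -!scalemxAr.
  have E (u v : 'rV[R]_6) : map_mx rc u *m map_mx rc g0 *m (map_mx rc v)^T = map_mx rc (u *m g0 *m v^T).
    have -> : (map_mx rc v)^T = map_mx rc v^T by apply/matrixP => i j; rewrite !mxE.
    by rewrite -!map_mxM.
  rewrite !E scalerA iu2 scaleN1r opprK.
  have -> : b *m g0 *m a^T = a *m g0 *m b^T.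
    apply/matrixP => i j; rewrite !ord1.
    have -> : (b *m g0 *m a^T) 0 0 = (b *m g0 *m a^T)^T 0 0 by rewrite [RHS]mxE.
    by rewrite !trmx_mul trmxK gT mulmxA.
  by rewrite addrA subrK -map_mxD !mxE.
rewrite ltcR.
have ab0 : (a != 0) || (b != 0).
  rewrite -negb_and; apply/negP => /andP[/eqP a0 /eqP b0]; apply: p0.
  by rewrite pE a0 b0 !map_mx0 scaler0 addr0.
have ge0 (u : 'rV[R]_6) : 0 <= (u *m g0 *m u^T) 0 0.
  have [->|u0] := eqVneq u 0; first by rewrite !mul0mx mxE.
  exact/ltW/gpos.
case/orP: ab0 => ab0; first by rewrite ltr_wpDr ?gpos.
by rewrite ltr_wpDl ?gpos.
Qed.

Theorem real_trace_zero_vanish :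
  let cj := @vconj C in let p10 := vp10 JC iu in
  let d := vd12 JC NC iu structure_cst in let Om := vform NC in
  (forall x y z, T10 p10 x -> T10 p10 y -> T10 p10 z ->
    x <> 0 -> y <> 0 -> z <> 0 -> orth cj Om x y -> orth cj Om x z -> orth cj Om y z ->
    d x y (cj x) (cj y) * Om z (cj z) + d x z (cj x) (cj z) * Om y (cj y)
    + d y z (cj y) (cj z) * Om x (cj x) = 0) ->
  forall x y u v, T10 p10 x -> T10 p10 y -> T01 (vp01 JC iu) u -> T01 (vp01 JC iu) v ->
    d x y u v = 0.
Proof.
move=> cj p10 d Om tr0.
apply: (scbr_trace_zero_vanish (J := JC) iu2 iuC) tr0.
- by rewrite -map_mxM J2 map_mxN map_mx1.
- exact: conj_map_rc.
- exact: conj_map_rc.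
- by move=> i j; exact: conj_map_rc.
- have -> : NC^T = map_mx rc (J0 *m g0)^T by apply/matrixP => i j; rewrite !mxE.
  rewrite -map_mxN; congr map_mx; rewrite trmx_mul gT.
  by rewrite -[in LHS]gJ -(mulmxA (J0 *m g0)) -trmx_mul J2 linearN /= trmx1 mulmxN mulmx1.
- have -> : JC^T = map_mx rc J0^T by apply/matrixP => i j; rewrite !mxE.
  by rewrite -!map_mxM -!mulmxA (mulmxA J0 g0) gJ.
- exact: complexified_pos.
- by move=> i j; rewrite /structure_cst rbN map_mxN.
- by move=> i j k; rewrite -!map_delta !scbr_real -map_mxD -rbjac.
- have [K hK] := rbnil; exists K => s sK j.
  rewrite -map_delta.
  have -> : foldr (fun i y => scbr structure_cst (e i) y) (map_mx rc (e j)) s =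
      map_mx rc (foldr rb (e j) [seq (e i : 'rV[R]_6) | i <- s]).
    by elim: s {sK} => //= i s ->; rewrite -map_delta scbr_real.
  by rewrite hK ?map_mx0// size_map.
- move=> i j; rewrite -!map_delta -!map_mxM !scbr_real -!map_mxM -!map_mxB.
  by rewrite rbint map_mx0.
- have [K hK] := rbnil.
  (* A nonzero iterated bracket of maximal length is central. *)
  have [s [y [zn0 zc]]] : exists s y, foldr rb y s <> 0 /\ forall a, rb a (foldr rb y s) = 0.
    elim: K hK => [|K IH] hK.
      have := hK [::] erefl (e 0) => /= /rowP/(_ 0); rewrite !mxE /= => /eqP.
      by rewrite oner_eq0.
    have [h|] := pselect (forall s, size s = K -> forall y, foldr rb y s = 0); first exact: IH.
    move=> /existsNP[s /not_implyP[sK /existsNP[y ys]]].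
    by exists s, y; split=> // a; have := hK (a :: s); rewrite /= sK => /(_ erefl).
  exists (map_mx rc (foldr rb y s)).
    move=> z0; apply: zn0; apply/rowP => i; have /rowP/(_ i) := z0.
    by rewrite !mxE => /complexI.
  by move=> i; rewrite -map_delta scbr_real rbN zc oppr0 map_mx0.
Qed.

End Complexification.

(** * The theorem in a frame with constant coefficients *)

Section LocalFrame.
Local Open Scope complex_scope.
Context {R : realType}.
Local Notation C := (R[i]).
Local Notation rc := (real_complex R).
Local Notation e i := (delta_mx 0 i).
Local Notation iu := (0 +i* 1 : C).
Variables (U : set 'rV[R]_6) (F J g : 'rV[R]_6 -> 'M[R]_6).
Variables (J0 g0 : 'M[R]_6) (rb : 'rV[R]_6 -> 'rV[R]_6 -> 'rV[R]_6).

Hypothesis oU : open U.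
Hypothesis uF : forall u, U u -> F u \in unitmx.
Hypothesis dF : forall u, U u -> differentiable F u.
Hypothesis structF : forall u i j, U u ->
  \sum_l F u i l *: row j (dframe F l u) - \sum_l F u j l *: row i (dframe F l u)
  = rb (e i) (e j) *m F u.
Hypothesis FJ : forall u, U u -> J0 *m F u = F u *m J u.
Hypothesis Fg : forall u, U u -> g0 = F u *m g u *m (F u)^T.

Hypothesis rbL : forall a x y z, rb (a *: x + y) z = a *: rb x z + rb y z.
Hypothesis rbN : forall x y, rb x y = - rb y x.
Hypothesis rbjac : forall x y z, rb x (rb y z) = rb (rb x y) z + rb y (rb x z).
Hypothesis rbnil : exists K, forall s : seq 'rV[R]_6, size s = K ->
  forall y, foldr rb y s = 0.
Hypothesis J2 : J0 *m J0 = - 1%:M.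
Hypothesis rbint : forall x y, rb (x *m J0) (y *m J0) - rb (x *m J0) y *m J0
  - rb x (y *m J0) *m J0 - rb x y = 0.
Hypothesis gT : g0^T = g0.
Hypothesis gpos : forall v : 'rV[R]_6, v != 0 -> 0 < (v *m g0 *m v^T) 0 0.
Hypothesis gJ : J0 *m g0 *m J0^T = g0.

Local Notation p10 := (vp10 (map_mx rc J0) iu).
Local Notation p01 := (vp01 (map_mx rc J0) iu).
Local Notation Om := (vform (map_mx rc (J0 *m g0))).
Local Notation c := (fun i j => rb (e i) (e j)).
Local Notation br := (cbr c).
Local Notation cf := (coframe F).
Local Notation Omega := (fundamental_form J g).
Local Notation inv := (invariant_form F).

(** In the frame, [J u] and [g u] become the constant matrices [J0] and [g0]. *)
Lemma fundamental_invariant u v : U u -> Omega u v = inv (form2 Om) u v.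
Proof.
move=> Uu; rewrite /fundamental_form /invariant_form /form2 /vform.
have -> : v (@Ordinal 2 0 isT) = v ord0 by congr v; apply: val_inj.
have -> : v (@Ordinal 2 1 isT) = v ord_max by congr v; apply: val_inj.
have Ju : J u = invmx (F u) *m J0 *m F u by rewrite -mulmxA FJ// mulKmx ?uF.
have gu : g u = invmx (F u) *m g0 *m (invmx (F u))^T.
  by rewrite (Fg Uu) !mulmxA mulVmx ?uF// mul1mx -mulmxA -trmx_mul mulVmx ?uF// trmx1 mulmx1.
have -> : J u *m g u = invmx (F u) *m (J0 *m g0) *m (invmx (F u))^T.
  by rewrite Ju gu !mulmxA mulmxK ?uF.
rewrite trmx_mul /coframe.
have -> : (map_mx rc (invmx (F u)))^T = map_mx rc (invmx (F u))^T.
  by apply/matrixP => i j; rewrite !mxE.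
by rewrite !map_mxM !mulmxA.
Qed.

Lemma J_coframe u : U u -> map_mx rc (J u) *m cf u = cf u *m map_mx rc J0.
Proof.
move=> Uu; rewrite /coframe -[LHS]map_mxM -[RHS]map_mxM; congr map_mx.
by apply: (can_inj (mulKmx (uF Uu))); rewrite mulmxA -FJ// mulmxK ?uF// mulKVmx ?uF.
Qed.

Lemma proj10_coframe u x : U u -> proj10 J u x *m cf u = p10 (x *m cf u).
Proof.
move=> Uu; have JE := J_coframe Uu; rewrite /proj10 /vp10.
move: (map_mx rc (J u)) (cf u) (map_mx rc J0) JE => Ju cfu JC JE.
by rewrite -scalemxAl mulmxBl -scalemxAl -!mulmxA JE.
Qed.

Lemma proj01_coframe u x : U u -> proj01 J u x *m cf u = p01 (x *m cf u).
Proof.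
move=> Uu; have JE := J_coframe Uu; rewrite /proj01 /vp01.
move: (map_mx rc (J u)) (cf u) (map_mx rc J0) JE => Ju cfu JC JE.
by rewrite -scalemxAl mulmxDl -scalemxAl -!mulmxA JE.
Qed.

Lemma type_part_invariant k p (A : ('I_k -> 'rV[C]_6) -> C) u v : U u ->
  type_part J p (inv A) u v = inv (ctype p10 p01 p A) u v.
Proof.
move=> Uu; rewrite /type_part /invariant_form /ctype.
apply: eq_bigr => S _.
have E : (fun i => (if i \in S then proj10 J u (v i) else proj01 J u (v i)) *m cf u) =
   (fun i => if i \in S then p10 (v i *m cf u) else p01 (v i *m cf u)).
  by apply/funext => i; case: (i \in S); rewrite ?(proj10_coframe _ Uu) ?(proj01_coframe _ Uu).
by rewrite E.
Qed.

Lemma dform_near k (w w' : @Defs.form R 6 k) u v : U u ->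
  (forall u v, U u -> w u v = w' u v) -> dform w u v = dform w' u v.
Proof.
move=> Uu ww; apply: eq_bigr => i _; congr (_ * _); apply: eq_bigr => l _; congr (_ * _).
apply: partial_near; have : \near u, U u by exact: open_nbhs_nbhs.
by apply: filterS => u' Uu'; exact: ww.
Qed.

Lemma type_part_at k p (w w' : @Defs.form R 6 k) u v :
  (forall v, w u v = w' u v) -> type_part J p w u v = type_part J p w' u v.
Proof. by move=> ww; apply: eq_bigr => S _; exact: ww. Qed.

Lemma dform0 k u v : dform ((fun _ _ => 0) : @Defs.form R 6 k) u v = 0.
Proof.
rewrite /dform big1// => i _; rewrite big1 ?mulr0// => l _.
by rewrite (cderivable_cst l 0 u).2 mulr0.
Qed.

Local Notation o2 k := (@Ordinal 2 k isT).
Local Notation o3 k := (@Ordinal 3 k isT).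
Local Notation o4 k := (@Ordinal 4 k isT).
Local Notation DOm := (dOm br Om).
Local Notation om := (om12 br p10 p01 Om).
Local Notation d4 := (d12 br p10 p01 Om).

Let JC2 : map_mx rc J0 *m map_mx rc J0 = - 1%:M.
Proof. by rewrite -map_mxM J2 map_mxN map_mx1. Qed.

Let brL : forall a x y z, br (a *: x + y) z = a *: br x z + br y z.
Proof. exact: (scbrL (structure_cst rb)). Qed.
Let brN : forall x y, br x y = - br y x.
Proof. by apply: (scbrN (c := structure_cst rb)) => i j; rewrite /structure_cst rbN map_mxN. Qed.
Let OmL : forall a x y z, Om (a *: x + y) z = a * Om x z + Om y z.
Proof. exact: vformL. Qed.
Let NT : (map_mx rc (J0 *m g0))^T = - map_mx rc (J0 *m g0).
Proof.
have -> : (map_mx rc (J0 *m g0))^T = map_mx rc (J0 *m g0)^T.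
  by apply/matrixP => i j; rewrite !mxE.
rewrite -map_mxN; congr map_mx; rewrite trmx_mul gT.
by rewrite -[in LHS]gJ -(mulmxA (J0 *m g0)) -trmx_mul J2 linearN /= trmx1 mulmxN mulmx1.
Qed.
Let OmN : forall x y, Om x y = - Om y x.
Proof. exact: vformN NT. Qed.
Let p10L := vp10L (map_mx rc J0) iu.
Let p10K := vp10K iu2 JC2.
Let p01E := vp01E (map_mx rc J0) iu.

Local Ltac hyps := first [exact: brL | exact: brN | exact: OmL | exact: OmN
  | exact: p10L | exact: p01E].

Let omL a x x' y z : om (a *: x + x') y z = a * om x y z + om x' y z.
Proof. by apply: om12L1; hyps. Qed.
Let om01 x y z : om y x z = - om x y z.
Proof. by apply: om12_01; hyps. Qed.
Let om12' x y z : om x z y = - om x y z.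
Proof. by apply: om12_12; hyps. Qed.
Let d4L a x x' y z t : d4 (a *: x + x') y z t = a * d4 x y z t + d4 x' y z t.
Proof. by apply: d12L1; hyps. Qed.
Let d4_01 x y z t : d4 y x z t = - d4 x y z t.
Proof. by apply: d12_01; hyps. Qed.
Let d4_12 x y z t : d4 x z y t = - d4 x y z t.
Proof. by apply: d12_12; hyps. Qed.
Let d4_23 x y z t : d4 x y t z = - d4 x y z t.
Proof. by apply: d12_23; hyps. Qed.
Let DOmL a x x' y z : DOm (a *: x + x') y z = a * DOm x y z + DOm x' y z.
Proof. by apply: dOmL1; hyps. Qed.
Let DOm01 x y z : DOm y x z = - DOm x y z.
Proof. by apply: dOm01; hyps. Qed.
Let DOm12 x y z : DOm x z y = - DOm x y z.
Proof. by apply: dOm12; hyps. Qed.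

Let L0 (f : 'rV[C]_6 -> C) : (forall a x y, f (a *: x + y) = a * f x + f y) -> f 0 = 0.
Proof. by move=> fL; have := fL (-1) 0 0; rewrite scaler0 addr0 mulN1r addNr. Qed.

Let p1001 x : p10 (p01 x) = 0.
Proof. by rewrite p01E -scaleN1r addrC p10L p10K scaleN1r addNr. Qed.
Let p0110 x : p01 (p10 x) = 0.
Proof. by rewrite p01E p10K subrr. Qed.
Let p01K x : p01 (p01 x) = p01 x.
Proof. by rewrite p01E p1001 subr0. Qed.
Let ps x : p10 x + p01 x = x. Proof. exact: vpsum. Qed.

Let JNJ : map_mx rc J0 *m map_mx rc (J0 *m g0) *m (map_mx rc J0)^T = map_mx rc (J0 *m g0).
Proof.
have -> : (map_mx rc J0)^T = map_mx rc J0^T by apply/matrixP => i j; rewrite !mxE.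
by rewrite -!map_mxM -!mulmxA (mulmxA J0 g0) gJ.
Qed.

Let Om_types x y : Om (p10 x) (p01 y) + Om (p01 x) (p10 y) = Om x y.
Proof.
exact: (vform_types iu2 iuC JC2 (conj_map_rc _) (conj_map_rc _) NT JNJ).
Qed.

Let Om0 y : Om 0 y = 0.
Proof. by apply: (L0 (f := fun x => Om x y)) => a x x'; exact: OmL. Qed.
Let DOm0 y z : DOm 0 y z = 0.
Proof. by apply: (L0 (f := fun x => DOm x y z)) => a x x'; exact: DOmL. Qed.
Let om0 y z : om 0 y z = 0.
Proof. by apply: (L0 (f := fun x => om x y z)) => a x x'; exact: omL. Qed.
Let d40 y z t : d4 0 y z t = 0.
Proof. by apply: (L0 (f := fun x => d4 x y z t)) => a x x'; exact: d4L. Qed.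

Let ctype_form2 : ctype p10 p01 1 (form2 Om) = form2 Om.
Proof. by apply/funext => v; rewrite ctype1_form2 Om_types. Qed.

Let ctype_form3 : ctype p10 p01 1 (form3 DOm) = form3 om.
Proof. by apply/funext => v; rewrite ctype1_form3. Qed.

Let ctype_om : ctype p10 p01 1 (form3 om) = form3 om.
Proof.
by rewrite -ctype_form3 (ctypeK _ _ p10K p01K p1001 p0110 (kills_form3 DOm0 DOm01 DOm12)).
Qed.

(** Both [del] and [delbar] are sums over types of typed components of
    differentials: for a form of pure type a single term survives. The map [h]
    tells the two cases apart. *)
Lemma typed_differential k q (h : nat -> nat) (A : ('I_k -> 'rV[C]_6) -> C) A'
    (w : @Defs.form R 6 k) :
  kills0 A -> ctype p10 p01 q A = A -> (q < k.+1)%N ->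
  (forall u v, U u -> w u v = inv A u v) ->
  (forall u v, U u -> dform (inv A) u v = inv A' u v) ->
  forall u v, U u -> \sum_(p < k.+1) type_part J (h p) (dform (type_part J p w)) u v
    = inv (ctype p10 p01 (h q) A') u v.
Proof.
move=> A0 qA qk wA dA u v Uu.
have E p v' : dform (type_part J p w) u v' = dform (inv (ctype p10 p01 p A)) u v'.
  apply: dform_near Uu _ => u' v'' Uu'.
  by rewrite (type_part_at _ _ (fun v => wA _ v Uu')) type_part_invariant.
have cK p : ctype p10 p01 p A = if p == q then A else fun=> 0.
  by rewrite -[in LHS]qA (ctypeK _ _ p10K p01K p1001 p0110 A0) qA.
rewrite (bigD1 (Ordinal qk))//= [X in _ + X]big1 ?addr0.
  rewrite (type_part_at _ _ (w' := inv A')); first exact: type_part_invariant.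
  by move=> v'; rewrite E cK eqxx dA.
move=> [p pk] /= pq; rewrite (type_part_at _ _ (w' := fun _ _ => 0)); first by rewrite /type_part big1.
move=> v'; rewrite E cK ifF; last first.
  by apply: contraNF pq => /eqP pq; apply/eqP/val_inj.
exact: dform0.
Qed.

Lemma delbar_invariant u v : U u -> delbar J Omega u v = inv (form3 om) u v.
Proof.
move=> Uu; rewrite -ctype_form3.
apply: (typed_differential id (kills_form2 Om0 OmN) ctype_form2) => // u' v' Uu'.
  exact: fundamental_invariant.
exact: (dform_invariant2 oU uF dF structF _ OmL OmN Uu').
Qed.

Lemma del_delbar_invariant u v : U u ->
  del J (delbar J Omega) u v = inv (ctype p10 p01 2 (form4 d4)) u v.
Proof.
move=> Uu.
apply: (typed_differential S (kills_form3 om0 om01 om12') ctype_om) => // [|u' v' Uu'].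
  exact: delbar_invariant.
exact: (dform_invariant3 oU uF dF structF _ omL om01 om12' Uu').
Qed.

Lemma wedge_cst1 (a : @Defs.form R 6 2) u w : alternating (a u) ->
  wedge a (fun _ _ => 1 : C) u w = a u w.
Proof.
move=> alt_a; rewrite /wedge.
rewrite (eq_bigr (fun=> a u w)) => [|s _].
  by rewrite sumr_const card_Sn muln1 -[a u w *+ _]mulr_natl mulKf// pnatr_eq0.
rewrite mulr1 (_ : (fun i => _) = w \o s).
  by rewrite (alt_a s w) mulrA -signr_addb addbb mul1r.
by apply/funext => i /=; congr (w (s _)); apply: val_inj.
Qed.

Local Notation A4 := (ctype p10 p01 2 (form4 d4)).

Let A4alt : alternating A4.
Proof. exact: (@ctype_alternating _ _ p10 p01 4 2 _ (alternating_form4 d4_01 d4_12 d4_23)). Qed.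

(** Evaluating on frame vectors removes the change of basis. *)
Lemma wedge_invariant0 u : U u ->
  (forall v, wedge (del J (delbar J Omega)) (wedge_exp Omega 1) u v = 0) ->
  forall z, wedge_sum A4 (form2 Om) z = 0.
Proof.
move=> Uu W0 z.
have zE i : z i *m map_mx rc (F u) *m cf u = z i.
  by rewrite -mulmxA /coframe -map_mxM mulmxV ?uF// map_mx1 mulmx1.
have := W0 (fun i => z i *m map_mx rc (F u)).
move=> /eqP; rewrite mulf_eq0 invr_eq0 pnatr_eq0 /= => /eqP E.
rewrite -[RHS]E; apply: eq_bigr => s _; congr (_ * _ * _).
  rewrite (del_delbar_invariant _ Uu) /invariant_form.
  set a := (X in A4 X = _); set b := (X in _ = A4 X).
  by have -> : a = b by apply/funext => i; rewrite /b zE.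
have altO : alternating (Omega u).
  move=> t v; rewrite !(fundamental_invariant _ Uu) /invariant_form.
  exact: (alternating_form2 OmN t).
rewrite [RHS](wedge_cst1 _ altO) (fundamental_invariant _ Uu) /invariant_form.
set a := (X in form2 Om X = _); set b := (X in _ = form2 Om X).
by have -> : a = b by apply/funext => i; rewrite /b zE.
Qed.

Let kills_d4 : kills0 (form4 d4) := kills_form4 d40 d4_01 d4_12 d4_23.

Lemma A4_pure x y u v : T10 p10 x -> T10 p10 y -> T01 p01 u -> T01 p01 v ->
  A4 (vec [:: x; y; u; v]) = d4 x y u v.
Proof.
move=> tx ty tu tv.
rewrite (ctype_pure (S := [set o4 0; o4 1]) _ kills_d4); first by rewrite cards2.
have q10 w : T10 p10 w -> p01 w = 0 by move=> <-; exact: p0110.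
have q01 w : T01 p01 w -> p10 w = 0 by move=> <-; exact: p1001.
move=> i; rewrite /vec !inE; case: (ord4P i) => -> /=.
- by split; [exact: tx | exact: q10].
- by split; [exact: ty | exact: q10].
- by split; [exact: q01 | exact: tu].
- by split; [exact: q01 | exact: tv].
Qed.

Let d4_vanish : (forall z, wedge_sum A4 (form2 Om) z = 0) ->
  forall x y u v, T10 p10 x -> T10 p10 y -> T01 p01 u -> T01 p01 v -> d4 x y u v = 0.
Proof.
move=> W0.
apply: (real_trace_zero_vanish rbL rbN rbjac rbnil J2 rbint gT gpos gJ).
move=> x y z tx ty tz x0 y0 z0 xy xz yz.
have tc w : T10 p10 w -> T01 p01 (vconj w).
  move=> tw; rewrite /T01 -[in RHS]tw.
  by rewrite (vconj_vp10 iuC (conj_map_rc _)).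
have OC w w' : orth (@vconj _) Om w w' -> Om w' (vconj w) = 0.
  move=> h; rewrite OmN -[w' in Om _ w']vconjK.
  by rewrite (vform_conj (conj_map_rc _)) h rmorph0 oppr0.
have h10 w w' : T10 p10 w -> T10 p10 w' -> Om w w' = 0.
  by move=> <- <-; exact: (vform1010 iu2 JC2 NT JNJ).
have h01 w w' : T01 p01 w -> T01 p01 w' -> Om w w' = 0.
  by move=> <- <-; exact: (vform0101 iu2 iuC JC2 (conj_map_rc _) (conj_map_rc _) NT JNJ).
have := wedge_sum42_types (x := x) (y := y) (z := z) (x' := vconj x) (y' := vconj y)
  (z' := vconj z) A4alt OmN.
rewrite !A4_pure //; try exact: tc.
move=> H; rewrite -[RHS](H _ _ xy xz (OC _ _ xy) yz (OC _ _ xz) (OC _ _ yz) (W0 _)).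
- by rewrite [d4 z y _ _]d4_01 [d4 y z (vconj z) _]d4_23 opprK.
- move=> w w'; rewrite !inE => hw hw'; apply: h10.
    by case/or3P: hw => /eqP->.
  by case/or3P: hw' => /eqP->.
- move=> w w'; rewrite !inE => hw hw'; apply: h01.
    by case/or3P: hw => /eqP->; exact: tc.
  by case/or3P: hw' => /eqP->; exact: tc.
Qed.

(** A form of type (2,2) vanishes once it vanishes on two vectors of each type
    in a fixed order; the six positions of the (1,0)-arguments are reduced to
    this order by antisymmetry. *)
Theorem local_gauduchon_skt u : U u ->
  (forall v, wedge (del J (delbar J Omega)) (wedge_exp Omega 1) u v = 0) ->
  forall v, del J (delbar J Omega) u v = 0.
Proof.
move=> Uu /(wedge_invariant0 Uu)/d4_vanish van v.
rewrite (del_delbar_invariant _ Uu) /invariant_form.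
move: (fun i => v i *m cf u) => {}v.
have d4v x y a b : d4 (p10 x) (p10 y) (p01 a) (p01 b) = 0.
  by apply: van; [exact: p10K | exact: p10K | exact: p01K | exact: p01K].
rewrite /ctype big1 // => S; rewrite -sum1_card big_mkcond /= !big_ord_recl big_ord0.
have e0 : ord0 = o4 0 by apply: val_inj.
have e1 : lift ord0 ord0 = o4 1 by apply: val_inj.
have e2 : lift ord0 (lift ord0 ord0) = o4 2 by apply: val_inj.
have e3 : lift ord0 (lift ord0 (lift ord0 ord0)) = o4 3 by apply: val_inj.
rewrite e3 e2 e1 e0 /form4 {e0 e1 e2 e3}.
have d4v2 x y a b : d4 (p10 x) (p01 a) (p10 y) (p01 b) = 0 by rewrite d4_12 d4v oppr0.
have d4v3 x y a b : d4 (p10 x) (p01 a) (p01 b) (p10 y) = 0 by rewrite d4_23 d4v2 oppr0.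
have d4v4 x y a b : d4 (p01 a) (p10 x) (p10 y) (p01 b) = 0 by rewrite d4_01 d4v2 oppr0.
have d4v5 x y a b : d4 (p01 a) (p10 x) (p01 b) (p10 y) = 0 by rewrite d4_01 d4v3 oppr0.
have d4v6 x y a b : d4 (p01 a) (p01 b) (p10 x) (p10 y) = 0 by rewrite d4_12 d4v5 oppr0.
case: (o4 0 \in S); case: (o4 1 \in S); case: (o4 2 \in S); case: (o4 3 \in S) => // _.
Qed.

End LocalFrame.

(** * Smooth maps in charts *)

Section SmoothGerms.
Context {R : realType}.

Lemma smooth_twice_differentiable (V W : normedModType R) (U : set V) (f : V -> W) x :
  smooth_on U f -> nbhs x U -> twice_differentiable f x.
Proof.
move=> sf nU; have [d1 d2] := sf 2%N; split; first by apply: filterS nU.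
by move=> v; have [d3 _] := d2 v; apply: d3; exact: nbhs_singleton.
Qed.

Section Charts.
Context {m : nat} {T : topologicalType} (c : chart R m T).
Hypothesis cc : is_chart c.

Lemma chart_ran_near x : cdom c x -> \forall u \near cmap c x, cran c u.
Proof.
move=> cx; apply: open_nbhs_nbhs; split; first exact: chart_ran_open cc.
by exists x.
Qed.

Lemma chart_inv_near x (N : set T) : cdom c x -> nbhs x N ->
  \forall u \near cmap c x, N (cinv c u).
Proof.
move=> cx xN; have := chart_inv_cts cc (u := cmap c x); apply; first by exists x.
by rewrite (chart_mapK cc cx).
Qed.

Lemma chart_dom_nbhs x : cdom c x -> nbhs x (cdom c).
Proof. by move=> cx; apply: open_nbhs_nbhs; split=> //; exact: chart_dom_open cc. Qed.

Lemma chart_ranP u : cran c u -> cdom c (cinv c u) /\ cmap c (cinv c u) = u.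
Proof. by move=> [x cx <-]; rewrite (chart_mapK cc cx). Qed.

End Charts.

Lemma smooth_map_local_rep m (M N : topologicalType) (AM : set (chart R m M))
    (AN : set (chart R m N)) (U : set M) (f : M -> N) c d x :
  is_chart c -> is_chart d -> smooth_map_on AM AN U f -> AM c -> AN d -> nbhs x U ->
  cdom c x -> cdom d (f x) -> twice_differentiable (local_rep c d f) (cmap c x).
Proof.
move=> cc cd [fc fs] Ac Ad xU cx dfx.
apply: (smooth_twice_differentiable (fs c d Ac Ad)).
have nN : nbhs x (U `&` cdom c `&` f @^-1` cdom d).
  apply: filterI; first by apply: filterI => //; exact: chart_dom_nbhs.
  by apply: (fc x (nbhs_singleton xU)); exact: chart_dom_nbhs.
have nu : \forall u \near cmap c x,
    (U `&` cdom c `&` f @^-1` cdom d) (cinv c u) /\ cran c u.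
  by apply: filterI; [exact: (chart_inv_near cc cx nN)|exact: (chart_ran_near cc cx)].
apply: filterS nu => u [h cu].
exists (cinv c u) => //.
by have [] := chart_ranP cc cu.
Qed.

End SmoothGerms.

(** * The Lie algebra of a Lie group *)

Section LieGroup.
Context {R : realType} {m : nat} {G : topGroupType} (AG : set (chart R m G)).
Hypothesis hG : lie_group AG.
Local Notation "x *g y" := (x * y)%g (at level 40, left associativity).

Let ac c : AG c -> is_chart c := atlas_chart (lie_atlas hG) (c := c).

Definition mul_rep (c1 c2 d : chart R m G) (q : 'rV[R]_m * 'rV[R]_m) : 'rV[R]_m :=
  cmap d (cinv c1 q.1 *g cinv c2 q.2).

Lemma mul_near (x y : G) (N : set G) : nbhs (x *g y) N ->
  \forall q \near (x, y), N (q.1 *g q.2).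
Proof. by move=> h; exact: (lie_mul_cts hG (x := (x, y)) h). Qed.

Lemma mul_rep_near c1 c2 x y (N : set G) : AG c1 -> AG c2 ->
  cdom c1 x -> cdom c2 y -> nbhs (x *g y) N ->
  \forall q \near (cmap c1 x, cmap c2 y), [/\ cran c1 q.1, cran c2 q.2 &
     N (cinv c1 q.1 *g cinv c2 q.2)].
Proof.
move=> A1 A2 cx cy /mul_near[[N1 N2] /= [xN1 yN2] sub].
have n1 : \forall u \near cmap c1 x, cran c1 u /\ N1 (cinv c1 u).
  by apply: filterI; [exact: (chart_ran_near (ac A1) cx)|exact: (chart_inv_near (ac A1) cx xN1)].
have n2 : \forall u \near cmap c2 y, cran c2 u /\ N2 (cinv c2 u).
  by apply: filterI; [exact: (chart_ran_near (ac A2) cy)|exact: (chart_inv_near (ac A2) cy yN2)].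
exists ([set u | cran c1 u /\ N1 (cinv c1 u)], [set u | cran c2 u /\ N2 (cinv c2 u)]).
  by split.
move=> [u v] /= [[cu1 nu] [cv1 nv]]; split=> //.
by apply: (sub (cinv c1 u, cinv c2 v)); split.
Qed.

Lemma mul_rep_twice c1 c2 d x y : AG c1 -> AG c2 -> AG d ->
  cdom c1 x -> cdom c2 y -> cdom d (x *g y) ->
  twice_differentiable (mul_rep c1 c2 d) (cmap c1 x, cmap c2 y).
Proof.
move=> A1 A2 Ad cx cy dxy.
apply: (smooth_twice_differentiable (lie_mul_smooth hG A1 A2 Ad)).
have nq := mul_rep_near A1 A2 cx cy (chart_dom_nbhs (ac Ad) dxy).
by apply: filterS nq => q.
Qed.

Lemma left_rep_twice c d a x : AG c -> AG d -> cdom c x -> cdom d (a *g x) ->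
  twice_differentiable (fun w => cmap d (a *g cinv c w)) (cmap c x).
Proof.
move=> Ac Ad cx dax; have [c1 A1 c1a] := atlas_cover (lie_atlas hG) a.
have := twice_partial2 (mul_rep_twice A1 Ac Ad c1a cx dax).
by rewrite /mul_rep /= (chart_mapK (ac A1) c1a).
Qed.

Lemma right_rep_twice c d a x : AG c -> AG d -> cdom c x -> cdom d (x *g a) ->
  twice_differentiable (fun w => cmap d (cinv c w *g a)) (cmap c x).
Proof.
move=> Ac Ad cx dax; have [c1 A1 c1a] := atlas_cover (lie_atlas hG) a.
have := twice_partial1 (mul_rep_twice Ac A1 Ad cx c1a dax).
by rewrite /mul_rep /= (chart_mapK (ac A1) c1a).
Qed.

Lemma left_near (a x : G) (N : set G) : nbhs (a *g x) N -> \forall y \near x, N (a *g y).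
Proof.
move=> /mul_near[[N1 N2] /= [aN1 xN2] sub]; apply: filterS xN2 => y ny.
by apply: (sub (a, y)); split=> //=; exact: nbhs_singleton.
Qed.

Lemma right_near (a x : G) (N : set G) : nbhs (x *g a) N -> \forall y \near x, N (y *g a).
Proof.
move=> /mul_near[[N1 N2] /= [xN1 aN2] sub]; apply: filterS xN1 => y ny.
by apply: (sub (y, a)); split=> //=; exact: nbhs_singleton.
Qed.

Lemma inv_near (x : G) (N : set G) : nbhs (x^-1)%g N -> \forall y \near x, N (y^-1)%g.
Proof. by have [ic _] := lie_inv_smooth hG; exact: (ic x I). Qed.

Variable e : chart R m G.
Hypothesis Ae : AG e.
Hypothesis e1 : cdom e 1%g.

Local Notation X := (cinv e).
Local Notation w0 := (cmap e 1%g).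
Local Notation mu := (mul_rep e e e).

Definition conj_rep (y : G) (w : 'rV[R]_m) := cmap e (y^-1 *g (X w *g y))%g.
Definition comm_rep (y : G) (w : 'rV[R]_m) := cmap e ((X w)^-1 *g (y^-1 *g (X w *g y)))%g.
Definition Ad y := 'J (conj_rep y) w0.

Let X0 : X w0 = 1%g. Proof. exact: (chart_mapK (ac Ae) e1). Qed.

Let near_e (N : set G) : nbhs (1%g : G) N -> \forall w \near w0, N (X w).
Proof. exact: (chart_inv_near (ac Ae) e1). Qed.

Let near1_dom : nbhs (1%g : G) (cdom e). Proof. exact: (chart_dom_nbhs (ac Ae) e1). Qed.

Let ran_near : \forall w \near w0, cran e w. Proof. exact: (chart_ran_near (ac Ae) e1). Qed.

Lemma conj_rep0 y : conj_rep y w0 = w0.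
Proof. by rewrite /conj_rep X0 mul1g mulVg. Qed.

Lemma comm_rep0 y : comm_rep y w0 = w0.
Proof. by rewrite /comm_rep X0 invg1 !mul1g mulVg. Qed.

Lemma near_conj (y : G) (N : set G) : nbhs (1%g : G) N ->
  \forall x \near (1%g : G), N (y^-1 *g (x *g y))%g.
Proof.
move=> n1; apply: (right_near (a := y) (N := fun z => N (y^-1 *g z))).
by apply: left_near; rewrite mul1g mulVg.
Qed.

Lemma conj_rep_diff y : differentiable (conj_rep y) w0.
Proof.
have [d Ad' dy] := atlas_cover (lie_atlas hG) y.
have d1y : cdom d (1 *g y)%g by rewrite mul1g.
have ey : cdom e (y^-1 *g (1 *g y))%g by rewrite mul1g mulVg.
have [/nbhs_singleton D1 _] := right_rep_twice Ae Ad' e1 d1y.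
have [/nbhs_singleton D2 _] := left_rep_twice Ad' Ae d1y ey.
have D2' : differentiable (fun w => cmap e (y^-1 *g cinv d w)) (cmap d (X w0 *g y)).
  by rewrite X0.
have := differentiable_comp D1 D2'.
apply: near_eq_differentiable.
have dn : nbhs (1 *g y)%g (cdom d) by exact: (chart_dom_nbhs (ac Ad') d1y).
have nw := near_e (right_near dn); apply: filterS nw => w dw.
by rewrite /conj_rep /= (chart_mapK (ac Ad') dw).
Qed.

(** The order of the factors is the one for which [Ad] is multiplicative on
    matrices acting on row vectors ([AdM]). *)
Lemma conj_rep_mul y1 y2 :
  \forall w \near w0, conj_rep y2 (conj_rep y1 w) = conj_rep (y1 *g y2) w.
Proof.
have nw := near_e (near_conj y1 near1_dom); apply: filterS nw => w dw.
rewrite /conj_rep (chart_mapK (ac Ae) dw); congr (cmap e _).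
by rewrite invgM !mulgA.
Qed.

Lemma AdM y1 y2 : Ad (y1 *g y2) = Ad y1 *m Ad y2.
Proof.
have D1 := conj_rep_diff y1.
have D2 : differentiable (conj_rep y2) (conj_rep y1 w0).
  by rewrite conj_rep0; exact: conj_rep_diff.
rewrite /Ad -[X in _ *m 'J _ X](conj_rep0 y1) -(jacobian_comp D1 D2).
apply/esym/jacobian_near; last exact: differentiable_comp.
exact: conj_rep_mul.
Qed.

Lemma Ad1 : Ad 1%g = 1%:M.
Proof.
rewrite /Ad -(jacobian_id w0); apply: jacobian_near; last exact: conj_rep_diff.
apply: filterS ran_near => w rw.
by rewrite /conj_rep invg1 mul1g mulg1; have [] := chart_ranP (ac Ae) rw.
Qed.

Let mu_twice : twice_differentiable mu (w0, w0).
Proof. by apply: mul_rep_twice => //; rewrite mul1g. Qed.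

Lemma mul_rep1r : \forall w \near w0, mu (w, w0) = w.
Proof.
apply: filterS ran_near => w rw; rewrite /mul_rep /= X0 mulg1.
by have [] := chart_ranP (ac Ae) rw.
Qed.

Lemma mul_rep1l : \forall w \near w0, mu (w0, w) = w.
Proof.
apply: filterS ran_near => w rw; rewrite /mul_rep /= X0 mul1g.
by have [] := chart_ranP (ac Ae) rw.
Qed.

(** The left and right invariant frames: row [i] of [lframe w], resp. [rframe w],
    is the value at [X w] of the left, resp. right, invariant field equal to
    the [i]th coordinate vector at the identity. *)
Definition lframe := jacobian2 mu w0.
Definition rframe := jacobian1 mu w0.
(** The second order part of the product at the identity, whose skew part is
    the Lie bracket. *)
Definition lie_bil (a b : 'rV[R]_m) : 'rV[R]_m := mixed_derivative mu (w0, w0) a b.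
Definition lie_br a b := lie_bil a b - lie_bil b a.

Lemma lframe0 : lframe w0 = 1%:M.
Proof.
have [d _] := nbhs_singleton (near_jacobian2 mu_twice).
by rewrite /lframe /jacobian2 (jacobian_near mul_rep1l d) -[RHS](jacobian_id w0).
Qed.

Lemma lframe_unit : \forall w \near w0, lframe w \in unitmx.
Proof.
have [dl _] := derive_jacobian2 mu_twice.
apply: near_unitmx dl _; rewrite [X in X \in _]lframe0; exact: unitmx1.
Qed.

Definition Adx w := Ad (X w).

(** This is the derivative of [xi * (xi^-1 * w * xi) = w * xi] in [w]. *)
Lemma Adx_lframe : \forall w \near w0, Adx w *m lframe w = rframe w.
Proof.
have nd := near_jacobian2 mu_twice; apply: filterS nd => w [dw _].
have dw' : differentiable (fun w' => mu (w, w')) (conj_rep (X w) w0) by rewrite conj_rep0.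
rewrite /Adx /Ad /lframe /jacobian2 -[X in _ *m 'J _ X](conj_rep0 (X w)).
rewrite -(jacobian_comp (conj_rep_diff (X w)) dw').
apply: jacobian_near; last exact: (differentiable_comp (conj_rep_diff (X w)) dw').
have nw := near_e (near_conj (X w) near1_dom); apply: filterS nw => w' ew'.
by rewrite /mul_rep /conj_rep /= (chart_mapK (ac Ae) ew') mulVKg.
Qed.

Lemma Adx_diff : differentiable Adx w0.
Proof.
have [dl _] := derive_jacobian2 mu_twice; have [dr _] := derive_jacobian1 mu_twice.
have dI := differentiable_invmx dl (nbhs_singleton lframe_unit).
have dRI : differentiable (fun w => rframe w *m invmx (lframe w)) w0 := differentiable_mulmx dr dI.
apply: near_eq_differentiable dRI.
have nw : \forall w \near w0, lframe w \in unitmx /\ Adx w *m lframe w = rframe w.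
  by apply: filterI; [exact: lframe_unit | exact: Adx_lframe].
apply: filterS nw => w [uw <-]; exact: mulmxK.
Qed.

Lemma Adx0 : Adx w0 = 1%:M.
Proof. by rewrite /Adx X0 Ad1. Qed.

Definition ad a := 'D_a Adx w0.

(** Differentiate [Adx_lframe] at the identity, where both frames are the
    identity matrix: the derivative of the left frame is [lie_bil] and that of the
    right frame is its transpose. *)
Lemma adE a x : x *m ad a = lie_br x a.
Proof.
have [dl El] := derive_jacobian2 mu_twice; have [dr Er] := derive_jacobian1 mu_twice.
have K : ad a = 'D_a (jacobian1 mu w0) w0 - 'D_a (jacobian2 mu w0) w0.
  exact: (derive_mulmx_at1 _ Adx_diff dl Adx0 lframe0 Adx_lframe).
rewrite K mulmxBr; exact: (congr2 (fun p q => p - q) (Er a x) (El a x)).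
Qed.

Lemma ad_lin k a b : ad (k *: a + b) = k *: ad a + ad b.
Proof. by rewrite /ad (deriveDv _ _ Adx_diff) (deriveZv _ _ Adx_diff). Qed.

Let conj_Adx xi : \forall w \near w0, Adx xi *m Adx (conj_rep (X xi) w) = Adx w *m Adx xi.
Proof.
have nw := near_e (near_conj (X xi) near1_dom); apply: filterS nw => w ew.
have H : X xi *g X (conj_rep (X xi) w) = X w *g X xi.
  by rewrite /conj_rep (chart_mapK (ac Ae) ew) mulVKg.
exact: etrans (esym (AdM (X xi) (X (conj_rep (X xi) w)))) (etrans (congr1 Ad H) (AdM (X w) (X xi))).
Qed.

(** Differentiate in [w] the multiplicativity of [Ad] on
    [xi * (xi^-1 * w * xi) = w * xi]. *)
Lemma ad_Adx xi b : Adx xi *m ad (b *m Adx xi) = ad b *m Adx xi.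
Proof.
have dc := conj_rep_diff (X xi).
have bc : 'D_b (conj_rep (X xi)) w0 = b *m Adx xi := deriveEjacobian b dc.
have H := derive_intertwine b Adx_diff dc (conj_rep0 (X xi)) (conj_Adx xi).
by rewrite bc in H; exact: H.
Qed.

(** The derivative in [xi] of [ad_Adx]; evaluated on a vector it is the Jacobi
    identity. *)
Lemma ad_jacobi a b : ad a *m ad b + ad (b *m ad a) = ad b *m ad a.
Proof.
have dA := Adx_diff.
have H : 'D_a (fun xi => Adx xi *m ad (b *m Adx xi)) w0 = ad b *m ad a.
  apply: etrans (derive_mulmxl (ad b) (diff_derivable (v := a) dA)).
  by congr ('D_a _ w0); apply/funext => xi; exact: ad_Adx.
apply: etrans _ H.
exact: (esym (derive_mulmx_lin a b ad_lin dA Adx0)).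
Qed.

Lemma lie_brN a b : lie_br a b = - lie_br b a.
Proof. by rewrite /lie_br opprB. Qed.

Lemma lie_brL k x y z : lie_br (k *: x + y) z = k *: lie_br x z + lie_br y z.
Proof.
have E (T : 'M[R]_m) : (k *: x + y) *m T = k *: (x *m T) + y *m T by rewrite mulmxDl scalemxAl.
by rewrite -[LHS](adE z) -(adE z x) -(adE z y) E.
Qed.

Lemma lie_br_jacobi x y z :
  lie_br x (lie_br y z) = lie_br (lie_br x y) z + lie_br y (lie_br x z).
Proof.
move: ad lie_br adE lie_brN ad_jacobi => T br E N JT.
have := congr1 (fun M => x *m M) (JT z y).
by rewrite mulmxDr !mulmxA !E => <-; rewrite [br y (br x z)]N addrAC addrN add0r.
Qed.

Let inv_rep w := cmap e (X w)^-1%g.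

Let inv_rep0 : inv_rep w0 = w0. Proof. by rewrite /inv_rep X0 invg1. Qed.

Let inv_rep_diff : differentiable inv_rep w0.
Proof.
have e1' : cdom e (1^-1)%g by rewrite invg1.
have [/nbhs_singleton d _] := smooth_map_local_rep (ac Ae) (ac Ae) (lie_inv_smooth hG)
  Ae Ae (filterT : nbhs (1%g : G) setT) e1 e1'.
exact: d.
Qed.

Let inv_near1 (N : set G) : nbhs (1%g : G) N -> \forall x \near (1%g : G), N (x^-1)%g.
Proof. by move=> n1; apply: inv_near; rewrite invg1. Qed.

Lemma near_comm (y : G) (N : set G) : nbhs (1%g : G) N ->
  \forall x \near (1%g : G), N (commg x y).
Proof.
move=> n1; have := @mul_near 1%g 1%g N; rewrite mul1g => /(_ n1) [[N1 N2] /= [n1' n2] sub].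
have nx : \forall x \near (1%g : G), N1 (x^-1)%g /\ N2 (y^-1 *g (x *g y))%g.
  by apply: filterI; [exact: inv_near1 | exact: near_conj].
by apply: filterS nx => x [h1 h2]; exact: (sub (_, _)).
Qed.

Let comm_rep_mul y :
  \forall w \near w0, comm_rep y w = mu (inv_rep w, conj_rep y w).
Proof.
have nw : \forall w \near w0, cdom e (X w)^-1%g /\ cdom e (y^-1 *g (X w *g y))%g.
  apply: filterI; first exact: (near_e (inv_near1 near1_dom)).
  exact: (near_e (near_conj y near1_dom)).
apply: filterS nw => w [d1 d2].
by rewrite /comm_rep /mul_rep /= (chart_mapK (ac Ae) d1) (chart_mapK (ac Ae) d2).
Qed.

Lemma comm_rep_diff y : differentiable (comm_rep y) w0.
Proof.
have dm : differentiable mu (inv_rep w0, conj_rep y w0).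
  by rewrite inv_rep0 conj_rep0; exact: (nbhs_singleton mu_twice.1).
have [d _] := jacobian_pair_comp inv_rep_diff (conj_rep_diff y) dm.
by apply: near_eq_differentiable d; apply: filterS (comm_rep_mul y) => w ->.
Qed.

Let mul_comm_rep y : \forall w \near w0, mu (w, comm_rep y w) = conj_rep y w.
Proof.
have nw := near_e (near_comm y near1_dom); apply: filterS nw => w dw.
by rewrite /comm_rep /mul_rep /= (chart_mapK (ac Ae) dw) mulVKg.
Qed.

(** Differentiate [w * comm (w, y) = y^-1 * w * y] in [w]. *)
Lemma jacobian_comm_rep y : 'J (comm_rep y) w0 = Ad y - 1%:M.
Proof.
have di : differentiable id w0 by [].
have dm : differentiable mu (id w0, comm_rep y w0).
  by rewrite comm_rep0; exact: (nbhs_singleton mu_twice.1).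
have [d E] := jacobian_pair_comp di (comm_rep_diff y) dm.
have l0 : jacobian2 mu w0 w0 = 1%:M by exact: lframe0.
have r0 : jacobian1 mu w0 w0 = 1%:M.
  have d1 : differentiable (fun w => mu (w, w0)) w0.
    by have [] := nbhs_singleton (near_jacobian1 mu_twice).
  by apply: etrans (jacobian_near mul_rep1r d1) (jacobian_id w0).
have J1 : 'J (fun w => mu (w, comm_rep y w)) w0 = Ad y.
  exact: jacobian_near (mul_comm_rep y) d.
have := etrans (esym E) J1; rewrite comm_rep0 jacobian_id.
move: ('J (comm_rep y) w0) (Ad y) => p q.
rewrite [X in 1%:M *m X + _]r0 [X in _ + _ *m X]l0 !mulmx1 => <-.
by rewrite addrC addKr.
Qed.

Let comm_reps (s : seq G) w := foldl (fun w y => comm_rep y w) w s.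

Let comm_reps0 s : comm_reps s w0 = w0.
Proof. by elim/last_ind: s => [//|s y IH]; rewrite /comm_reps foldl_rcons -/(comm_reps s w0) IH comm_rep0. Qed.

Let near_comms (s : seq G) (N : set G) : nbhs (1%g : G) N ->
  \forall x \near (1%g : G), N (foldl (@commg G) x s).
Proof.
elim: s => [//|y s IH] n1 /=.
exact: (near_comm y (IH n1)).
Qed.

Let comm_repsE s : \forall w \near w0, comm_reps s w = cmap e (foldl (@commg G) (X w) s).
Proof.
elim/last_ind: s => [|s y IH].
  by apply: filterS ran_near => w rw /=; have [] := chart_ranP (ac Ae) rw.
have nw : \forall w \near w0, comm_reps s w = cmap e (foldl (@commg G) (X w) s)
   /\ cdom e (foldl (@commg G) (X w) s).
  by apply: filterI => //; exact: (near_e (near_comms s near1_dom)).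
apply: filterS nw => w [E d].
by rewrite /comm_reps !foldl_rcons -/(comm_reps s w) E /comm_rep (chart_mapK (ac Ae) d).
Qed.

Let Ad1prod (s : seq G) : 'M[R]_m := foldl (fun M y => M *m (Ad y - 1%:M)) 1%:M s.

Let comm_reps_jacobian s : differentiable (comm_reps s) w0 /\ 'J (comm_reps s) w0 = Ad1prod s.
Proof.
elim/last_ind: s => [|s y [d E]].
  by split; [| exact: jacobian_id].
have dy : differentiable (comm_rep y) (comm_reps s w0) by rewrite comm_reps0; exact: comm_rep_diff.
have -> : comm_reps (rcons s y) = comm_rep y \o comm_reps s.
  by apply/funext => w; rewrite /comm_reps foldl_rcons.
split; first exact: differentiable_comp.
rewrite (jacobian_comp d dy) E /Ad1prod foldl_rcons -/(Ad1prod s); congr (_ *m _).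
by rewrite comm_reps0 jacobian_comm_rep.
Qed.

Let lower_comms k (s : seq G) x : lower_central k x ->
  lower_central (size s + k) (foldl (@commg G) x s).
Proof.
elim: s k x => [//|y s IH] k x xk.
have := IH k.+1 (commg x y); rewrite -addSnnS; apply.
by apply: sub_gen_smallest; exists x, y.
Qed.

Section Nilpotent.
Variable K : nat.
Hypothesis nilK : lower_central K = [set (1%g : G)].

Let Ad1prod_nil s : size s = K -> Ad1prod s = 0.
Proof.
move=> sK; have [d <-] := comm_reps_jacobian s.
have cst_s : \forall w \near w0, comm_reps s w = cst w0 w.
  apply: filterS (comm_repsE s) => w ->; congr (cmap e _).
  have : lower_central (size s + 0) (foldl (@commg G) (X w) s) by exact: lower_comms.
  by rewrite addn0 sK nilK.
exact: etrans (jacobian_near cst_s d) (jacobian_cst _ _).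
Qed.

Let adprod (s : seq 'rV[R]_m) : 'M[R]_m := foldr (fun a M => ad a *m M) 1%:M s.

(** The factors [Ad y - 1] are replaced one by one by derivatives: since the
    product vanishes for all [y = X w], its derivative in [w] vanishes too. *)
Lemma Ad1prod_adprod s t : (size s + size t)%N = K -> Ad1prod s *m adprod t = 0.
Proof.
elim: t s => [|a t IH] s st; first by rewrite mulmx1; apply: Ad1prod_nil; rewrite -st addn0.
rewrite /= mulmxA; apply: (derive_sandwich a Adx_diff) => w.
have := IH (rcons s (X w)); rewrite size_rcons addSnnS => /(_ st).
rewrite /Ad1prod foldl_rcons -/(Ad1prod s) mulmxBr mulmx1 mulmxBl => /eqP.
by rewrite subr_eq0 => /eqP.
Qed.

Lemma lie_br_nilpotent s y : size s = K -> foldr lie_br y s = 0.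
Proof.
move=> sK.
have adN a : ad (- a) = - ad a.
  have a0 : ad 0 = 0 by have := ad_lin (-1) 0 0; rewrite scaler0 addr0 scaleN1r addNr.
  by have := ad_lin (-1) a 0; rewrite addr0 a0 addr0 !scaleN1r.
have E (t : seq 'rV[R]_m) z : foldr lie_br z t = z *m adprod (map -%R (rev t)).
  elim/last_ind: t z => [|t a IH] z; first by rewrite mulmx1.
  rewrite foldr_rcons IH rev_rcons /= mulmxA; congr (_ *m _).
  by rewrite lie_brN adN mulmxN adE.
rewrite E -[adprod _]mul1mx -[X in X *m adprod _]/(Ad1prod [::]).
by rewrite Ad1prod_adprod ?mulmx0// size_map size_rev.
Qed.

End Nilpotent.

End LieGroup.

(** * Frames transported by a local diffeomorphism *)

Section FrameCalculus.
Context {R : realType}.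

Lemma near_eq_twice_differentiable (V W : normedModType R) (f g : V -> W) x :
  (\near x, f x = g x) -> twice_differentiable f x -> twice_differentiable g x.
Proof.
move=> fg [df ddf]; have nfg : \forall y \near x, \near y, f y = g y.
  exact/near_join.
split=> [|v].
  have nd : \forall y \near x, (\near y, f y = g y) /\ differentiable f y by apply: filterI.
  by apply: filterS nd => y [h d]; exact: near_eq_differentiable h d.
apply: near_eq_differentiable (ddf v).
by apply: filterS nfg => y h; exact: near_eq_derive.
Qed.

Lemma derive_jacobian m n (f : 'rV[R]_m -> 'rV[R]_n) x :
  twice_differentiable f x -> differentiable (jacobian f) x /\
  forall a b, b *m 'D_a (jacobian f) x = 'D_a ('D_b f) x.
Proof.
move=> [df ddf].
have E b : \near x, 'D_b f x = b *m 'J f x.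
  by apply: filterS df => y dy; exact: deriveEjacobian.
have d : differentiable (jacobian f) x.
  by apply: differentiable_rows => b; exact: near_eq_differentiable (E b) (ddf b).
split=> // a b; rewrite -(derive_mulmxl b (diff_derivable (v := a) d)).
exact/esym/near_eq_derive.
Qed.

(** [Psi] is a local diffeomorphism with local inverse [psi], and [F] is the
    image by [Psi] of the frame [L]. *)
Section MovingFrame.
Variables (m : nat) (Psi psi : 'rV[R]_m -> 'rV[R]_m) (L F : 'rV[R]_m -> 'M[R]_m) (w0 : 'rV[R]_m).
Local Notation u0 := (Psi w0).
Hypothesis dPsi : twice_differentiable Psi w0.
Hypothesis dpsi : differentiable psi (Psi w0).
Hypothesis psiK : \forall w \near w0, psi (Psi w) = w.
Hypothesis PsiK : \forall u \near Psi w0, Psi (psi u) = u.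
Hypothesis dL : differentiable L w0.
Hypothesis L0 : L w0 = 1%:M.
Hypothesis FPsi : \forall w \near w0, F (Psi w) = L w *m 'J Psi w.

Let psi0 : psi (Psi w0) = w0. Proof. exact: nbhs_singleton psiK. Qed.

Lemma moving_frame0 : F u0 = 'J Psi w0.
Proof. by rewrite (nbhs_singleton FPsi) L0 mul1mx. Qed.

Lemma moving_frame_unit : F u0 \in unitmx.
Proof.
have d0 := nbhs_singleton dPsi.1; rewrite moving_frame0.
have E : 'J Psi w0 *m 'J psi u0 = 1%:M.
  rewrite -(jacobian_comp d0 dpsi) -[RHS](jacobian_id w0); apply: jacobian_near psiK _.
  exact: differentiable_comp.
move: ('J Psi w0) ('J psi u0) E => A B E.
have E' : (A : 'M[R]_m) *m (B : 'M[R]_m) = 1%:M := E.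
by case: (mulmx1_unit E').
Qed.

Let dH : differentiable (fun w => L w *m 'J Psi w) w0.
Proof. by apply: differentiable_mulmx => //; have [] := derive_jacobian dPsi. Qed.

Lemma moving_frame_diff : differentiable F u0.
Proof.
have dH' : differentiable (fun w => L w *m 'J Psi w) (psi u0) by rewrite psi0.
apply: near_eq_differentiable (differentiable_comp dpsi dH').
have n1 : \forall u \near u0, F (Psi (psi u)) = L (psi u) *m 'J Psi (psi u).
  have h : \forall w \near psi u0, F (Psi w) = L w *m 'J Psi w by rewrite psi0.
  exact: (differentiable_cvg dpsi h).
have n2 : \forall u \near u0, F (Psi (psi u)) = L (psi u) *m 'J Psi (psi u) /\ Psi (psi u) = u.
  by apply: filterI.
by apply: filterS n2 => u /= [<- ->].
Qed.

Lemma moving_frame_derive a b :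
  b *m 'D_(a *m F u0) F u0 = b *m 'D_a L w0 *m F u0 + 'D_a ('D_b Psi) w0.
Proof.
have d0 := nbhs_singleton dPsi.1.
have [dJ EJ] := derive_jacobian dPsi.
have E1 : 'D_a (F \o Psi) w0 = 'D_(a *m F u0) F u0.
  by rewrite (derive_comp a d0 moving_frame_diff) (deriveEjacobian a d0) moving_frame0.
have E2 : 'D_a (F \o Psi) w0 = 'D_a (fun w => L w *m 'J Psi w) w0.
  exact: near_eq_derive.
have [_ E3] := derive_mulmx (diff_derivable (v := a) dL) (diff_derivable (v := a) dJ).
by rewrite -E1 E2 E3 L0 mul1mx mulmxDr EJ mulmxA -moving_frame0.
Qed.

Let cancel_second (x1 x2 p1 p2 q : 'rV[R]_m) (f : 'M[R]_m) :
  x1 = p1 *m f + q -> x2 = p2 *m f + q -> x1 - x2 = (p1 - p2) *m f.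
Proof. by move=> -> ->; rewrite mulmxBl opprD addrACA subrr addr0. Qed.

(** The brackets of [F] only involve the derivative of [L], since the second
    derivatives of [Psi] cancel by symmetry. *)
Lemma moving_frame_bracket a b :
  b *m 'D_(a *m F u0) F u0 - a *m 'D_(b *m F u0) F u0
    = (b *m 'D_a L w0 - a *m 'D_b L w0) *m F u0.
Proof.
have S := derive_sym_rV b a dPsi.
apply: cancel_second (moving_frame_derive a b) _.
exact: etrans (moving_frame_derive b a) (congr1 (fun q => _ + q) (esym S)).
Qed.

End MovingFrame.

(** [DF v] and [DJ v] stand for the derivatives of the frame and of the complex
    structure at a point, related by the derivative of [J0 *m F = F *m J]. *)
Lemma frame_integrable_algebra m (f J J0 : 'M[R]_m) (DF DJ : 'rV[R]_m -> 'M[R]_m)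
    (rb : 'rV[R]_m -> 'rV[R]_m -> 'rV[R]_m) :
  f \in unitmx -> J0 *m f = f *m J -> J *m J = - 1%:M ->
  (forall v, f *m DJ v = J0 *m DF v - DF v *m J) ->
  (forall a b, b *m DF (a *m f) - a *m DF (b *m f) = rb a b *m f) ->
  (forall a b, b *m DJ (a *m J) - a *m DJ (b *m J) + a *m DJ b *m J - b *m DJ a *m J = 0) ->
  forall x y, rb (x *m J0) (y *m J0) - rb (x *m J0) y *m J0 - rb x (y *m J0) *m J0 - rb x y = 0.
Proof.
move=> uf fJ J2 E B K x y; have := K (x *m f) (y *m f).
have fJx (a : 'rV[R]_m) : a *m f *m J = a *m J0 *m f by rewrite -!mulmxA fJ.
have KE (a : 'rV[R]_m) v : a *m f *m DJ v = a *m J0 *m DF v - a *m DF v *m J.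
  by rewrite -mulmxA E mulmxBr !mulmxA.
rewrite !fJx !KE => H.
have inj : injective (fun z : 'rV[R]_m => z *m f).
  by move=> z z' zz; rewrite -(mulmxK uf z) -(mulmxK uf z') zz.
apply: inj; rewrite mul0mx !mulmxBl -!fJx -!B -[RHS]H.
have JJ (a : 'rV[R]_m) : a *m J *m J = - a by rewrite -mulmxA J2 mulmxN mulmx1.
rewrite !mulmxBl !JJ.
move: (DF (x *m J0 *m f)) (DF (y *m J0 *m f)) (DF (x *m f)) (DF (y *m f)) => Dxj Dyj Dx Dy.
move: (y *m J0 *m Dxj) (x *m J0 *m Dyj) (y *m Dxj *m J) (x *m J0 *m Dy *m J)
  (x *m Dyj *m J) (y *m J0 *m Dx *m J) (x *m Dy) (y *m Dx) => p1 p2 p3 p4 p5 p6 p7 p8.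
apply/rowP => j; rewrite !mxE; ring.
Qed.

(** The Nijenhuis tensor of [J] is tensorial: its vanishing on coordinate fields
    gives its vanishing on the fields of the frame, where [J] is constant. *)
Lemma frame_integrable m (F J : 'rV[R]_m -> 'M[R]_m) (J0 : 'M[R]_m)
    (rb : 'rV[R]_m -> 'rV[R]_m -> 'rV[R]_m) u :
  differentiable F u -> differentiable J u -> F u \in unitmx ->
  (\near u, J0 *m F u = F u *m J u) -> J u *m J u = - 1%:M ->
  (forall a b, b *m 'D_(a *m F u) F u - a *m 'D_(b *m F u) F u = rb a b *m F u) ->
  (forall a b : 'rV[R]_m, nijenhuis J (cst a) (cst b) u = 0) ->
  forall x y, rb (x *m J0) (y *m J0) - rb (x *m J0) y *m J0 - rb x (y *m J0) *m J0 - rb x y = 0.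
Proof.
move=> dF dJ uF FJ J2 brF NJ.
apply: (@frame_integrable_algebra _ (F u) (J u) J0 (fun v => 'D_v F u) (fun v => 'D_v J u) rb) => //.
- exact: nbhs_singleton FJ.
- move=> v.
  have e1 : 'D_v (fun w => J0 *m F w) u = 'D_v (fun w => F w *m J w) u.
    exact: near_eq_derive.
  have [_ e2] := derive_mulmx (diff_derivable (v := v) dF) (diff_derivable (v := v) dJ).
  have e3 := derive_mulmxl J0 (diff_derivable (v := v) dF).
  have e := etrans (esym e3) (etrans e1 e2).
  exact: (canRL (addrK _) (esym (etrans e (addrC _ _)))).
- move=> a b.
  have dc (z : 'rV[R]_m) v : 'D_v (fun w => z *m J w) u = z *m 'D_v J u.
    exact: derive_mulmxl (diff_derivable (v := v) dJ).
  have c0 (z : 'rV[R]_m) v : 'D_v (cst z) u = 0 by exact: derive_cst.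
  have N : nijenhuis J (cst a) (cst b) u =
      (b *m 'D_(a *m J u) J u - a *m 'D_(b *m J u) J u) - (0 - a *m 'D_b J u) *m J u
      - (b *m 'D_a J u - 0) *m J u - (0 - 0).
    by rewrite /nijenhuis /lie_bracket !dc !c0.
  have := etrans (esym N) (NJ a b).
  move: ('D_(a *m J u) J u) ('D_(b *m J u) J u) ('D_a J u) ('D_b J u) => p q r s.
  by rewrite !subr0 sub0r mulNmx opprK.
Qed.

Lemma smooth_on_cst (V W : normedModType R) (U : set V) (a : W) : smooth_on U (cst a).
Proof.
move=> k; elim: k a => [|k IH] a /=; first by move=> x _; exact: cst_continuous.
split=> [x _|v]; first exact: differentiable_cst.
have -> : (fun x => 'D_v (cst a) x) = cst 0 by apply/funext => x; rewrite derive_cst.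
exact: IH.
Qed.

End FrameCalculus.

(** * The invariant frame of a nilmanifold *)

Section Nilmanifold.
Context {R : realType} {m : nat} {G : topGroupType} (AG : set (chart R m G)).
Context (Gamma : set G) {M : topologicalType} (AM : set (chart R m M)) (pr : G -> M).
Hypothesis hM : nilmanifold AG Gamma AM pr.
Variable e : chart R m G.
Hypothesis Ae : AG e.
Hypothesis e1 : cdom e 1%g.

Local Notation "x *g y" := (x * y)%g (at level 40, left associativity).
Local Notation X := (cinv e).
Local Notation w0 := (cmap e 1%g).
Local Notation mu := (mul_rep e e e).

Let hG : lie_group AG := nil_lie hM.
Let ac c : AG c -> is_chart c := atlas_chart (lie_atlas hG) (c := c).
Let am c : AM c -> is_chart c := atlas_chart (nil_atlas hM) (c := c).
Let X0 : X w0 = 1%g. Proof. exact: (chart_mapK (ac Ae) e1). Qed.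

Let near_e (N : set G) : nbhs (1%g : G) N -> \forall w \near w0, N (X w).
Proof. exact: (chart_inv_near (ac Ae) e1). Qed.

Let near_l x (N : set G) : nbhs x N -> \forall y \near (1%g : G), N (x *g y).
Proof. by move=> n; apply: (left_near hG); rewrite mulg1. Qed.

Let ran_near : \forall w \near w0, cran e w. Proof. exact: (chart_ran_near (ac Ae) e1). Qed.

Let near1_dom : nbhs (1%g : G) (cdom e). Proof. exact: (chart_dom_nbhs (ac Ae) e1). Qed.

Let pr_near x (N : set M) : nbhs (pr x) N -> \forall y \near x, N (pr y).
Proof. by have [[pc _] _] := nil_covering hM; exact: (pc x I). Qed.

(** The orbit map of [x] followed by the covering map, in the charts [e] and
    [c]. *)
Definition chart_pr (c : chart R m M) x w := cmap c (pr (x *g X w)).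

Lemma chart_pr_lift c x y : pr x = pr y -> chart_pr c x = chart_pr c y.
Proof.
move=> /(nil_fibre hM)[a Ga ->]; apply/funext => w; congr (cmap c _).
by apply/(nil_fibre hM); exists a => //; rewrite mulgA.
Qed.

Lemma chart_pr0 c x : chart_pr c x w0 = cmap c (pr x).
Proof. by rewrite /chart_pr X0 mulg1. Qed.

Section Point.
Variables (c : chart R m M) (x : G).
Hypothesis Ac : AM c.
Hypothesis cx : cdom c (pr x).

Local Notation left_rep d := (local_rep e d (left_translation x)).

Let left0 d : left_rep d w0 = cmap d x.
Proof. by rewrite /local_rep /left_translation /= X0 mulg1. Qed.

Lemma left_rep_diff d : AG d -> cdom d x -> twice_differentiable (left_rep d) w0.
Proof.
move=> Ad dx; have dx1 : cdom d (x *g 1)%g by rewrite mulg1.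
exact: (left_rep_twice hG Ae Ad e1 dx1).
Qed.

Lemma pr_rep_diff d : AG d -> cdom d x -> twice_differentiable (local_rep d c pr) (left_rep d w0).
Proof.
move=> Ad dx; rewrite left0; have [ps _] := nil_covering hM.
exact: (smooth_map_local_rep (ac Ad) (am Ac) ps Ad Ac filterT dx cx).
Qed.

Lemma chart_pr_factor d : AG d -> cdom d x ->
  \forall w \near w0, local_rep d c pr (left_rep d w) = chart_pr c x w.
Proof.
move=> Ad dx; have nd := near_e (near_l (chart_dom_nbhs (ac Ad) dx)).
apply: filterS nd => w dw; rewrite /local_rep /left_translation /=.
by rewrite (chart_mapK (ac Ad) dw).
Qed.

Lemma chart_pr_twice : twice_differentiable (chart_pr c x) w0.
Proof.
have [d Ad dx] := atlas_cover (lie_atlas hG) x.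
have t := twice_differentiable_comp (left_rep_diff Ad dx) (pr_rep_diff Ad dx).
by apply: near_eq_twice_differentiable t; exact: chart_pr_factor.
Qed.

Lemma jacobian_chart_pr d : AG d -> cdom d x ->
  'J (chart_pr c x) w0 = 'J (left_rep d) w0 *m 'J (local_rep d c pr) (left_rep d w0).
Proof.
move=> Ad dx.
have d1 := nbhs_singleton (left_rep_diff Ad dx).1.
have d2 := nbhs_singleton (pr_rep_diff Ad dx).1.
have E := jacobian_near (chart_pr_factor Ad dx) (differentiable_comp d1 d2).
exact: etrans (esym E) (jacobian_comp d1 d2).
Qed.

(** The inverse is [x^-1] times a local section of the covering map. *)
Lemma chart_pr_inverse : exists psi : 'rV[R]_m -> 'rV[R]_m,
  [/\ differentiable psi (chart_pr c x w0),
      \forall w \near w0, psi (chart_pr c x w) = w &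
      \forall u \near chart_pr c x w0, chart_pr c x (psi u) = u].
Proof.
have [_ /(_ x) [U [s [oU Ux oprU sK ss]]]] := nil_covering hM.
have nU : nbhs x U by exact: open_nbhs_nbhs.
have nprU : nbhs (pr x) (pr @` U) by apply: open_nbhs_nbhs; split=> //; exists x.
have [d Ad dx] := atlas_cover (lie_atlas hG) x.
have sx : s (pr x) = x by exact: sK.
have dsx : cdom d (s (pr x)) by rewrite sx.
have ds := smooth_map_local_rep (am Ac) (ac Ad) ss Ac Ad nprU cx dsx.
have ex : cdom e (x^-1 *g x)%g by rewrite mulVg.
have dl := left_rep_twice hG Ad Ae dx ex.
pose psi u := cmap e (x^-1 *g s (cinv c u))%g.
have nscts : \forall u \near cmap c (pr x), cdom d (s (cinv c u)) /\ cdom e (x^-1 *g s (cinv c u))%g.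
  have [sc _] := ss; have sc' := sc (pr x) (nbhs_singleton nprU).
  have n2 : nbhs (s (pr x)) [set y | cdom d y /\ cdom e (x^-1 *g y)%g].
    apply: filterI; first exact: (chart_dom_nbhs (ac Ad) dsx).
    apply: (left_near hG); rewrite sx mulVg; exact: near1_dom.
  exact: (chart_inv_near (am Ac) cx (sc' _ n2)).
exists psi; split.
- rewrite chart_pr0.
  have d1 := nbhs_singleton ds.1.
  have d2 : differentiable (fun w => cmap e (x^-1 *g cinv d w)%g) (local_rep c d s (cmap c (pr x))).
    have -> : local_rep c d s (cmap c (pr x)) = cmap d x.
      by rewrite /local_rep /= (chart_mapK (am Ac) cx) sx.
    exact: nbhs_singleton dl.1.
  apply: near_eq_differentiable (differentiable_comp d1 d2).
  apply: filterS nscts => u [du _].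
  by rewrite /local_rep /psi /= (chart_mapK (ac Ad) du).
- have nw : \forall w \near w0, (U (x *g X w) /\ cdom c (pr (x *g X w))) /\ cran e w.
    apply: filterI ran_near; apply: filterI; first exact: (near_e (near_l nU)).
    exact: (near_e (near_l (pr_near (chart_dom_nbhs (am Ac) cx)))).
  apply: filterS nw => w [[Uw cw] rw].
  rewrite /psi /chart_pr (chart_mapK (am Ac) cw) (sK _ Uw) mulKg.
  by have [] := chart_ranP (ac Ae) rw.
- rewrite chart_pr0.
  have nu : \forall u \near cmap c (pr x), (cdom d (s (cinv c u)) /\ cdom e (x^-1 *g s (cinv c u))%g)
     /\ (cran c u /\ (pr @` U) (cinv c u)).
    apply: filterI => //; apply: filterI; first exact: (chart_ran_near (am Ac) cx).
    exact: (chart_inv_near (am Ac) cx nprU).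
  apply: filterS nu => u [[_ eu] [ru [y Uy yu]]].
  rewrite /chart_pr /psi (chart_mapK (ac Ae) eu) mulVKg -yu (sK _ Uy) yu.
  by have [] := chart_ranP (am Ac) ru.
Qed.

End Point.

Let lift_ex (y : M) : exists x, pr x = y := nil_surj hM y.
Definition lift y : G := sval (cid (lift_ex y)).
Lemma liftK y : pr (lift y) = y. Proof. exact: svalP (cid (lift_ex y)). Qed.

(** The frame of [M] which lifts to the left invariant frame of [G]: it does
    not depend on the lift since [Gamma] acts by left translations. *)
Definition frame c u : 'M[R]_m := 'J (chart_pr c (lift (cinv c u))) w0.

Lemma frameE c x : is_chart c -> cdom c (pr x) -> frame c (cmap c (pr x)) = 'J (chart_pr c x) w0.
Proof.
move=> cc cx; rewrite /frame (chart_mapK cc cx).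
by rewrite (chart_pr_lift c (liftK (pr x))).
Qed.

Let mu_twice : twice_differentiable mu (w0, w0).
Proof. by apply: (mul_rep_twice hG) => //; rewrite mul1g. Qed.

(** By associativity [chart_pr c (x * X w) w'] is [chart_pr c x] at the product of
    [w] and [w'], so that [frame] is the image of the left invariant frame of [G]. *)
Lemma frame_chart_pr c x : AM c -> cdom c (pr x) ->
  \forall w \near w0, frame c (chart_pr c x w) = lframe e w *m 'J (chart_pr c x) w.
Proof.
move=> Ac cx; have [dP _] := chart_pr_twice Ac cx.
have nw : \forall w \near w0, ((cdom c (pr (x *g X w)) /\ cdom e (X w)) /\
    (mu (w, w0) = w /\ differentiable (chart_pr c x) w)) /\
    differentiable (fun w' => mu (w, w')) w0.
  apply: filterI; last by apply: filterS (near_jacobian2 mu_twice) => w [].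
  apply: filterI; apply: filterI => //.
  - exact: (near_e (near_l (pr_near (chart_dom_nbhs (am Ac) cx)))).
  - exact: (near_e near1_dom).
  - exact: (mul_rep1r hG Ae e1).
apply: filterS nw => w [[[cw ew] [mw dw]] dmu].
rewrite (frameE (am Ac) cw).
have dw' : differentiable (chart_pr c x) (mu (w, w0)) by rewrite mw.
have E := jacobian_comp dmu dw'; rewrite mw in E.
apply: etrans E; apply/esym/jacobian_near; last exact: (differentiable_comp dmu dw').
have nw' := near_e (near_l (chart_dom_nbhs (ac Ae) ew)).
apply: filterS nw' => w' ew'.
by rewrite /chart_pr /mul_rep /= (chart_mapK (ac Ae) ew') mulgA.
Qed.

Lemma frame_properties c u : AM c -> cran c u ->
  [/\ frame c u \in unitmx, differentiable (frame c) u &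
   forall a b, b *m 'D_(a *m frame c u) (frame c) u - a *m 'D_(b *m frame c u) (frame c) u
     = lie_br e a b *m frame c u].
Proof.
move=> Ac cu; have [cy cE] := chart_ranP (am Ac) cu.
set x := lift (cinv c u).
have cx : cdom c (pr x) by rewrite /x liftK.
have uE : u = chart_pr c x w0 by rewrite chart_pr0 /x liftK.
have [psi [dpsi psiK PsiK]] := chart_pr_inverse Ac cx.
have tP := chart_pr_twice Ac cx.
have [dl El] := derive_jacobian2 mu_twice.
have l0 := lframe0 hG Ae e1.
have FP := frame_chart_pr Ac cx.
have b1 := moving_frame_unit tP dpsi psiK l0 FP.
have b2 := moving_frame_diff tP dpsi psiK PsiK dl FP.
have b3 := moving_frame_bracket tP dpsi psiK PsiK dl l0 FP.
move: uE => ->; split; [exact: b1 | exact: b2 |] => a b.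
apply: etrans (b3 a b) _; congr (_ *m _).
exact: (congr2 (fun p q => p - q) (El a b) (El b a)).
Qed.

Section InvariantTensors.
Variables (c : chart R m M) (u : 'rV[R]_m).
Hypothesis Ac : AM c.
Hypothesis cu : cran c u.

(* The Jacobian matrix which defines [frame] factors through a left translation of [G]
   followed by the covering map. *)
Let frame_factor : exists d x,
  let L := local_rep e d (left_translation x) in let P := local_rep d c pr in
  [/\ AG d, cran e w0, cdom d (left_translation x (X w0)), cran d (L w0) &
     [/\ cdom c (pr (cinv d (L w0))), P (L w0) = u & frame c u = 'J L w0 *m 'J P (L w0)]].
Proof.
have [cy cE] := chart_ranP (am Ac) cu.
pose x := lift (cinv c u); have px : pr x = cinv c u by exact: liftK.
have cx : cdom c (pr x) by rewrite px.
have [d Ad dx] := atlas_cover (lie_atlas hG) x.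
have Lw : local_rep e d (left_translation x) w0 = cmap d x.
  by rewrite /local_rep /left_translation /= X0 mulg1.
exists d, x; split=> //.
- exact: nbhs_singleton ran_near.
- by rewrite /left_translation X0 mulg1.
- by rewrite Lw; exists x.
split; last exact: (jacobian_chart_pr Ac cx Ad dx).
- by rewrite Lw (chart_mapK (ac Ad) dx).
- by rewrite Lw /local_rep /= (chart_mapK (ac Ad) dx) px.
Qed.

Lemma frame_endo J JG : (forall a, endo_related AG AG (left_translation a) JG JG) ->
  endo_related AG AM pr JG J -> JG e w0 *m frame c u = frame c u *m J c u.
Proof.
move=> JL JP; have [d [x [Ad ew dX dw [cw PE ->]]]] := frame_factor.
have H1 := JL x e d Ae Ad w0 ew dX.
have H2 := JP d c Ad Ac _ dw cw.
rewrite /= PE in H2; rewrite /= in H1.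
have alg (A B P Q S : 'M[R]_m) : P *m A = A *m Q -> Q *m B = B *m S ->
  P *m (A *m B) = A *m B *m S by move=> h1 h2; rewrite mulmxA h1 -!mulmxA h2.
exact: alg H1 H2.
Qed.

Lemma frame_metric g gG : (forall a, metric_related AG AG (left_translation a) gG gG) ->
  metric_related AG AM pr gG g -> gG e w0 = frame c u *m g c u *m (frame c u)^T.
Proof.
move=> gL gP; have [d [x [Ad ew dX dw [cw PE ->]]]] := frame_factor.
have H1 := gL x e d Ae Ad w0 ew dX.
have H2 := gP d c Ad Ac _ dw cw.
rewrite /= PE in H2; rewrite /= in H1.
have alg (A B P Q S : 'M[R]_m) : P = A *m Q *m A^T -> Q = B *m S *m B^T ->
  P = A *m B *m S *m (A *m B)^T by move=> -> ->; rewrite trmx_mul !mulmxA.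
exact: alg H1 H2.
Qed.

End InvariantTensors.

End Nilmanifold.

(** * Invariant metrics on nilmanifolds *)

Lemma frame_structure_rows {R : realType} n (F : 'rV[R]_n -> 'M[R]_n) w i j (z : 'rV[R]_n) :
  differentiable F w ->
  delta_mx 0 j *m 'D_(delta_mx 0 i *m F w) F w - delta_mx 0 i *m 'D_(delta_mx 0 j *m F w) F w = z ->
  \sum_l F w i l *: row j (dframe F l w) - \sum_l F w j l *: row i (dframe F l w) = z.
Proof.
move=> dF <-.
have E k k' : \sum_l F w k l *: row k' (dframe F l w)
    = delta_mx 0 k' *m 'D_(delta_mx 0 k *m F w) F w.
  rewrite (derive_rV _ dF) mulmx_sumr; apply: eq_bigr => l _.
  by rewrite [row _ _]rowE -scalemxAr; congr (_ *: _); rewrite -rowE mxE.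
by rewrite !E.
Qed.

Lemma skt_first_gauduchon (R : realType) m (M : topologicalType) (AM : set (chart R m M)) J g :
  skt AM J g -> first_gauduchon AM J g.
Proof.
move=> S c u v Ac cu /=; rewrite /wedge big1 ?mulr0// => s _.
by rewrite (S c u _ Ac cu) mulr0 mul0r.
Qed.

Section GauduchonSkt.
Context {R : realType} {G : topGroupType} (AG : set (chart R 6 G)) (Gamma : set G).
Context {M : topologicalType} (AM : set (chart R 6 M)) (pr : G -> M).
Hypothesis hM : nilmanifold AG Gamma AM pr.
Variables (J g : chart R 6 M -> 'rV[R]_6 -> 'M[R]_6).
Hypothesis hJ : complex_structure AM J.
Hypothesis hJinv : invariant_endo AG AM pr J.
Hypothesis hg : hermitian_metric AM J g.
Hypothesis hginv : invariant_metric AG AM pr g.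

(** On the range of a chart of [M], the invariant frame puts the data in the form
    of [local_gauduchon_skt]: [J0] and [g0] are the values at the identity of the
    left invariant lifts of [J] and [g]. *)
Lemma first_gauduchon_skt : first_gauduchon AM J g -> skt AM J g.
Proof.
move=> GJ c u v Ac cu.
have [JG [_ JL JP]] := hJinv; have [gG [_ gL gP]] := hginv.
have hG := nil_lie hM.
have [e Ae e1] := atlas_cover (lie_atlas hG) (1%g : G).
pose w0 := cmap e 1%g; pose F := frame hM e c; pose J0 := JG e w0; pose g0 := gG e w0.
have oU : open (cran c) := chart_ran_open (atlas_chart (nil_atlas hM) Ac).
have FP w : cran c w -> [/\ F w \in unitmx, differentiable F w &
    forall a b, b *m 'D_(a *m F w) F w - a *m 'D_(b *m F w) F w = lie_br e a b *m F w].
  exact: (frame_properties hM Ae e1 Ac).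
have uF w : cran c w -> F w \in unitmx by move=> /FP[].
have FJ w : cran c w -> J0 *m F w = F w *m J c w.
  by move=> cw; exact: (frame_endo hM Ae e1 Ac cw JL JP).
have Fg w : cran c w -> g0 = F w *m g c w *m (F w)^T.
  by move=> cw; exact: (frame_metric hM Ae e1 Ac cw gL gP).
clearbody F J0 g0.
have [ufu dFu BF] := FP u cu.
have rbN := lie_brN e.
have rbL := lie_brL hG Ae e1.
have rbjac := lie_br_jacobi hG Ae e1.
have rbnil : exists K, forall s : seq 'rV[R]_6, size s = K -> forall y, foldr (lie_br e) y s = 0.
  have [K nK] := nil_nilpotent hM; exists K => s sK y.
  exact: (lie_br_nilpotent hG Ae e1 nK).
have inj (A B : 'M[R]_6) : A *m F u = B *m F u -> A = B.
  by move=> AB; rewrite -(mulmxK ufu A) AB mulmxK.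
have J2u := cs_square hJ Ac cu.
have J2 : J0 *m J0 = - 1%:M.
  apply: inj; rewrite -mulmxA FJ// mulmxA FJ// -mulmxA J2u.
  by rewrite mulmxN mulmx1 mulNmx mul1mx.
have gT : g0^T = g0.
  by rewrite (Fg u cu) !trmx_mul trmxK (hm_sym hg Ac cu) mulmxA.
have gpos (w : 'rV[R]_6) : w != 0 -> 0 < (w *m g0 *m w^T) 0 0.
  move=> w0'; have wF : w *m F u != 0.
    by apply: contra_neq w0' => wF; rewrite -(mulmxK ufu w) wF mul0mx.
  have := hm_pos hg Ac cu wF.
  by rewrite (Fg u cu) trmx_mul !mulmxA.
have gJ : J0 *m g0 *m J0^T = g0.
  rewrite (Fg u cu) !mulmxA FJ// -(mulmxA _ (F u)^T) -trmx_mul FJ// trmx_mul.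
  by rewrite !mulmxA -(mulmxA (F u)) -(mulmxA (F u)) (hm_compat hg Ac cu).
have nU : nbhs u (cran c) by exact: open_nbhs_nbhs.
have dJ : differentiable (J c) u.
  have [/(_ c Ac) sJ _] := cs_field hJ.
  exact: nbhs_singleton (smooth_twice_differentiable sJ nU).1.
have nFJ : \forall w \near u, J0 *m F w = F w *m J c w by apply: filterS nU => w; exact: FJ.
have NJ (a b : 'rV[R]_6) : nijenhuis (J c) (cst a) (cst b) u = 0.
  by apply: (cs_integrable hJ Ac cu); exact: smooth_on_cst.
have rbint := frame_integrable dFu dJ ufu nFJ J2u BF NJ.
have dF w : cran c w -> differentiable F w by move=> /FP[].
have structF w i j : cran c w ->
    \sum_l F w i l *: row j (dframe F l w) - \sum_l F w j l *: row i (dframe F l w)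
     = lie_br e (delta_mx 0 i) (delta_mx 0 j) *m F w.
  move=> /FP[_ dw Bw].
  exact: frame_structure_rows dw (Bw _ _).
have := @local_gauduchon_skt R (cran c) F (J c) (g c) J0 g0 (lie_br e) oU uF dF structF FJ Fg
  rbL rbN rbjac rbnil J2 rbint gT gpos gJ u cu.
by apply=> v'; exact: (GJ c u v' Ac cu).
Qed.

End GauduchonSkt.

Theorem proposition3p3 (R : realType)
    (G : topGroupType) (AG : set (chart R 6 G)) (Gamma : set G)
    (M : topologicalType) (AM : set (chart R 6 M)) (pr : G -> M)
    (hM : nilmanifold AG Gamma AM pr)
    (J : chart R 6 M -> 'rV[R]_6 -> 'M[R]_6)
    (hJ : complex_structure AM J) (hJinv : invariant_endo AG AM pr J)
    (g : chart R 6 M -> 'rV[R]_6 -> 'M[R]_6)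
    (hg : hermitian_metric AM J g) (hginv : invariant_metric AG AM pr g) :
  first_gauduchon AM J g <-> skt AM J g.
Proof.
split; last exact: skt_first_gauduchon.
exact: (first_gauduchon_skt hM hJ hJinv hg hginv).
Qed.
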